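(* The system $\mathsf{RCA}_0^\omega+\mathsf{WKL}$ proves $\mathsf{WHBU}_{\text{ae}}$.
   Context: $\mathsf{RCA}_0^\omega$ is Kohlenbach's base theory of higher-order Reverse Mathematics. $\mathsf{WKL}$ (weak König's lemma): every infinite binary tree has an infinite path. Reals are coded by fast-converging Cauchy sequences; functions on reals are functionals respecting real equality (not necessarily continuous). For $\Psi$ with positive real values, $I_x^\Psi=(x-\Psi(x),x+\Psi(x))$, and $|J|$ denotes the (Lebesgue) length/measure of $J$. $\mathsf{WHBU}$: for every $\Psi:\mathbb{R}\to\mathbb{R}^+$ and every real $\varepsilon>0$, there are pairwise distinct $y_0,\dots,y_k\in[0,1]$ with $1-\varepsilon<\sum_{i\le k}|J^\Psi_{y_i}|$, where $J^\Psi_{y_0}=I^\Psi_{y_0}$ and $J^\Psi_{y_{i+1}}=I^\Psi_{y_{i+1}}\setminus\bigcup_{j\le i}I^\Psi_{y_j}$. A set $E\subseteq[0,1]$ is RM-closed if its complement is given (via a code) as the union of a sequence of basic open intervals with rational endpoints; measure zero means for each $\varepsilon>0$ coverable by a sequence of basic open intervals of total length below $\varepsilon$. $\Psi:[0,1]\to\mathbb{R}$ is continuous almost everywhere if it is continuous at every point outside some RM-closed measure-zero $E\subseteq[0,1]$. $\mathsf{WHBU}_{\text{ae}}$: $\mathsf{WHBU}$ restricted to $\Psi:[0,1]\to\mathbb{R}^+$ continuous almost everywhere. *)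

(* Defs.v *)
From Stdlib Require Import List.
Import ListNotations.
Set Implicit Arguments.
Unset Strict Implicit.

Inductive ty : Type := tN | Arr (σ τ : ty).

Declare Scope ty_scope.
Delimit Scope ty_scope with ty.
Bind Scope ty_scope with ty.
Notation "σ ⇒ τ" := (Arr σ τ) (at level 60, right associativity) : ty_scope.
Open Scope ty_scope.

Notation one := (tN ⇒ tN).
Notation two := (one ⇒ tN).

Definition ctx := list ty.

Inductive var : ctx -> ty -> Type :=
| v0 (Γ : ctx) (σ : ty) : var (σ :: Γ) σ
| vS (Γ : ctx) (σ τ : ty) : var Γ σ -> var (τ :: Γ) σ.
Arguments v0 {Γ σ}.
Arguments vS {Γ σ τ} _.

(** [tK], [tS] are the combinators Π and Σ; [tR] is the recursor [R_0]. *)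
Inductive tm (Γ : ctx) : ty -> Type :=
| tvar (σ : ty) : var Γ σ -> tm Γ σ
| tzero : tm Γ tN
| tsucc : tm Γ (tN ⇒ tN)
| tK (σ τ : ty) : tm Γ (σ ⇒ τ ⇒ σ)
| tS (ρ σ τ : ty) : tm Γ ((ρ ⇒ σ ⇒ τ) ⇒ (ρ ⇒ σ) ⇒ ρ ⇒ τ)
| tR : tm Γ ((tN ⇒ tN ⇒ tN) ⇒ tN ⇒ tN ⇒ tN)
| tapp (σ τ : ty) : tm Γ (σ ⇒ τ) -> tm Γ σ -> tm Γ τ.
Arguments tvar {Γ σ} _.
Arguments tzero {Γ}.
Arguments tsucc {Γ}.
Arguments tK {Γ} σ τ.
Arguments tS {Γ} ρ σ τ.
Arguments tR {Γ}.
Arguments tapp {Γ σ τ} _ _.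

(** The only prime formulas are equations between terms of type 0. *)
Inductive fm : ctx -> Type :=
| Eq0 (Γ : ctx) : tm Γ tN -> tm Γ tN -> fm Γ
| Bot (Γ : ctx) : fm Γ
| Imp (Γ : ctx) : fm Γ -> fm Γ -> fm Γ
| All (Γ : ctx) (σ : ty) : fm (σ :: Γ) -> fm Γ.
Arguments Eq0 {Γ} _ _.
Arguments Bot {Γ}.
Arguments Imp {Γ} _ _.
Arguments All {Γ} σ _.

Fixpoint qf (Γ : ctx) (A : fm Γ) : Prop :=
  match A with
  | Eq0 _ _ => True
  | Bot => True
  | Imp B C => qf B /\ qf C
  | All _ _ => False
  end.

Definition ren (Γ Δ : ctx) := forall σ, var Γ σ -> var Δ σ.
Definition sbst (Γ Δ : ctx) := forall σ, var Γ σ -> tm Δ σ.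

Fixpoint ren_tm (Γ Δ : ctx) (r : ren Γ Δ) (σ : ty) (t : tm Γ σ) : tm Δ σ :=
  match t with
  | tvar v => tvar (r _ v)
  | tzero => tzero
  | tsucc => tsucc
  | tK σ τ => tK σ τ
  | tS ρ σ τ => tS ρ σ τ
  | tR => tR
  | tapp f a => tapp (ren_tm r f) (ren_tm r a)
  end.

Fixpoint sub_tm (Γ Δ : ctx) (s : sbst Γ Δ) (σ : ty) (t : tm Γ σ) : tm Δ σ :=
  match t with
  | tvar v => s _ v
  | tzero => tzero
  | tsucc => tsucc
  | tK σ τ => tK σ τ
  | tS ρ σ τ => tS ρ σ τ
  | tR => tR
  | tapp f a => tapp (sub_tm s f) (sub_tm s a)
  end.

Definition wk (Γ : ctx) (τ : ty) : ren Γ (τ :: Γ) := fun _ v => vS v.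
Arguments wk {Γ τ} _ _.

Definition scons (Γ Δ : ctx) (τ : ty) (t : tm Δ τ) (s : sbst Γ Δ) :
  sbst (τ :: Γ) Δ := fun σ v =>
  match v in var G σ return
    match G with
    | [] => unit
    | τ :: Γ => tm Δ τ -> sbst Γ Δ -> tm Δ σ
    end with
  | v0 => fun t _ => t
  | vS v => fun _ s => s _ v
  end t s.

Definition up (Γ Δ : ctx) (τ : ty) (s : sbst Γ Δ) : sbst (τ :: Γ) (τ :: Δ) :=
  scons (tvar v0) (fun σ v => ren_tm wk (s σ v)).

Fixpoint sub_fm (Γ : ctx) (A : fm Γ) : forall Δ, sbst Γ Δ -> fm Δ :=
  match A in fm Γ return forall Δ, sbst Γ Δ -> fm Δ with
  | Eq0 t u => fun Δ s => Eq0 (sub_tm s t) (sub_tm s u)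
  | Bot => fun Δ s => Bot
  | Imp B C => fun Δ s => Imp (sub_fm B s) (sub_fm C s)
  | All σ B => fun Δ s => All σ (sub_fm B (up s))
  end.

Definition wk_fm (Γ : ctx) (τ : ty) (A : fm Γ) : fm (τ :: Γ) :=
  sub_fm A (fun _ v => tvar (vS v)).

Definition inst (Γ : ctx) (τ : ty) (A : fm (τ :: Γ)) (t : tm Γ τ) : fm Γ :=
  sub_fm A (scons t (fun _ v => tvar v)).

(** Inside a binder, [# t] moves a term [t] of an outer context into the current
    one; the embedding is found by instance resolution and is unique. *)

Class emb (Γ Δ : ctx) := emb_ren : ren Γ Δ.
#[export] Instance emb_refl Γ : emb Γ Γ | 0 := fun _ v => v.
#[export] Instance emb_step Γ Δ τ (e : emb Γ Δ) : emb Γ (τ :: Δ) | 1 :=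
  fun σ v => vS (e σ v).

Definition lift {Γ Δ : ctx} {e : emb Γ Δ} {σ : ty} (t : tm Γ σ) : tm Δ σ :=
  ren_tm emb_ren t.

(** Bracket abstraction: λ is not primitive. *)
Fixpoint lam (Γ : ctx) (σ τ : ty) (t : tm (σ :: Γ) τ) : tm Γ (σ ⇒ τ) :=
  match t in tm _ τ return tm Γ (σ ⇒ τ) with
  | @tvar _ τ v =>
      match v in var G τ return
        match G with [] => unit | σ :: Γ => tm Γ (σ ⇒ τ) end with
      | @v0 _ σ => tapp (tapp (tS σ (σ ⇒ σ) σ) (tK σ (σ ⇒ σ))) (tK σ σ)
      | vS v => tapp (tK _ _) (tvar v)
      end
  | tzero => tapp (tK _ _) tzero
  | tsucc => tapp (tK _ _) tsucc
  | tK a b => tapp (tK _ _) (tK a b)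
  | tS a b c => tapp (tK _ _) (tS a b c)
  | tR => tapp (tK _ _) tR
  | tapp f a => tapp (tapp (tS _ _ _) (lam f)) (lam a)
  end.

Definition Lam (σ : ty) {Γ : ctx} {τ : ty}
  (f : tm (σ :: Γ) σ -> tm (σ :: Γ) τ) : tm Γ (σ ⇒ τ) := lam (f (tvar v0)).
Definition AllB (σ : ty) {Γ : ctx} (f : tm (σ :: Γ) σ -> fm (σ :: Γ)) : fm Γ :=
  All σ (f (tvar v0)).
Arguments Lam σ {Γ τ} f.
Arguments AllB σ {Γ} f.
Definition Not {Γ : ctx} (A : fm Γ) : fm Γ := Imp A Bot.
Definition And {Γ : ctx} (A B : fm Γ) : fm Γ := Not (Imp A (Not B)).
Definition Or {Γ : ctx} (A B : fm Γ) : fm Γ := Imp (Not A) B.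
Definition Iff {Γ : ctx} (A B : fm Γ) : fm Γ := And (Imp A B) (Imp B A).
Definition Ex {Γ : ctx} (σ : ty) (A : fm (σ :: Γ)) : fm Γ :=
  Not (All σ (Not A)).
Definition ExB (σ : ty) {Γ : ctx} (f : tm (σ :: Γ) σ -> fm (σ :: Γ)) : fm Γ :=
  Ex (f (tvar v0)).
Arguments ExB σ {Γ} f.

Declare Scope tm_scope.
Delimit Scope tm_scope with tm.
Bind Scope tm_scope with tm.
Declare Scope fm_scope.
Delimit Scope fm_scope with fm.
Bind Scope fm_scope with fm.

Notation "# t" := (lift t) (at level 8, t at level 8, format "# t") : tm_scope.
Notation "f · t" := (tapp f t) (at level 12, left associativity) : tm_scope.
Notation "'λ' x : σ , t" := (Lam σ (fun x => t))
  (at level 200, x name, σ at level 60) : tm_scope.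
Notation "s = t" := (Eq0 s%tm t%tm) : fm_scope.
Notation "s <> t" := (Not (Eq0 s%tm t%tm)) : fm_scope.
Notation "A -> B" := (Imp A%fm B%fm) : fm_scope.
Notation "A <-> B" := (Iff A%fm B%fm) : fm_scope.
Notation "A /\ B" := (And A%fm B%fm) : fm_scope.
Notation "A \/ B" := (Or A%fm B%fm) : fm_scope.
Notation "~ A" := (Not A%fm) : fm_scope.
Notation "'ALL' x : σ , A" := (AllB σ%ty (fun x => A%fm))
  (at level 200, x name, σ at level 60) : fm_scope.
Notation "'EX' x : σ , A" := (ExB σ%ty (fun x => A%fm))
  (at level 200, x name, σ at level 60) : fm_scope.
Open Scope tm_scope.

(** Equality at higher types is defined pointwise. *)
Fixpoint eqT (σ : ty) : forall Γ, tm Γ σ -> tm Γ σ -> fm Γ :=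
  match σ return forall Γ, tm Γ σ -> tm Γ σ -> fm Γ with
  | tN => fun Γ s t => Eq0 s t
  | σ ⇒ τ => fun Γ s t =>
      AllB σ (fun x => eqT (#s · #x) (#t · #x))
  end.

(** A theory is given by its axioms, which may have free variables (of the
    indicated context); by [prv_allI] this amounts to their universal
    closures. *)

Definition theory := forall Γ : ctx, fm Γ -> Prop.

Inductive prv (T : theory) : forall Γ : ctx, list (fm Γ) -> fm Γ -> Prop :=
| prv_ax Γ (H : list (fm Γ)) A : T Γ A -> prv T H A
| prv_hyp Γ (H : list (fm Γ)) A : In A H -> prv T H A
| prv_impI Γ (H : list (fm Γ)) A B : prv T (A :: H) B -> prv T H (Imp A B)
| prv_impE Γ (H : list (fm Γ)) A B :
    prv T H (Imp A B) -> prv T H A -> prv T H B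
| prv_raa Γ (H : list (fm Γ)) A : prv T (Not A :: H) Bot -> prv T H A
| prv_allI Γ (H : list (fm Γ)) σ (A : fm (σ :: Γ)) :
    prv T (map (@wk_fm Γ σ) H) A -> prv T H (All σ A)
| prv_allE Γ (H : list (fm Γ)) σ (A : fm (σ :: Γ)) (t : tm Γ σ) :
    prv T H (All σ A) -> prv T H (inst A t).

Definition proves (T : theory) (A : fm []) : Prop := prv T [] A.

Definition add_axiom (T : theory) (S : forall Γ, fm Γ) : theory :=
  fun Γ A => T Γ A \/ A = S Γ.

(** Substitution [A(f,x) ↦ A(f, F f)], from context [x, f, Γ] to [f, F, Γ]. *)
Definition ac_sbst (Γ : ctx) : sbst (tN :: one :: Γ) (one :: two :: Γ) :=
  scons (tvar (vS v0) · tvar v0)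
    (scons (tvar v0) (fun _ v => tvar (vS (vS v)))).

(** Kohlenbach's E-PRA^ω (equality and successor axioms, Π, Σ, R_0,
    extensionality at all types, quantifier-free induction) plus QF-AC^{1,0}.
    Both schemata admit parameters of arbitrary types, through [Γ]. *)
Inductive RCA0w : theory :=
| ax_refl Γ (t : tm Γ tN) : RCA0w (t = t)%fm
| ax_sym Γ (s t : tm Γ tN) : RCA0w (s = t -> t = s)%fm
| ax_trans Γ (s t u : tm Γ tN) : RCA0w (s = t -> t = u -> s = u)%fm
| ax_succ0 Γ (t : tm Γ tN) : RCA0w (tsucc · t <> tzero)%fm
| ax_succI Γ (s t : tm Γ tN) : RCA0w (tsucc · s = tsucc · t -> s = t)%fm
| ax_K Γ σ τ (x : tm Γ σ) (y : tm Γ τ) : RCA0w (eqT (tK σ τ · x · y) x)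
| ax_S Γ ρ σ τ (x : tm Γ (ρ ⇒ σ ⇒ τ)) (y : tm Γ (ρ ⇒ σ)) (z : tm Γ ρ) :
    RCA0w (eqT (tS ρ σ τ · x · y · z) (x · z · (y · z)))
| ax_R0 Γ (f : tm Γ (tN ⇒ tN ⇒ tN)) (m : tm Γ tN) :
    RCA0w (tR · f · m · tzero = m)%fm
| ax_RS Γ (f : tm Γ (tN ⇒ tN ⇒ tN)) (m n : tm Γ tN) :
    RCA0w (tR · f · m · (tsucc · n) = f · n · (tR · f · m · n))%fm
| ax_ext Γ ρ τ (φ : tm Γ (ρ ⇒ τ)) (x y : tm Γ ρ) :
    RCA0w (eqT x y -> eqT (φ · x) (φ · y))%fm
| ax_QFIA Γ (A : fm (tN :: Γ)) : qf A ->
    RCA0w (inst A tzero ->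
           All tN (A -> sub_fm A (scons (tsucc · tvar v0)
                                    (fun _ v => tvar (vS v)))) ->
           All tN A)%fm
| ax_QFAC10 Γ (A : fm (tN :: one :: Γ)) : qf A ->
    RCA0w (All one (Ex A) -> Ex (σ := two) (All one (sub_fm A (@ac_sbst Γ))))%fm.

Section Terms.
Context {Γ : ctx}.

Definition S1 (t : tm Γ tN) : tm Γ tN := tsucc · t.
Definition addN (s t : tm Γ tN) : tm Γ tN :=
  tR · (λ _ : tN, tsucc) · s · t.
Definition predN (t : tm Γ tN) : tm Γ tN := tR · tK tN tN · tzero · t.
Definition cond0 (c a b : tm Γ tN) : tm Γ tN :=
  tR · (λ _ : tN, λ _ : tN, #b) · a · c.
End Terms.

Notation "s + t" := (addN s t) : tm_scope.

Definition mulN {Γ} (s t : tm Γ tN) : tm Γ tN :=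
  tR · (λ _ : tN, λ r : tN, #r + #s) · tzero · t.
Notation "s * t" := (mulN s t) : tm_scope.

Definition subN {Γ} (s t : tm Γ tN) : tm Γ tN :=
  tR · (λ _ : tN, λ r : tN, predN #r) · s · t.
Notation "s ∸ t" := (subN s t) (at level 50, left associativity) : tm_scope.

Definition leN {Γ} (s t : tm Γ tN) : fm Γ := (s ∸ t = tzero)%fm.
Definition ltN {Γ} (s t : tm Γ tN) : fm Γ := leN (S1 s) t.

Definition expN2 {Γ} (t : tm Γ tN) : tm Γ tN :=
  tR · (λ _ : tN, λ r : tN, #r + #r) · S1 tzero · t.

(** Cantor pairing [(x+y)(x+y+1)/2 + x]; [diagN z] is the number of the
    diagonal [x + y] on which [z] lies. *)
Definition triN {Γ} (t : tm Γ tN) : tm Γ tN :=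
  tR · (λ i : tN, λ r : tN, #r + S1 #i) · tzero · t.
Definition pairN {Γ} (x y : tm Γ tN) : tm Γ tN := triN (x + y) + x.
Definition diagN {Γ} (z : tm Γ tN) : tm Γ tN :=
  tR · (λ i : tN, λ r : tN, cond0 (triN (S1 #r) ∸ S1 #i) (S1 #r) #r)
     · tzero · z.
Definition fstN {Γ} (z : tm Γ tN) : tm Γ tN := z ∸ triN (diagN z).
Definition sndN {Γ} (z : tm Γ tN) : tm Γ tN := diagN z ∸ fstN z.

(** Every number codes a rational: [⟨⟨a,b⟩,d⟩] codes [(a - b)/(d + 1)]. *)
Definition mkQ {Γ} (a b d : tm Γ tN) : tm Γ tN := pairN (pairN a b) d.
Definition posQ {Γ} (q : tm Γ tN) : tm Γ tN := fstN (fstN q).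
Definition negpQ {Γ} (q : tm Γ tN) : tm Γ tN := sndN (fstN q).
Definition denQ {Γ} (q : tm Γ tN) : tm Γ tN := S1 (sndN q).

Definition zeroQ {Γ} : tm Γ tN := mkQ tzero tzero tzero.
Definition oneQ {Γ} : tm Γ tN := mkQ (S1 tzero) tzero tzero.
Definition addQ {Γ} (q r : tm Γ tN) : tm Γ tN :=
  mkQ (posQ q * denQ r + posQ r * denQ q)
      (negpQ q * denQ r + negpQ r * denQ q)
      (predN (denQ q * denQ r)).
Definition oppQ {Γ} (q : tm Γ tN) : tm Γ tN :=
  mkQ (negpQ q) (posQ q) (sndN q).
Definition subQ {Γ} (q r : tm Γ tN) : tm Γ tN := addQ q (oppQ r).
Definition leQ {Γ} (q r : tm Γ tN) : fm Γ :=
  leN (posQ q * denQ r + negpQ r * denQ q)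
      (posQ r * denQ q + negpQ q * denQ r).
Definition ltQ {Γ} (q r : tm Γ tN) : fm Γ := Not (leQ r q).
(** [pow2Q n] is [2^-n] and [pow2Q' n] is [2^(1-n)]. *)
Definition pow2Q {Γ} (n : tm Γ tN) : tm Γ tN :=
  mkQ (S1 tzero) tzero (predN (expN2 n)).
Definition pow2Q' {Γ} (n : tm Γ tN) : tm Γ tN := addQ (pow2Q n) (pow2Q n).

(** A real is a sequence [q] of codes with [|q_n - q_(n+i)| < 2^-n]; then
    [x = y] iff [|x_n - y_n| <= 2^(1-n)] for all [n], and [x < y] iff
    [x_n + 2^(1-n) < y_n] for some [n]. *)
Section Reals.
Context {Γ : ctx}.
Implicit Types x y z : tm Γ one.

Definition isR x : fm Γ :=
  (ALL n : tN, ALL i : tN,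
     ltQ (subQ (#x · #n) (#x · (#n + #i))) (pow2Q #n) /\
     ltQ (subQ (#x · (#n + #i)) (#x · #n)) (pow2Q #n))%fm.

Definition eqR x y : fm Γ :=
  (ALL n : tN,
     leQ (subQ (#x · #n) (#y · #n)) (pow2Q' #n) /\
     leQ (subQ (#y · #n) (#x · #n)) (pow2Q' #n))%fm.

Definition ltR x y : fm Γ :=
  (EX n : tN, ltQ (addQ (#x · #n) (pow2Q' #n)) (#y · #n))%fm.

Definition leR x y : fm Γ := Not (ltR y x).

Definition ratR (q : tm Γ tN) : tm Γ one := λ _ : tN, #q.
Definition addR x y : tm Γ one :=
  λ n : tN, addQ (#x · S1 #n) (#y · S1 #n).
Definition oppR x : tm Γ one := λ n : tN, oppQ (#x · #n).
Definition subR x y : tm Γ one := addR x (oppR y).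

(** [sumR x n] is [Σ_(i<n) x_i]; evaluating the summands at [k + n] makes the
    sum converge fast. *)
Definition sumR (x : tm Γ (tN ⇒ one)) (n : tm Γ tN) : tm Γ one :=
  λ k : tN,
    tR · (λ i : tN, λ r : tN, addQ #r (#x · #i · (#k + #n))) · zeroQ · #n.

Definition in01 x : fm Γ := (leR (ratR zeroQ) x /\ leR x (ratR oneQ))%fm.
Definition inOpen a b x : fm Γ := (ltR a x /\ ltR x b)%fm.
End Reals.

Notation "'ALLR' x , A" := (AllB one (fun x => Imp (isR x) A%fm))
  (at level 200, x name) : fm_scope.
Notation "'EXR' x , A" := (ExB one (fun x => And (isR x) A%fm))
  (at level 200, x name) : fm_scope.

(** Finite binary sequences are identified with numbers by
    [⟨⟩ ↦ 0] and [s⌢b ↦ 2s + 1 + b], a bijection. *)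
Definition snocB {Γ} (s b : tm Γ tN) : tm Γ tN := S1 (s + s + b).

Definition restr {Γ} (f : tm Γ one) (n : tm Γ tN) : tm Γ tN :=
  tR · (λ i : tN, λ s : tN, snocB #s (#f · #i)) · tzero · n.

(** A set of numbers is given by a type-1 [X], with [s ∈ X] iff [X(s) = 1]. *)
Definition mem {Γ} (s : tm Γ tN) (X : tm Γ one) : fm Γ := (X · s = S1 tzero)%fm.

Definition bintree {Γ} (T : tm Γ one) : fm Γ :=
  (ALL s : tN, mem (snocB #s tzero) #T \/ mem (snocB #s (S1 tzero)) #T ->
     mem #s #T)%fm.

Definition infinite {Γ} (X : tm Γ one) : fm Γ :=
  (ALL m : tN, EX s : tN, leN #m #s /\ mem #s #X)%fm.

Definition WKL (Γ : ctx) : fm Γ :=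
  (ALL T : one, bintree #T -> infinite #T ->
     EX f : one, (ALL n : tN, #f · #n = tzero \/ #f · #n = S1 tzero) /\
                 (ALL n : tN, mem (restr #f #n) #T))%fm.

Notation rseq := (tN ⇒ one).
Notation fct := (one ⇒ one).

(** A function [[0,1] -> R] is a type [1 -> 1] object that maps reals in [[0,1]]
    to reals and respects equality of reals there; continuity is not assumed. *)
Definition fun01 {Γ} (Ψ : tm Γ fct) : fm Γ :=
  ((ALLR x, in01 #x -> isR (#Ψ · #x)) /\
   (ALLR x, ALLR y, in01 #x -> in01 #y -> eqR #x #y ->
      eqR (#Ψ · #x) (#Ψ · #y)))%fm.

Definition positive01 {Γ} (Ψ : tm Γ fct) : fm Γ :=
  (ALLR x, in01 #x -> ltR (ratR zeroQ) (#Ψ · #x))%fm.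

Definition contAt {Γ} (Ψ : tm Γ fct) (x : tm Γ one) : fm Γ :=
  (ALLR ε, ltR (ratR zeroQ) #ε ->
     EXR δ, ltR (ratR zeroQ) #δ /\
       ALLR y, in01 #y ->
         inOpen (subR #x #δ) (addR #x #δ) #y ->
         inOpen (subR (#Ψ · #x) #ε) (addR (#Ψ · #x) #ε) (#Ψ · #y))%fm.

(** A sequence of basic open intervals [(a_n, b_n)] is a pair of sequences of
    (codes of) rationals. *)
Definition intervals {Γ} (a b : tm Γ one) : fm Γ :=
  (ALL n : tN, ltQ (#a · #n) (#b · #n))%fm.

Definition inUnion {Γ} (a b x : tm Γ one) : fm Γ :=
  (EX n : tN, inOpen (ratR (#a · #n)) (ratR (#b · #n)) #x)%fm.

(** The RM-closed subset of [[0,1]] coded by [a], [b]. *)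
Definition inClosed {Γ} (a b x : tm Γ one) : fm Γ :=
  (in01 x /\ ~ inUnion a b x)%fm.

(** [Σ_n (b_n - a_n) < ε], in the form "some real below [ε] bounds all partial
    sums" (the limit of the partial sums need not exist in the base theory). *)
Definition totalLt {Γ} (a b ε : tm Γ one) : fm Γ :=
  (EXR δ, ltR #δ #ε /\
     ALL n : tN,
       leR (sumR (λ i : tN, ratR (subQ (#b · #i) (#a · #i))) #n) #δ)%fm.

Definition nullClosed {Γ} (a b : tm Γ one) : fm Γ :=
  (ALLR ε, ltR (ratR zeroQ) #ε ->
     EX c : one, EX d : one,
       intervals #c #d /\ totalLt #c #d #ε /\
       ALLR x, inClosed #a #b #x -> inUnion #c #d #x)%fm.

Definition contAE {Γ} (Ψ : tm Γ fct) : fm Γ :=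
  (EX a : one, EX b : one,
     intervals #a #b /\ nullClosed #a #b /\
     ALLR x, in01 #x -> ~ inClosed #a #b #x -> contAt #Ψ #x)%fm.

Definition inI {Γ} (Ψ : tm Γ fct) (y x : tm Γ one) : fm Γ :=
  inOpen (subR y (Ψ · y)) (addR y (Ψ · y)) x.

Definition inJ {Γ} (Ψ : tm Γ fct) (y : tm Γ rseq) (i : tm Γ tN)
  (x : tm Γ one) : fm Γ :=
  (inI Ψ (y · i) x /\ ~ EX j : tN, ltN #j #i /\ inI #Ψ (#y · #j) #x)%fm.

(** [|J| = r] for the elementary set [J = {x | A(x)}]: up to endpoints, [J] is
    the union of the non-overlapping intervals [(a_j, b_j)], [j < m], listed
    from left to right, and [r] is the sum of their lengths. *)
Definition lengthIs {Γ} (A : fm (one :: Γ)) (r : tm Γ one) : fm Γ :=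
  (EX m : tN, EX a : rseq, EX b : rseq,
     (ALL j : tN, ltN #j #m ->
        isR (#a · #j) /\ isR (#b · #j) /\ leR (#a · #j) (#b · #j)) /\
     (ALL j : tN, ltN (S1 #j) #m -> leR (#b · #j) (#a · S1 #j)) /\
     (ALLR x,
        (ALL j : tN, ltN #j #m ->
           ~ eqR #x (#a · #j) /\ ~ eqR #x (#b · #j)) ->
        (sub_fm A (scons #x (fun _ v => tvar (vS (vS (vS (vS v)))))) <->
         EX j : tN, ltN #j #m /\ inOpen (#a · #j) (#b · #j) #x)) /\
     eqR #r (sumR (λ j : tN, subR (#b · #j) (#a · #j)) #m))%fm.

Definition lengthJ {Γ} (Ψ : tm Γ fct) (y : tm Γ rseq) (i : tm Γ tN)
  (r : tm Γ one) : fm Γ :=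
  lengthIs (inJ #Ψ #y #i (tvar v0)) r.

(** The points [y_0, …, y_k] are the first [k + 1] terms of a sequence [y]. *)
Definition WHBU_at {Γ} (Ψ : tm Γ fct) (ε : tm Γ one) : fm Γ :=
  (EX k : tN, EX y : rseq,
     (ALL i : tN, leN #i #k -> isR (#y · #i) /\ in01 (#y · #i)) /\
     (ALL i : tN, ALL j : tN, ltN #i #j -> leN #j #k ->
        ~ eqR (#y · #i) (#y · #j)) /\
     EX l : rseq,
       (ALL i : tN, leN #i #k ->
          isR (#l · #i) /\ lengthJ #Ψ #y #i (#l · #i)) /\
       ltR (subR (ratR oneQ) #ε) (sumR #l (S1 #k)))%fm.

Definition WHBU_ae : fm [] :=
  (ALL Ψ : fct, fun01 #Ψ -> positive01 #Ψ -> contAE #Ψ ->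
     ALLR ε, ltR (ratR zeroQ) #ε -> WHBU_at #Ψ #ε)%fm.

(* Main.v *)
(** By a Henkin construction, a sentence that holds in all models is derivable,
    and dividing by extensional equality makes the models extensional. So we
    argue in an extensional model, whose numbers need not be standard. Its
    rationals form an ordered field, and the recursor, quantifier-free induction
    and QF-AC give finite sums, induction for Sigma-1 formulas and choice.

    Cover the null set [E] by rational intervals of total length below [e], and
    add the intervals of [Ψ] around all dyadic rationals. A point outside [E] is
    a point of continuity, so [Ψ] is bounded from below near it and it lies in
    the interval around a dyadic rational close to it. By WKL, finitely many of
    these intervals cover [0, 1]. Take for the [y_i] all the [j / 2^L], with [L]
    large enough. The set [J_{y_i}] is a union of at most [i + 1] intervals
    whose endpoints are maxima and minima of endpoints of the [I_{y_j}]. These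
    pieces and the finitely many intervals used for [E] cover a fine grid in
    [0, 1], so that their lengths add up to at least [1], and those of the
    pieces to more than [1 - e]. *)

From Stdlib Require Import List Arith Lia Cantor Eqdep_dec Ring Ring_theory.
From Stdlib Require Import Classical ClassicalEpsilon FunctionalExtensionality.
From Stdlib Require Import PropExtensionality ProofIrrelevance Program.Equality.
Require Import Defs.
Import ListNotations.
Set Implicit Arguments.
Unset Strict Implicit.
Unset Printing Implicit Defensive.

(** Weak König's lemma settles countable covers only, whereas [Ψ] gives an uncountable one.
    Continuity almost everywhere bridges the gap: measure zero provides a sequence of intervals for
    [E], and elsewhere dyadic centres suffice, so no centre ever has to be chosen outside a
    countable set. The metatheory is classical with choice; what must be internal is that the
    objects claimed to exist are elements of the model and that induction is applied to predicates
    decidable there, or to Sigma-1 and Pi-1 ones. [Rep], [RQ] and [Dec] keep track of this. The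
    order of the reals is not decidable in this sense, so endpoints cannot be sorted; taking the
    centres in increasing order puts the pieces of each [J] into order by itself. Lengths are
    compared by counting grid cells because the number of intervals may be nonstandard: the count is
    an induction on inequalities between rationals. One number [L] bounds the codes of the intervals
    used, the levels of their centres and the indices of the intervals for [E], since the components
    of a pair never exceed its code. *)

(** * Substitution in terms and formulas *)

Lemma var_case (Γ : ctx) (σ : ty) (P : forall τ, var (σ :: Γ) τ -> Prop) :
  P σ v0 -> (forall τ v, P τ (vS v)) -> forall τ v, P τ v.
Proof.
intros H0 HS τ v.
exact (match v as v in var G τ return
  match G return var G τ -> Prop with
  | [] => fun _ => True
  | σ :: Γ => fun v => forall P : forall τ, var (σ :: Γ) τ -> Prop,
      P σ v0 -> (forall τ v, P τ (vS v)) -> P τ v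
  end v with
  | v0 => fun P H0 _ => H0
  | vS v => fun P _ HS => HS _ v
  end P H0 HS).
Qed.

Lemma sbst_ext (Γ Δ : ctx) (σ : ty) (s s' : sbst (σ :: Γ) Δ) :
  s σ v0 = s' σ v0 -> (forall τ v, s τ (vS v) = s' τ (vS v)) -> s = s'.
Proof.
intros H0 HS; extensionality τ; extensionality v.
revert τ v; apply var_case; auto.
Qed.

Lemma sub_ren_tm (Γ Δ Θ : ctx) (r : ren Γ Δ) (s : sbst Δ Θ) σ (t : tm Γ σ) :
  sub_tm s (ren_tm r t) = sub_tm (fun τ v => s τ (r τ v)) t.
Proof. induction t; simpl; congruence. Qed.

Lemma ren_sub_tm (Γ Δ Θ : ctx) (s : sbst Γ Δ) (r : ren Δ Θ) σ (t : tm Γ σ) :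
  ren_tm r (sub_tm s t) = sub_tm (fun τ v => ren_tm r (s τ v)) t.
Proof. induction t; simpl; congruence. Qed.

Lemma sub_sub_tm (Γ Δ Θ : ctx) (s : sbst Γ Δ) (s' : sbst Δ Θ) σ (t : tm Γ σ) :
  sub_tm s' (sub_tm s t) = sub_tm (fun τ v => sub_tm s' (s τ v)) t.
Proof. induction t; simpl; congruence. Qed.

Lemma sub_tm_id (Γ : ctx) σ (t : tm Γ σ) : sub_tm (fun _ v => tvar v) t = t.
Proof. induction t; simpl; congruence. Qed.

Lemma ren_tm_sub (Γ Δ : ctx) (r : ren Γ Δ) σ (t : tm Γ σ) :
  ren_tm r t = sub_tm (fun _ v => tvar (r _ v)) t.
Proof. induction t; simpl; congruence. Qed.

Lemma up_comp (Γ Δ Θ : ctx) (τ : ty) (s : sbst Γ Δ) (s' : sbst Δ Θ) :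
  (fun σ (v : var (τ :: Γ) σ) => sub_tm (up s') (up s v)) =
  up (fun σ v => sub_tm s' (s σ v)).
Proof.
apply sbst_ext; [reflexivity|]; intros σ v.
cbn; rewrite sub_ren_tm, ren_sub_tm; reflexivity.
Qed.

Lemma up_id (Γ : ctx) (τ : ty) :
  up (τ := τ) (fun σ (v : var Γ σ) => tvar v) = (fun σ v => tvar v).
Proof. apply sbst_ext; reflexivity. Qed.

Lemma sub_sub_fm (Γ : ctx) (A : fm Γ) : forall (Δ Θ : ctx) (s : sbst Γ Δ)
  (s' : sbst Δ Θ),
  sub_fm (sub_fm A s) s' = sub_fm A (fun τ v => sub_tm s' (s τ v)).
Proof.
induction A; intros; simpl.
- now rewrite !sub_sub_tm.
- reflexivity.
- now rewrite IHA1, IHA2.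
- now rewrite IHA, up_comp.
Qed.

Lemma sub_fm_id (Γ : ctx) (A : fm Γ) : sub_fm A (fun _ v => tvar v) = A.
Proof.
induction A; simpl.
- now rewrite !sub_tm_id.
- reflexivity.
- now rewrite IHA1, IHA2.
- now rewrite up_id, IHA.
Qed.

Lemma sub_inst (Γ Δ : ctx) (τ : ty) (A : fm (τ :: Γ)) (t : tm Γ τ)
  (s : sbst Γ Δ) :
  sub_fm (inst A t) s = inst (sub_fm A (up s)) (sub_tm s t).
Proof.
unfold inst; rewrite !sub_sub_fm; f_equal.
apply sbst_ext; [reflexivity|]; intros σ v; cbn.
rewrite sub_ren_tm; symmetry; apply sub_tm_id.
Qed.

Lemma inst_up (Γ Δ : ctx) (τ : ty) (A : fm (τ :: Γ)) (t : tm Δ τ)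
  (s : sbst Γ Δ) : inst (sub_fm A (up s)) t = sub_fm A (scons t s).
Proof.
unfold inst; rewrite sub_sub_fm; f_equal.
apply sbst_ext; [reflexivity|]; intros σ v; cbn.
rewrite sub_ren_tm; apply sub_tm_id.
Qed.

Lemma sub_wk_fm (Γ Δ : ctx) (τ : ty) (A : fm Γ) (s : sbst Γ Δ) :
  sub_fm (wk_fm τ A) (up s) = wk_fm τ (sub_fm A s).
Proof.
unfold wk_fm; rewrite !sub_sub_fm; f_equal.
extensionality σ; extensionality v; cbn.
now rewrite ren_tm_sub.
Qed.

Lemma sub_eqT (σ : ty) : forall (Γ Δ : ctx) (s : sbst Γ Δ) (t u : tm Γ σ),
  sub_fm (eqT t u) s = eqT (sub_tm s t) (sub_tm s u).
Proof.
induction σ; intros; [reflexivity|].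
cbn; f_equal; rewrite IHσ2; cbn.
unfold lift; rewrite !sub_ren_tm, !ren_sub_tm; reflexivity.
Qed.

Lemma qf_sub (Γ : ctx) (A : fm Γ) : forall (Δ : ctx) (s : sbst Γ Δ),
  qf A -> qf (sub_fm A s).
Proof. induction A; simpl; intros; firstorder. Qed.

(** Needed to move derivations into the larger contexts that the Henkin construction creates, see
    [prv_sub]. *)
Definition sub_closed (T : theory) := forall (Γ Δ : ctx) (s : sbst Γ Δ) A,
  T Γ A -> T Δ (sub_fm A s).

Lemma RCA0w_sub_closed : sub_closed RCA0w.
Proof.
intros Γ Δ u A HA; revert Δ u; destruct HA; intros Δ s';
  rewrite ?sub_eqT; cbn [sub_fm]; rewrite ?sub_eqT; cbn [sub_tm].
- apply ax_refl.
- apply ax_sym.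
- apply ax_trans.
- apply ax_succ0.
- apply ax_succI.
- apply ax_K.
- apply ax_S.
- apply ax_R0.
- apply ax_RS.
- apply ax_ext.
(* For the two schemata, the substituted axiom and the axiom for the substituted formula differ only
   in how substitutions are composed. *)
- pose proof (@ax_QFIA Δ (sub_fm A (up s')) (qf_sub _ H)) as HI.
  rewrite sub_inst.
  rewrite ?sub_sub_fm in HI |- *.
  match goal with |- RCA0w (Imp _ (Imp (All _ (Imp _ (sub_fm A ?f))) _)) =>
    match type of HI with RCA0w (Imp _ (Imp (All _ (Imp _ (sub_fm A ?g))) _)) =>
      replace f with g; [exact HI|] end end.
  apply sbst_ext; [reflexivity|]; intros σ v; cbn.
  rewrite sub_ren_tm, ren_tm_sub; reflexivity.
- pose proof (@ax_QFAC10 Δ (sub_fm A (up (up s'))) (qf_sub _ H)) as HI.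
  rewrite ?sub_sub_fm in HI |- *.
  unfold Ex, Not in *; cbn [sub_fm] in *; rewrite !sub_sub_fm in *.
  match goal with |- RCA0w (Imp _ (Imp (All _ (Imp (All _ (sub_fm A ?f)) _)) _)) =>
    match type of HI with
      RCA0w (Imp _ (Imp (All _ (Imp (All _ (sub_fm A ?g)) _)) _)) =>
      replace f with g; [exact HI|] end end.
  apply sbst_ext; [reflexivity|].
  apply (@var_case Γ one); [reflexivity|]; intros σ v; cbn.
  rewrite !sub_ren_tm, !ren_tm_sub, sub_sub_tm; reflexivity.
Qed.

Lemma WKL_sub_closed : sub_closed (add_axiom RCA0w WKL).
Proof.
intros Γ Δ s A [HA| ->]; [left; now apply RCA0w_sub_closed|right].
reflexivity.
Qed.

(** * Derivations and consistency *)

Section Derivations.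
Variable T : theory.
Hypothesis T_closed : sub_closed T.

Lemma prv_incl Γ (H : list (fm Γ)) A : prv T H A ->
  forall H', incl H H' -> prv T H' A.
Proof.
induction 1; intros H' HH.
- now apply prv_ax.
- apply prv_hyp; auto.
- apply prv_impI, IHprv; intros X [->|HX]; [now left|right; auto].
- eapply prv_impE; eauto.
- apply prv_raa, IHprv; intros X [->|HX]; [now left|right; auto].
- apply prv_allI, IHprv; now apply incl_map.
- now apply prv_allE, IHprv.
Qed.

Lemma prv_sub Γ (H : list (fm Γ)) A : prv T H A ->
  forall Δ (s : sbst Γ Δ), prv T (map (fun B => sub_fm B s) H) (sub_fm A s).
Proof.
induction 1; intros Δ s.
- now apply prv_ax, T_closed.
- now apply prv_hyp, (in_map (fun B => sub_fm B s)).
- apply prv_impI; exact (IHprv Δ s).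
- exact (prv_impE (IHprv1 Δ s) (IHprv2 Δ s)).
- apply prv_raa; exact (IHprv Δ s).
- cbn; apply prv_allI; specialize (IHprv _ (up (τ := σ) s)).
  rewrite map_map in *; erewrite map_ext; [exact IHprv|].
  intros B; cbn; now rewrite sub_wk_fm.
- rewrite sub_inst; apply prv_allE; exact (IHprv Δ s).
Qed.

Lemma prv_wk Γ σ (H : list (fm Γ)) A : prv T H A ->
  prv T (map (@wk_fm Γ σ) H) (wk_fm σ A).
Proof. intros HA; exact (prv_sub HA _). Qed.

Definition consistent Γ (H : list (fm Γ)) := ~ prv T H Bot.

(** As every type has a closed term, a fresh variable can be eliminated again; so adding one
    preserves consistency. *)
Fixpoint dflt Γ σ : tm Γ σ :=
  match σ with
  | tN => tzero
  | Arr σ τ => tapp (tK τ σ) (dflt Γ τ)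
  end.

Lemma prv_botE Γ (H : list (fm Γ)) A : prv T H Bot -> prv T H A.
Proof. intros HB; apply prv_raa; apply (prv_incl HB); now right. Qed.

Lemma consistent_wk Γ σ (H : list (fm Γ)) :
  consistent H -> consistent (map (@wk_fm Γ σ) H).
Proof.
intros HH HB; apply HH.
exact (prv_allE (dflt Γ σ) (prv_allI HB)).
Qed.

Lemma consistent_lem Γ (H : list (fm Γ)) A : consistent H ->
  ~ consistent (A :: H) -> consistent (Not A :: H).
Proof.
intros HH HA HB; apply HA; intros HA'; apply HH.
apply (prv_impE (prv_impI HB)), prv_impI.
exact HA'.
Qed.

(** The fresh variable is a counterexample to [A] if there is one. If this were refutable, then [A]
    would be provable for a fresh variable, hence [All σ A] too, and the implication would follow
    from its conclusion. *)
Lemma consistent_henkin Γ σ (H : list (fm Γ)) (A : fm (σ :: Γ)) :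
  consistent H ->
  consistent (Imp A (wk_fm σ (All σ A)) :: map (@wk_fm Γ σ) H).
Proof.
intros HH HB; apply prv_impI in HB.
assert (HA : prv T (map (@wk_fm Γ σ) H) A).
{ apply prv_raa; apply (prv_impE (prv_incl HB (incl_tl _ (incl_refl _)))).
  apply prv_impI, prv_botE.
  apply (prv_impE (A := A)); apply prv_hyp; cbn; auto. }
apply (consistent_wk (σ := σ) HH), (prv_impE HB), prv_impI.
apply (prv_incl (prv_wk σ (prv_allI HA))); now right.
Qed.
End Derivations.

(** * Semantics *)

(** The relation [sE] is separate from equality because distinct terms of the term model can be
    provably equal. *)
Record struct := {
  dom :> ty -> Type;
  sap : forall σ τ, dom (σ ⇒ τ) -> dom σ -> dom τ;
  szero : dom tN;
  ssucc : dom (tN ⇒ tN);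
  sK : forall σ τ, dom (σ ⇒ τ ⇒ σ);
  sS : forall ρ σ τ, dom ((ρ ⇒ σ ⇒ τ) ⇒ (ρ ⇒ σ) ⇒ ρ ⇒ τ);
  sR : dom ((tN ⇒ tN ⇒ tN) ⇒ tN ⇒ tN ⇒ tN);
  sE : dom tN -> dom tN -> Prop
}.
Arguments sap {s σ τ} _ _.
Arguments szero {s}.
Arguments ssucc {s}.
Arguments sK {s} σ τ.
Arguments sS {s} ρ σ τ.
Arguments sR {s}.
Arguments sE {s} _ _.

Definition env (D : ty -> Type) (Γ : ctx) := forall σ, var Γ σ -> D σ.

Definition enil (D : ty -> Type) : env D [] := fun σ v =>
  match v in var G σ return match G with [] => D σ | _ => unit end with
  | v0 => tt
  | vS _ => tt
  end.

Definition econs (D : ty -> Type) (Γ : ctx) (τ : ty) (x : D τ) (ρ : env D Γ) :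
  env D (τ :: Γ) := fun σ v =>
  match v in var G σ return
    match G with
    | [] => unit
    | τ :: Γ => D τ -> env D Γ -> D σ
    end with
  | v0 => fun x _ => x
  | vS v => fun _ ρ => ρ _ v
  end x ρ.
Arguments enil {D} σ v.
Arguments econs {D Γ τ} x ρ σ v.

Lemma env_ext (D : ty -> Type) (Γ : ctx) (σ : ty) (s s' : env D (σ :: Γ)) :
  s σ v0 = s' σ v0 -> (forall τ v, s τ (vS v) = s' τ (vS v)) -> s = s'.
Proof.
intros H0 HS; extensionality τ; extensionality v.
revert τ v; apply var_case; auto.
Qed.

Fixpoint teval (M : struct) Γ (ρ : env M Γ) σ (t : tm Γ σ) : M σ :=
  match t with
  | tvar v => ρ _ v
  | tzero => szero
  | tsucc => ssucc
  | tK σ τ => sK σ τ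
  | tS ρ σ τ => sS ρ σ τ
  | tR => sR
  | tapp f a => sap (teval ρ f) (teval ρ a)
  end.

Fixpoint sat (M : struct) Γ (A : fm Γ) : env M Γ -> Prop :=
  match A with
  | Eq0 t u => fun ρ => sE (teval ρ t) (teval ρ u)
  | Bot => fun _ => False
  | Imp B C => fun ρ => sat B ρ -> sat C ρ
  | All σ B => fun ρ => forall x, sat B (econs x ρ)
  end.

Definition models (T : theory) (M : struct) :=
  forall Γ (A : fm Γ) (ρ : env M Γ), T Γ A -> sat A ρ.

Lemma teval_sub (M : struct) (Γ Δ : ctx) (s : sbst Γ Δ) (ρ : env M Δ) σ
  (t : tm Γ σ) : teval ρ (sub_tm s t) = teval (fun τ v => teval ρ (s τ v)) t.
Proof. induction t; simpl; congruence. Qed.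

Lemma teval_ren (M : struct) (Γ Δ : ctx) (r : ren Γ Δ) (ρ : env M Δ) σ
  (t : tm Γ σ) : teval ρ (ren_tm r t) = teval (fun τ v => ρ τ (r τ v)) t.
Proof. induction t; simpl; congruence. Qed.

Lemma forall_eq (X : Type) (P Q : X -> Prop) :
  (forall x, P x = Q x) -> (forall x, P x) = (forall x, Q x).
Proof. intros H; replace Q with P; [reflexivity|]; now extensionality x. Qed.

Lemma sat_sub (M : struct) (Γ : ctx) (A : fm Γ) : forall (Δ : ctx)
  (s : sbst Γ Δ) (ρ : env M Δ),
  sat (sub_fm A s) ρ = sat A (fun τ v => teval ρ (s τ v)).
Proof.
induction A; intros; simpl.
- now rewrite !teval_sub.
- reflexivity.
- now rewrite IHA1, IHA2.
- apply forall_eq; intros x; rewrite IHA; f_equal.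
  apply env_ext; [reflexivity|]; intros τ v; cbn.
  now rewrite teval_ren.
Qed.

(** * Completeness *)

(** Turns an injective coding into an enumeration without a decoding function. *)
Definition inverse (A : Type) (f : A -> nat) (d : A) (n : nat) : A :=
  epsilon (inhabits d) (fun a => f a = n).

Lemma inverseK (A : Type) (f : A -> nat) (d : A) :
  (forall x y, f x = f y -> x = y) -> forall a, inverse f d (f a) = a.
Proof.
intros Hf a; apply Hf; unfold inverse.
apply (epsilon_spec (inhabits d) (fun b => f b = f a)); now exists a.
Qed.

Lemma to_nat_inj a b c d : to_nat (a, b) = to_nat (c, d) -> a = c /\ b = d.
Proof. intros H; apply Cantor.to_nat_inj in H; now injection H. Qed.

Fixpoint tycode (σ : ty) : nat :=
  match σ with
  | tN => 0
  | Arr σ τ => S (to_nat (tycode σ, tycode τ))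
  end.

Lemma tycode_inj σ τ : tycode σ = tycode τ -> σ = τ.
Proof.
revert τ; induction σ; destruct τ; try discriminate; [reflexivity|].
intros H; injection H as H; apply to_nat_inj in H as [].
f_equal; auto.
Qed.

Fixpoint vcode Γ σ (v : var Γ σ) : nat :=
  match v with v0 => 0 | vS v => S (vcode v) end.

Lemma vcode_inj Γ σ (v : var Γ σ) : forall τ (w : var Γ τ),
  vcode v = vcode w -> existT (var Γ) σ v = existT (var Γ) τ w.
Proof.
induction v; intros τ' w; revert τ' w;
  match goal with |- forall τ w, @?P τ w => apply (@var_case _ _ P) end;
  try discriminate; [reflexivity|].
intros ρ w H; injection H as H; apply IHv in H.
exact (f_equal (fun p => existT (var (τ :: Γ)) _ (vS (projT2 p))) H).
Qed.

Fixpoint tcode Γ σ (t : tm Γ σ) : nat :=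
  match t with
  | tvar v => to_nat (0, vcode v)
  | tzero => to_nat (1, 0)
  | tsucc => to_nat (2, 0)
  | tK σ τ => to_nat (3, to_nat (tycode σ, tycode τ))
  | tS ρ σ τ => to_nat (4, to_nat (tycode ρ, to_nat (tycode σ, tycode τ)))
  | tR => to_nat (5, 0)
  | tapp f a => to_nat (6, to_nat (tcode f, tcode a))
  end.

Lemma tcode_inj_sig Γ σ (t : tm Γ σ) : forall τ (u : tm Γ τ),
  tcode t = tcode u -> existT (tm Γ) σ t = existT (tm Γ) τ u.
Proof.
induction t; destruct u; cbn [tcode]; intros H;
  apply to_nat_inj in H as [H1 H2]; try discriminate; try reflexivity;
  try apply to_nat_inj in H2 as [H2 H3].
- apply vcode_inj in H2.
  exact (f_equal (fun p => existT (tm Γ) _ (tvar (projT2 p))) H2).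
- apply tycode_inj in H2, H3; now subst.
- apply to_nat_inj in H3 as [H3 H4].
  apply tycode_inj in H2, H3, H4; now subst.
- apply IHt1 in H2; apply IHt2 in H3.
  assert (E := f_equal (@projT1 _ _) H2); injection E as -> ->.
  apply inj_pair2 in H2, H3; now subst.
Qed.

Lemma tcode_inj Γ σ (t u : tm Γ σ) : tcode t = tcode u -> t = u.
Proof. intros H; apply inj_pair2, tcode_inj_sig, H. Qed.

Fixpoint fcode Γ (A : fm Γ) : nat :=
  match A with
  | Eq0 t u => to_nat (0, to_nat (tcode t, tcode u))
  | Bot => to_nat (1, 0)
  | Imp A B => to_nat (2, to_nat (fcode A, fcode B))
  | All σ A => to_nat (3, to_nat (tycode σ, fcode A))
  end.

Lemma fcode_inj Γ (A B : fm Γ) : fcode A = fcode B -> A = B.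
Proof.
induction A; dependent destruction B; cbn [fcode]; intros H;
  apply to_nat_inj in H as [H1 H2]; try discriminate; try reflexivity;
  apply to_nat_inj in H2 as [H2 H3].
- f_equal; now apply tcode_inj.
- f_equal; auto.
- apply tycode_inj in H2; subst; f_equal; auto.
Qed.

(** The [n]-th stage of the construction has a free variable for each of the
    types [wty 0], …, [wty (n - 1)]; a stage number codes the type of the next
    variable, the formula to be decided and witnessed, and the stage at which
    that formula was formed. *)
Definition wty (n : nat) : ty := inverse tycode tN (fst (of_nat n)).
Definition wstage (n : nat) : nat := fst (of_nat (snd (of_nat n))).

Fixpoint wctx (n : nat) : ctx :=
  match n with 0 => [] | S n => wty n :: wctx n end.

Definition wfm (n : nat) : fm (wty n :: wctx (wstage n)) :=
  inverse (fcode (Γ := _)) Bot (fst (of_nat (snd (of_nat (snd (of_nat n)))))).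

(** The code has a spare component [m], so each formula is treated at arbitrarily late stages, in
    particular when all its parameters exist. The equation is between dependent pairs because the
    type and context of [wfm n] depend on [n]. *)
Lemma wfm_surj σ k (A : fm (σ :: wctx k)) m : exists n, m <= n /\
  existT (fun τ => {k & fm (τ :: wctx k)}) (wty n) (existT _ (wstage n) (wfm n))
  = existT _ σ (existT _ k A).
Proof.
exists (to_nat (tycode σ, to_nat (k, to_nat (fcode A, m)))); split.
- pose proof (to_nat_non_decreasing (fcode A) m).
  pose proof (to_nat_non_decreasing k (to_nat (fcode A, m))).
  pose proof (to_nat_non_decreasing (tycode σ)
    (to_nat (k, to_nat (fcode A, m)))); lia.
- unfold wfm, wstage, wty.
  repeat (rewrite cancel_of_to; cbn [fst snd]).
  rewrite (inverseK tN tycode_inj).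
  now rewrite (inverseK Bot (@fcode_inj _)).
Qed.

(** Closed terms over the Henkin constants, [ic i] being the variable introduced at stage [i].
    Unlike [tm (wctx n)], this type does not depend on a stage and can serve as the domain of a
    model. *)
Inductive itm : ty -> Type :=
| ic (i : nat) : itm (wty i)
| izero : itm tN
| isucc : itm (tN ⇒ tN)
| iK (σ τ : ty) : itm (σ ⇒ τ ⇒ σ)
| iS (ρ σ τ : ty) : itm ((ρ ⇒ σ ⇒ τ) ⇒ (ρ ⇒ σ) ⇒ ρ ⇒ τ)
| iR : itm ((tN ⇒ tN ⇒ tN) ⇒ tN ⇒ tN ⇒ tN)
| iapp (σ τ : ty) : itm (σ ⇒ τ) -> itm σ -> itm τ.

Fixpoint ilev σ (t : itm σ) : nat :=
  match t with
  | ic i => S i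
  | iapp f a => max (ilev f) (ilev a)
  | _ => 0
  end.

Fixpoint wvar (n i : nat) : tm (wctx n) (wty i) :=
  match n with
  | 0 => dflt [] (wty i)
  | S n =>
      match Nat.eq_dec n i with
      | left e => eq_rect n (fun j => tm (wctx (S n)) (wty j)) (tvar v0) i e
      | right _ => ren_tm wk (wvar n i)
      end
  end.

(** [dn n t] expresses [t] at stage [n]; it is meaningful if [ilev t <= n]. *)
Fixpoint dn (n : nat) σ (t : itm σ) : tm (wctx n) σ :=
  match t with
  | ic i => wvar n i
  | izero => tzero
  | isucc => tsucc
  | iK σ τ => tK σ τ
  | iS ρ σ τ => tS ρ σ τ
  | iR => tR
  | iapp f a => tapp (dn n f) (dn n a)
  end.

Fixpoint wenv (n : nat) : env itm (wctx n) :=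
  match n return env itm (wctx n) with
  | 0 => @enil itm
  | S n => @econs itm _ _ (ic n) (@wenv n)
  end.
Arguments wenv n σ v : clear implicits.

Definition dne (n : nat) Γ (ρ : env itm Γ) : sbst Γ (wctx n) :=
  fun σ v => dn n (ρ σ v).

Lemma wvar_new n : wvar (S n) n = tvar v0.
Proof.
simpl; destruct (Nat.eq_dec n n) as [e|]; [|tauto].
now rewrite (UIP_refl_nat n e).
Qed.

Lemma wvar_old n i : i < n -> wvar (S n) i = ren_tm wk (wvar n i).
Proof. intros H; simpl; destruct (Nat.eq_dec n i); [lia|reflexivity]. Qed.

Lemma dn_wk n σ (t : itm σ) : ilev t <= n -> dn (S n) t = ren_tm wk (dn n t).
Proof.
induction t; intros H; try reflexivity.
- now apply wvar_old.
- cbn [ilev] in H; cbn [dn ren_tm].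
  rewrite IHt1, IHt2 by lia; reflexivity.
Qed.

Lemma dn_dn n k σ (t : itm σ) : ilev t <= k ->
  sub_tm (dne n (wenv k)) (dn k t) = dn n t.
Proof.
induction t; intros H; try reflexivity.
- cbn [ilev dn] in *; revert H; induction k; intros H; [lia|].
  destruct (Nat.eq_dec i k) as [->|]; [now rewrite wvar_new|].
  rewrite wvar_old, sub_ren_tm by lia; apply IHk; lia.
- cbn [ilev] in H; cbn [dn sub_tm].
  rewrite IHt1, IHt2 by lia; reflexivity.
Qed.

Lemma elev Γ (ρ : env itm Γ) : exists n, forall σ v, ilev (ρ σ v) <= n.
Proof.
induction Γ as [|τ Γ IH].
- exists 0; intros σ v; inversion v.
- destruct (IH (fun σ v => ρ σ (vS v))) as [n Hn].
  exists (max n (ilev (ρ τ v0))); apply var_case; [lia|].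
  intros σ v; specialize (Hn σ v); lia.
Qed.

(** * The Henkin construction *)

Section Henkin.
Variable T : theory.
Hypothesis T_closed : sub_closed T.
Variable A0 : fm [].
Hypothesis A0_unprovable : ~ proves T A0.

(** Constants that do not exist yet at stage [n] become default terms. This is harmless, as every
    formula returns at a stage where its constants exist. *)
Definition wfm_at (n : nat) : fm (wctx (S n)) :=
  sub_fm (wfm n) (up (τ := wty n) (dne n (wenv (wstage n)))).

Fixpoint whyp (n : nat) : list (fm (wctx n)) :=
  match n with
  | 0 => [Not A0]
  | S n =>
      let A := wfm_at n in
      let H := Imp A (wk_fm (wty n) (All (wty n) A))
                 :: map (@wk_fm _ (wty n)) (whyp n) in
      (if excluded_middle_informative (consistent T (A :: H)) then A else Not A) :: H
  end.

Lemma whyp_consistent n : consistent T (whyp n).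
Proof.
induction n; cbn [whyp].
- intros H; apply A0_unprovable, prv_raa, H.
- destruct excluded_middle_informative as [H|H]; [exact H|].
  apply consistent_lem; [now apply consistent_henkin|exact H].
Qed.

(** Truth in the term model: provability from some stage on. By [tr_of], one stage is enough if the
    parameters exist there. *)
Definition tr Γ (A : fm Γ) (ρ : env itm Γ) :=
  exists n0, forall n, n0 <= n -> prv T (whyp n) (sub_fm A (dne n ρ)).

Lemma dne_wk n Γ (ρ : env itm Γ) A : (forall σ v, ilev (ρ σ v) <= n) ->
  sub_fm A (dne (S n) ρ) = wk_fm _ (sub_fm A (dne n ρ)).
Proof.
intros Hρ; unfold wk_fm; rewrite sub_sub_fm; f_equal.
extensionality σ; extensionality v; unfold dne.
now rewrite dn_wk, ren_tm_sub.
Qed.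

Lemma tr_of Γ (A : fm Γ) ρ n : (forall σ v, ilev (ρ σ v) <= n) ->
  prv T (whyp n) (sub_fm A (dne n ρ)) -> tr A ρ.
Proof.
intros Hρ H; exists n; intros m Hm; induction Hm as [|m Hm IH]; [exact H|].
rewrite dne_wk by (intros σ v; specialize (Hρ σ v); lia).
apply (prv_incl (prv_wk T_closed _ IH)).
cbn [whyp]; now do 2 apply incl_tl.
Qed.

Lemma tr_impE Γ (A B : fm Γ) ρ : tr (Imp A B) ρ -> tr A ρ -> tr B ρ.
Proof.
intros [n Hn] [m Hm]; exists (max n m); intros k Hk.
exact (prv_impE (Hn k ltac:(lia)) (Hm k ltac:(lia))).
Qed.

Lemma tr_weak Γ (A B : fm Γ) ρ : tr B ρ -> tr (Imp A B) ρ.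
Proof.
intros [n Hn]; exists n; intros k Hk; cbn; apply prv_impI.
apply (prv_incl (Hn k Hk)); now apply incl_tl.
Qed.

Lemma tr_bot Γ (ρ : env itm Γ) : ~ tr Bot ρ.
Proof. intros [n Hn]; exact (whyp_consistent (Hn n (le_n n))). Qed.

Lemma tr_botE Γ (A : fm Γ) (ρ : env itm Γ) : tr (Not A) ρ -> tr A ρ -> False.
Proof. intros H1 H2; exact (tr_bot (tr_impE H1 H2)). Qed.

Lemma tr_ax Γ (A : fm Γ) (ρ : env itm Γ) : T A -> tr A ρ.
Proof. intros H; exists 0; intros n _; apply prv_ax, T_closed, H. Qed.

(** At a stage [k] where all parameters exist, [A] becomes a formula over [wctx k], which is treated
    at some stage [n] from [k] on; the witness is the constant introduced there. *)
Lemma tr_treated Γ τ (A : fm (τ :: Γ)) (ρ : env itm Γ) : exists n (t : itm τ),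
  (forall σ v, ilev (ρ σ v) <= n) /\ ilev t <= S n /\
  (In (sub_fm A (dne (S n) (econs t ρ))) (whyp (S n)) \/
   In (Not (sub_fm A (dne (S n) (econs t ρ)))) (whyp (S n))) /\
  In (Imp (sub_fm A (dne (S n) (econs t ρ))) (sub_fm (All τ A) (dne (S n) ρ)))
    (whyp (S n)).
Proof.
destruct (elev ρ) as [k Hk].
destruct (wfm_surj (sub_fm A (up (τ := τ) (dne k ρ))) k) as (n & Hn & E).
assert (Hρ : forall σ v, ilev (ρ σ v) <= n)
  by (intros σ v; specialize (Hk σ v); lia).
(* Rewriting the parameters at stage [k] and then at stage [n] gives the same as rewriting them at
   [n] directly, by [dn_dn]. *)
assert (EA : existT (fun τ => fm (τ :: wctx n)) (wty n) (wfm_at n)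
             = existT _ τ (sub_fm A (up (dne n ρ)))).
{ apply (f_equal (fun p => existT (fun τ => fm (τ :: wctx n)) (projT1 p)
    (sub_fm (projT2 (projT2 p))
       (up (τ := projT1 p) (dne n (wenv (projT1 (projT2 p)))))))) in E.
  cbn in E; unfold wfm_at; rewrite E; f_equal.
  rewrite sub_sub_fm, up_comp; f_equal; f_equal.
  extensionality σ; extensionality v; now apply dn_dn. }
exists n.
assert (Hτ : wty n = τ) by exact (f_equal (@projT1 _ _) EA).
destruct Hτ.
apply inj_pair2 in EA.
exists (ic n); split; [exact Hρ|split; [reflexivity|]].
replace (sub_fm A (dne (S n) (econs (ic n) ρ))) with (wfm_at n).
- cbn [whyp]; split.
  + destruct excluded_middle_informative; [left|right]; now left.
  + right; left; f_equal.
    rewrite (dne_wk (All (wty n) A) Hρ).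
    f_equal; cbn; f_equal; exact EA.
- rewrite EA; f_equal; apply sbst_ext; [symmetry; apply wvar_new|].
  intros σ v; cbn; symmetry; now apply dn_wk.
Qed.

Lemma lev_econs n Γ τ (t : itm τ) (ρ : env itm Γ) :
  (forall σ v, ilev (ρ σ v) <= n) -> ilev t <= n ->
  forall σ v, ilev (@econs itm _ _ t ρ σ v) <= n.
Proof. intros Hρ Ht; now apply var_case. Qed.

Lemma tr_dec Γ (A : fm Γ) ρ : tr A ρ \/ tr (Not A) ρ.
Proof.
(* The stages treat formulas with one more variable, so a vacuous one is added. *)
destruct (tr_treated (wk_fm tN A) ρ) as (n & t & Hρ & Ht & H & _).
assert (E : sub_fm (wk_fm tN A) (dne (S n) (econs t ρ))
            = sub_fm A (dne (S n) ρ)).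
{ unfold wk_fm; rewrite sub_sub_fm; reflexivity. }
rewrite E in H.
assert (Hρ' : forall σ v, ilev (ρ σ v) <= S n)
  by (intros σ v; specialize (Hρ σ v); lia).
destruct H as [H|H]; [left|right]; apply (tr_of Hρ'), prv_hyp, H.
Qed.

(** Truth of [A] at the Henkin witness [t] alone already yields [All σ A] by the axiom added for
    it. *)
Lemma tr_allI Γ σ (A : fm (σ :: Γ)) ρ :
  (forall x, tr A (econs x ρ)) -> tr (All σ A) ρ.
Proof.
intros HA.
destruct (tr_treated A ρ) as (n & t & Hρ & Ht & _ & H).
assert (Hρ' : forall σ v, ilev (ρ σ v) <= S n)
  by (intros τ v; specialize (Hρ τ v); lia).
destruct (tr_dec (All σ A) ρ) as [|HN]; [assumption|exfalso].
assert (HW : tr (Imp A (wk_fm σ (All σ A))) (econs t ρ)).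
{ apply (tr_of (n := S n)); [now apply lev_econs|].
  apply prv_hyp.
  assert (E : sub_fm (wk_fm σ (All σ A)) (dne (S n) (econs t ρ))
            = sub_fm (All σ A) (dne (S n) ρ)).
  { unfold wk_fm; rewrite sub_sub_fm; reflexivity. }
  cbn [sub_fm] in E |- *; rewrite E; exact H. }
destruct (tr_impE HW (HA t)) as [m Hm].
apply (tr_botE HN); exists m; intros k Hk; specialize (Hm k Hk).
unfold wk_fm in Hm; rewrite sub_sub_fm in Hm; exact Hm.
Qed.

Lemma tr_allE Γ σ (A : fm (σ :: Γ)) ρ x :
  tr (All σ A) ρ -> tr A (econs x ρ).
Proof.
intros [n Hn]; exists n; intros k Hk; specialize (Hn k Hk).
apply (prv_allE (dn k x)) in Hn; rewrite inst_up in Hn.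
replace (dne k (econs x ρ)) with (scons (dn k x) (dne k ρ)); [exact Hn|].
apply sbst_ext; reflexivity.
Qed.

Definition wstruct : struct := {|
  dom := itm; sap := iapp; szero := izero; ssucc := isucc; sK := iK; sS := iS;
  sR := iR;
  sE := fun t u =>
    tr (Eq0 (tvar v0) (tvar (vS v0))) (econs t (econs u (@enil itm))) |}.

Lemma dn_teval n Γ (ρ : env wstruct Γ) σ (t : tm Γ σ) :
  dn n (teval ρ t) = sub_tm (dne n ρ) t.
Proof. induction t; cbn; try reflexivity; now rewrite IHt1, IHt2. Qed.

Lemma truth Γ (A : fm Γ) : forall ρ : env wstruct Γ, sat A ρ <-> tr A ρ.
Proof.
induction A; intros ρ; cbn [sat].
- cbn; unfold tr; cbn; split; intros [n0 H]; exists n0; intros n Hn;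
    specialize (H n Hn); unfold dne in *; cbn in *; now rewrite !dn_teval in *.
- split; [tauto|apply tr_bot].
- rewrite IHA1, IHA2; split; [intros H|apply tr_impE].
  destruct (tr_dec A1 ρ) as [H1|H1]; [now apply tr_weak, H|].
  destruct H1 as [n Hn]; exists n; intros k Hk; apply prv_impI, prv_botE.
  apply (prv_impE (A := sub_fm A1 (dne k ρ))); [|apply prv_hyp; now left].
  apply (prv_incl (Hn k Hk)); now apply incl_tl.
- split; intros H.
  + apply tr_allI; intros x; apply IHA, H.
  + intros x; apply IHA, tr_allE, H.
Qed.

Lemma wstruct_models : models T wstruct.
Proof. intros Γ A ρ HA; now apply truth, tr_ax. Qed.

Lemma wstruct_refutes : ~ sat (M := wstruct) A0 (@enil itm).
Proof.
intros H%truth; apply (@tr_botE [] A0 (@enil itm)); [|exact H].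
apply (tr_of (n := 0)); [intros σ v; inversion v|].
apply prv_hyp; left; cbn; unfold Not; f_equal.
rewrite <- (sub_fm_id A0) at 1; apply f_equal.
extensionality σ; extensionality v; inversion v.
Qed.
End Henkin.

Theorem completeness (T : theory) (A : fm []) : sub_closed T ->
  (forall M : struct, models T M -> sat (M := M) A enil) -> proves T A.
Proof.
intros HT HA; apply NNPP; intros HN.
exact (wstruct_refutes HT HN (HA _ (wstruct_models HT HN))).
Qed.

Lemma sat_Not (M : struct) Γ (A : fm Γ) (ρ : env M Γ) :
  sat (Not A) ρ = ~ sat A ρ.
Proof. reflexivity. Qed.

Lemma sat_And (M : struct) Γ (A B : fm Γ) (ρ : env M Γ) :
  sat (And A B) ρ = (sat A ρ /\ sat B ρ).
Proof. apply propositional_extensionality; cbn; tauto. Qed.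

Lemma sat_Or (M : struct) Γ (A B : fm Γ) (ρ : env M Γ) :
  sat (Or A B) ρ = (sat A ρ \/ sat B ρ).
Proof. apply propositional_extensionality; cbn; tauto. Qed.

Lemma sat_Iff (M : struct) Γ (A B : fm Γ) (ρ : env M Γ) :
  sat (Iff A B) ρ = (sat A ρ <-> sat B ρ).
Proof. apply propositional_extensionality; cbn; tauto. Qed.

Lemma sat_Imp (M : struct) Γ (A B : fm Γ) (ρ : env M Γ) :
  sat (Imp A B) ρ = (sat A ρ -> sat B ρ).
Proof. reflexivity. Qed.

Lemma sat_Ex (M : struct) Γ σ (A : fm (σ :: Γ)) (ρ : env M Γ) :
  sat (Ex A) ρ = exists x, sat A (econs x ρ).
Proof.
apply propositional_extensionality; cbn; split.
- intros H; apply NNPP; intros HN; apply H; intros x Hx; apply HN; now exists x.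
- intros [x Hx] HN; exact (HN x Hx).
Qed.

Lemma sat_ExB (M : struct) Γ σ (f : tm (σ :: Γ) σ -> fm (σ :: Γ))
  (ρ : env M Γ) :
  sat (ExB σ f) ρ = exists x, sat (f (tvar v0)) (econs x ρ).
Proof. apply sat_Ex. Qed.

Lemma sat_AllB (M : struct) Γ σ (f : tm (σ :: Γ) σ -> fm (σ :: Γ))
  (ρ : env M Γ) :
  sat (AllB σ f) ρ = forall x, sat (f (tvar v0)) (econs x ρ).
Proof. reflexivity. Qed.

Lemma teval_lift (M : struct) (Γ Δ : ctx) (e : emb Γ Δ) (ρ : env M Δ) σ
  (t : tm Γ σ) :
  teval ρ (lift t) = teval (fun τ v => ρ τ (emb_ren v)) t.
Proof. apply teval_ren. Qed.

(** * Extensional models *)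

Record good (M : struct) : Prop := {
  good_E : forall x y : M tN, sE x y <-> x = y;
  good_ext : forall σ τ (f g : M (σ ⇒ τ)),
    (forall x, sap f x = sap g x) -> f = g;
  good_models : models (add_axiom RCA0w WKL) M }.

Section Quotient.
Variable M : struct.
Hypothesis MT : models (add_axiom RCA0w WKL) M.

Fixpoint EE (σ : ty) : M σ -> M σ -> Prop :=
  match σ return M σ -> M σ -> Prop with
  | tN => fun x y => sE x y
  | Arr σ τ => fun f g => forall x, EE (sap f x) (sap g x)
  end.

Lemma sat_eqT σ : forall Γ (t u : tm Γ σ) (ρ : env M Γ),
  sat (eqT t u) ρ <-> EE (teval ρ t) (teval ρ u).
Proof.
induction σ; intros Γ t u ρ; [reflexivity|].
cbn [eqT EE]; rewrite sat_AllB; split; intros H x; specialize (H x);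
  apply IHσ2 in H || apply IHσ2; cbn [teval] in *;
  rewrite !teval_lift in *; exact H.
Qed.

Lemma EE_refl σ (x : M σ) : EE x x.
Proof.
revert x; induction σ; intros f; [|intros x; apply IHσ2].
exact (@MT [tN] _ (econs f (@enil M)) (or_introl (ax_refl (tvar v0)))).
Qed.

Lemma EE_sym σ (x y : M σ) : EE x y -> EE y x.
Proof.
revert x y; induction σ; intros f g; [|intros H x; apply IHσ2, H].
exact (@MT [tN; tN] _ (econs f (econs g (@enil M)))
  (or_introl (ax_sym (tvar v0) (tvar (vS v0))))).
Qed.

Lemma EE_trans σ (x y z : M σ) : EE x y -> EE y z -> EE x z.
Proof.
revert x y z; induction σ; intros f g h;
  [|intros H H' x; exact (IHσ2 _ _ _ (H x) (H' x))].
exact (@MT [tN; tN; tN] _ (econs f (econs g (econs h (@enil M))))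
  (or_introl (ax_trans (tvar v0) (tvar (vS v0)) (tvar (vS (vS v0)))))).
Qed.

(** For the argument this is the extensionality axiom; it makes application well defined on the
    quotient. *)
Lemma EE_ap σ τ (f g : M (σ ⇒ τ)) (x y : M σ) :
  EE f g -> EE x y -> EE (sap f x) (sap g y).
Proof.
intros Hf Hx; apply EE_trans with (sap g x); [apply Hf|].
pose proof (@MT [σ ⇒ τ; σ; σ] _ (econs g (econs x (econs y (@enil M))))
  (or_introl (ax_ext (tvar v0) (tvar (vS v0)) (tvar (vS (vS v0)))))) as H.
rewrite sat_Imp, !sat_eqT in H; exact (H Hx).
Qed.

(** Classes are predicates, so equivalent elements get equal classes by functional and propositional
    extensionality. *)
Definition quot (σ : ty) := {P : M σ -> Prop | exists x, P = EE x}.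
Definition cls σ (x : M σ) : quot σ := exist _ (EE x) (ex_intro _ x eq_refl).
Definition rp σ (q : quot σ) : M σ :=
  proj1_sig (constructive_indefinite_description _ (proj2_sig q)).

Lemma cls_eq σ (x y : M σ) : EE x y -> cls x = cls y.
Proof.
intros H; apply subset_eq_compat; extensionality z.
apply propositional_extensionality; split; apply EE_trans; auto using EE_sym.
Qed.

Lemma cls_inj σ (x y : M σ) : cls x = cls y -> EE x y.
Proof.
intros H%(f_equal (fun q => proj1_sig q y)); cbn in H; rewrite H.
apply EE_refl.
Qed.

Lemma cls_rp σ (q : quot σ) : cls (rp q) = q.
Proof.
unfold rp; destruct constructive_indefinite_description as [x Hx]; cbn.
destruct q as [P HP]; cbn in Hx; subst P.
now apply subset_eq_compat.
Qed.

Definition qstruct : struct := {|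
  dom := quot;
  sap := fun σ τ f x => cls (sap (rp f) (rp x));
  szero := cls szero; ssucc := cls ssucc;
  sK := fun σ τ => cls (sK σ τ); sS := fun ρ σ τ => cls (sS ρ σ τ);
  sR := cls sR;
  sE := eq |}.

Lemma cls_ap σ τ (f : M (σ ⇒ τ)) x :
  sap (s := qstruct) (cls f) (cls x) = cls (sap f x).
Proof. apply cls_eq, EE_ap; apply cls_inj, cls_rp. Qed.

Lemma teval_cls Γ (ρ : env M Γ) σ (t : tm Γ σ) :
  teval (M := qstruct) (fun τ v => cls (ρ τ v)) t = cls (teval ρ t).
Proof.
induction t; try reflexivity.
cbn [teval]; rewrite IHt1, IHt2; apply cls_ap.
Qed.

Lemma econs_cls Γ σ (x : M σ) (ρ : env M Γ) :
  econs (D := quot) (cls x) (fun τ v => cls (ρ τ v))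
  = (fun τ v => cls (@econs M _ _ x ρ τ v)).
Proof. apply env_ext; reflexivity. Qed.

Lemma sat_cls Γ (A : fm Γ) : forall ρ : env M Γ,
  sat (M := qstruct) A (fun τ v => cls (ρ τ v)) <-> sat A ρ.
Proof.
induction A; intros ρ; cbn [sat].
- rewrite !teval_cls; split; [apply cls_inj|apply (@cls_eq tN)].
- reflexivity.
- now rewrite IHA1, IHA2.
- split; intros H x.
  + apply IHA; rewrite <- econs_cls; apply H.
  + rewrite <- (cls_rp x), econs_cls; apply IHA, H.
Qed.

Lemma qstruct_good : good qstruct.
Proof.
split.
- reflexivity.
- intros σ τ f g H; rewrite <- (cls_rp f), <- (cls_rp g) in *.
  apply cls_eq; intros x; apply cls_inj.
  rewrite <- !cls_ap; apply H.
- intros Γ A ρ HA.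
  replace ρ with (fun τ v => cls (rp (ρ τ v))).
  + apply sat_cls, MT, HA.
  + extensionality τ; extensionality v; apply cls_rp.
Qed.
End Quotient.

Theorem provable_of_good (A : fm []) :
  (forall M, good M -> sat (M := M) A enil) ->
  proves (add_axiom RCA0w WKL) A.
Proof.
intros HA; apply completeness; [exact WKL_sub_closed|].
intros M HM; specialize (HA _ (qstruct_good HM)).
apply (sat_cls HM); erewrite f_equal; [exact HA|].
extensionality σ; extensionality v; inversion v.
Qed.

From HB Require Import structures.
From mathcomp Require Import ssreflect ssrfun ssrbool eqtype choice.
From mathcomp Require Import order ssralg ssrnum boolp lra.
Import Order.TTheory GRing.Theory Num.Theory.
Close Scope tm_scope.

Record gmodel := { gstruct :> struct; gmP : good gstruct }.

Notation "f $ x" := (sap f x) (at level 12, left associativity).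
Notation NM M := (dom (gstruct M) tN).

(** * Representable functions *)

Section Representability.
Context (M : gmodel).

Lemma sap_ext σ τ (f g : M (σ ⇒ τ)) : (forall x, f $ x = g $ x) -> f = g.
Proof. exact: (good_ext (gmP M)). Qed.

Lemma sat_eqTE σ : forall Γ (t u : tm Γ σ) (ρ : env M Γ),
  sat (eqT t u) ρ <-> teval ρ t = teval ρ u.
Proof.
elim: σ => [|σ1 _ σ2 IH] Γ t u ρ; first exact: (good_E (gmP M)).
split=> [H|E x]; last by apply/IH; rewrite /= !teval_lift E.
by apply: sap_ext => x; have /IH := H x; rewrite /= !teval_lift.
Qed.

Lemma sat_RCA Γ (A : fm Γ) (ρ : env M Γ) : RCA0w A -> sat A ρ.
Proof. by move=> HA; apply: (good_models (gmP M)); left. Qed.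

Lemma sKE σ τ (x : M σ) (y : M τ) : sK σ τ $ x $ y = x.
Proof.
by move/sat_eqTE: (sat_RCA (econs x (econs y (@enil M)))
  (ax_K (tvar v0) (tvar (vS v0)))).
Qed.

Lemma sSE ρ σ τ (x : M (ρ ⇒ σ ⇒ τ)) (y : M (ρ ⇒ σ)) (z : M ρ) :
  sS ρ σ τ $ x $ y $ z = x $ z $ (y $ z).
Proof.
by move/sat_eqTE: (sat_RCA (econs x (econs y (econs z (@enil M))))
  (ax_S (tvar v0) (tvar (vS v0)) (tvar (vS (vS v0))))).
Qed.

Lemma sR0 (f : M (tN ⇒ tN ⇒ tN)) m : sR $ f $ m $ szero = m.
Proof.
by move/(good_E (gmP M)): (sat_RCA (econs f (econs m (@enil M)))
  (ax_R0 (tvar v0) (tvar (vS v0)))).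
Qed.

Lemma sRS (f : M (tN ⇒ tN ⇒ tN)) m n :
  sR $ f $ m $ (ssucc $ n) = f $ n $ (sR $ f $ m $ n).
Proof.
by move/(good_E (gmP M)): (sat_RCA (econs f (econs m (econs n (@enil M))))
  (ax_RS (tvar v0) (tvar (vS v0)) (tvar (vS (vS v0))))).
Qed.

Lemma succ_neq0 (n : NM M) : ssucc $ n <> szero.
Proof.
move=> H; apply: (sat_RCA (econs n (@enil M)) (ax_succ0 (tvar v0))).
exact/(good_E (gmP M)).
Qed.

(** The one instance of the induction axiom that is used. This shape is enough for the case
    distinction on numbers and for truncated subtraction; with these, every decidable predicate
    becomes a single equation, see [ind]. *)
Lemma qf_ind (f1 g1 f2 g2 f3 g3 : M one) (P := fun n =>
    (f1 $ n = g1 $ n -> f2 $ n = g2 $ n) -> f3 $ n = g3 $ n) :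
  P szero -> (forall n, P n -> P (ssucc $ n)) -> forall n, P n.
Proof.
pose Γ := [one; one; one; one; one; one].
pose app (f : var (tN :: Γ) one) := (tvar f · tvar v0)%tm.
pose A : fm (tN :: Γ) := Imp (Imp (Eq0 (app (vS v0)) (app (vS (vS v0))))
   (Eq0 (app (vS (vS (vS v0)))) (app (vS (vS (vS (vS v0)))))))
   (Eq0 (app (vS (vS (vS (vS (vS v0)))))) (app (vS (vS (vS (vS (vS (vS v0)))))))).
have := sat_RCA (econs f1 (econs g1 (econs f2 (econs g2 (econs f3 (econs g3
  (@enil M))))))) (@ax_QFIA Γ A ltac:(cbn; tauto)).
rewrite !sat_Imp /inst /= => H H0 HS n; have E := good_E (gmP M).
have := H _ _ n; rewrite !E. apply; first exact: H0.
by move=> {}n; rewrite !E; apply: HS.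
Qed.

Lemma qf_ac (F : M (one ⇒ tN ⇒ tN)) :
  (forall x, exists n, F $ x $ n = szero) ->
  exists G : M two, forall x, F $ x $ (G $ x) = szero.
Proof.
move=> HF.
pose A : fm [tN; one; one ⇒ tN ⇒ tN] :=
  Eq0 (tvar (vS (vS v0)) · tvar (vS v0) · tvar v0)%tm tzero.
have E := good_E (gmP M).
have := sat_RCA (econs F (@enil M)) (@ax_QFAC10 _ A ltac:(cbn; tauto)).
rewrite sat_Imp !sat_Ex => -[|G HG].
- by move=> x; rewrite sat_Ex; have [n Hn] := HF x; exists n; apply/E.
by exists G => x; have := HG x => /E.
Qed.

Lemma dom_inh σ : inhabited (M σ).
Proof. constructor; exact (teval (@enil M) (dflt [] σ)). Qed.

(** The element representing [h]; junk unless [h] is representable, see [fnE]. *)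
Definition fn σ τ (h : M σ -> M τ) : M (σ ⇒ τ) :=
  epsilon (dom_inh (σ ⇒ τ)) (fun F => forall x, F $ x = h x).

Fixpoint tup (Γ : ctx) : Type :=
  match Γ with [] => unit | σ :: Γ => (M σ * tup Γ)%type end.

(** The head of the context is the last argument, so abstracting it in [rep_fn] keeps the
    representing element. *)
Fixpoint arr (Γ : ctx) (τ : ty) : ty :=
  match Γ with [] => τ | σ :: Γ => arr Γ (σ ⇒ τ) end.

Fixpoint apps Γ : forall τ, M (arr Γ τ) -> tup Γ -> M τ :=
  match Γ with
  | [] => fun τ F _ => F
  | σ :: Γ => fun τ F ρ => @apps Γ (σ ⇒ τ) F (snd ρ) $ fst ρ
  end.

(** The functions of several variables that are given by an element of the model. The tactics below
    prove this by following the structure of an expression. *)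
Definition Rep Γ τ (f : tup Γ -> M τ) := exists F, forall ρ, apps F ρ = f ρ.

Lemma rep_const Γ τ (c : M τ) : Rep (fun _ : tup Γ => c).
Proof.
elim: Γ τ c => [|σ Γ IH] τ c; first by exists c.
have [F HF] := IH _ (sK τ σ $ c).
by exists F => -[x ρ] /=; rewrite HF sKE.
Qed.

(** Bracket abstraction, with one [sS] for each variable of the context. *)
Lemma rep_ap Γ σ τ (f : tup Γ -> M (σ ⇒ τ)) (g : tup Γ -> M σ) :
  Rep f -> Rep g -> Rep (fun ρ => f ρ $ g ρ).
Proof.
move=> [F HF] [G HG].
suff [H HH] : Rep (fun ρ => apps F ρ $ apps G ρ)
  by exists H => ρ; rewrite HH HF HG.
elim: Γ σ τ F G {f g HF HG} => [|υ Γ IH] σ τ F G; first by exists (F $ G).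
have [F1 H1] := rep_const Γ (sS υ σ τ).
have [F2 H2] := IH _ _ F1 F.
have [F3 H3] := IH _ _ F2 G.
by exists F3 => -[x ρ] /=; rewrite H3 H2 H1 sSE.
Qed.

Lemma rep_v0 Γ σ : Rep (fun ρ : tup (σ :: Γ) => fst ρ).
Proof.
have [F HF] := rep_const Γ (sS σ (σ ⇒ σ) σ $ sK σ (σ ⇒ σ) $ sK σ σ).
by exists F => -[x ρ] /=; rewrite HF sSE sKE.
Qed.

Lemma rep_wk Γ σ τ (f : tup Γ -> M τ) :
  Rep f -> Rep (fun ρ : tup (σ :: Γ) => f (snd ρ)).
Proof.
move=> Hf; have [F HF] := rep_ap (rep_const Γ (sK τ σ)) Hf.
by exists F => -[x ρ] /=; rewrite HF sKE.
Qed.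

Lemma fn_spec σ τ (h : M σ -> M τ) F : (forall x, F $ x = h x) -> fn h = F.
Proof.
move=> HF; apply: sap_ext => x; rewrite HF.
exact: (epsilon_spec (dom_inh (σ ⇒ τ)) (fun F => forall x, F $ x = h x)
  (ex_intro _ F HF)).
Qed.

Lemma rep_fn Γ σ τ (h : tup Γ -> M σ -> M τ) :
  Rep (fun ρ : tup (σ :: Γ) => h (snd ρ) (fst ρ)) -> Rep (fun ρ => fn (h ρ)).
Proof.
move=> [F HF]; exists F => ρ; symmetry; apply: fn_spec => x.
exact: (HF (x, ρ)).
Qed.

Lemma fnE σ τ (h : M σ -> M τ) : Rep (fun ρ : tup [σ] => h (fst ρ)) ->
  forall x, fn h $ x = h x.
Proof.
move=> [F HF] x; rewrite (fn_spec (F := F)); first exact: (HF (x, tt)).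
by move=> y; exact: (HF (y, tt)).
Qed.

Lemma rep_ext Γ τ (f g : tup Γ -> M τ) : (forall ρ, f ρ = g ρ) ->
  Rep f -> Rep g.
Proof. by move=> H [F HF]; exists F => ρ; rewrite HF. Qed.
End Representability.
#[global] Opaque fn.

Ltac rep_var :=
  lazymatch goal with
  | |- @Rep ?M (cons ?σ ?Γ) ?τ ?f =>
      first
        [ exact (@rep_v0 M Γ σ)
        | let g := eval cbn [fst snd] in
            (fun (x : dom (gstruct M) σ) (ρ : tup M Γ) => f (x, ρ)) in
          lazymatch g with
          | fun _ => ?h => apply (@rep_wk M Γ σ τ h); rep_var
          end ]
  end.
Ltac rep_leaf := first [apply rep_const | eassumption | rep_var].
Ltac rep_core :=
  cbv beta;
  lazymatch goal with
  | |- Rep (fun _ => ?c) => apply rep_const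
  | |- Rep (fun ρ => sap (@?f ρ) (@?g ρ)) => apply (@rep_ap _ _ _ _ f g); rep_core
  | |- Rep (fun ρ => fn (@?h ρ)) => apply (@rep_fn _ _ _ _ h); rep_core
  | |- Rep _ => rep_leaf
  end.

(** * Arithmetic *)

Section Arithmetic.
Context {M : gmodel}.
Implicit Types x y z : NM M.

Definition nS x := ssucc $ x.
Notation "0" := (@szero M).
Notation "1" := (nS 0).

Definition addC : M (tN ⇒ tN ⇒ tN) :=
  fn (fun x => fn (fun y => sR $ fn (fun _ => ssucc) $ x $ y)).
Definition nadd x y := addC $ x $ y.
Definition predC : M one := fn (fun x => sR $ sK tN tN $ szero $ x).
Definition npred x := predC $ x.
Definition condC : M (tN ⇒ tN ⇒ tN ⇒ tN) :=
  fn (fun c => fn (fun a => fn (fun b =>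
    sR $ fn (fun _ => fn (fun _ => b)) $ a $ c))).
Definition ncond c x y := condC $ c $ x $ y.
Definition mulC : M (tN ⇒ tN ⇒ tN) :=
  fn (fun x => fn (fun y => sR $ fn (fun _ => fn (fun r => nadd r x)) $ 0 $ y)).
Definition nmul x y := mulC $ x $ y.
Definition subC : M (tN ⇒ tN ⇒ tN) :=
  fn (fun x => fn (fun y => sR $ fn (fun _ => fn (fun r => npred r)) $ x $ y)).
Definition nsub x y := subC $ x $ y.
End Arithmetic.

Ltac rep := intros; rewrite /nS /nadd /npred /ncond /nmul /nsub; rep_core.
Ltac fnrw := repeat (rewrite fnE; [|by rep]).

Declare Scope nm_scope.
Delimit Scope nm_scope with nm.
Notation "0" := szero : nm_scope.
Notation "1" := (nS szero) : nm_scope.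
Infix "+" := nadd : nm_scope.
Infix "*" := nmul : nm_scope.
Infix "-" := nsub : nm_scope.
Open Scope nm_scope.

Section ArithmeticTheory.
Context {M : gmodel}.
Implicit Types x y z : NM M.

Lemma nadd0 x : x + 0 = x.
Proof. by rewrite /nadd /addC; fnrw; rewrite sR0. Qed.

Lemma naddS x y : x + nS y = nS (x + y).
Proof. by rewrite /nadd /addC; fnrw; rewrite sRS; fnrw. Qed.

Lemma npred0 : npred 0 = 0 :> NM M.
Proof. by rewrite /npred /predC; fnrw; rewrite sR0. Qed.

Lemma npredS x : npred (nS x) = x.
Proof. by rewrite /npred /predC; fnrw; rewrite sRS sKE. Qed.

Lemma ncond0 x y : ncond 0 x y = x.
Proof. by rewrite /ncond /condC; fnrw; rewrite sR0. Qed.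

Lemma ncondS c x y : ncond (nS c) x y = y.
Proof. by rewrite /ncond /condC; fnrw; rewrite sRS; fnrw. Qed.

Lemma nmul0 x : x * 0 = 0.
Proof. by rewrite /nmul /mulC; fnrw; rewrite sR0. Qed.

Lemma nmulS x y : x * nS y = x * y + x.
Proof. by rewrite /nmul /mulC; fnrw; rewrite sRS; fnrw. Qed.

Lemma nsub0 x : x - 0 = x.
Proof. by rewrite /nsub /subC; fnrw; rewrite sR0. Qed.

Lemma nsubS x y : x - nS y = npred (x - y).
Proof. by rewrite /nsub /subC; fnrw; rewrite sRS; fnrw. Qed.

Definition Rep1 (f : NM M -> NM M) := Rep (fun ρ : tup M [tN] => f (fst ρ)).

Lemma ind_imp (f1 g1 f2 g2 f3 g3 : NM M -> NM M) (P := fun n =>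
    (f1 n = g1 n -> f2 n = g2 n) -> f3 n = g3 n) :
  Rep1 f1 -> Rep1 g1 -> Rep1 f2 -> Rep1 g2 -> Rep1 f3 -> Rep1 g3 ->
  P 0 -> (forall n, P n -> P (nS n)) -> forall n, P n.
Proof.
move=> H1 H2 H3 H4 H5 H6 H0 HS n.
have := @qf_ind M (fn f1) (fn g1) (fn f2) (fn g2) (fn f3) (fn g3).
have E f : Rep1 f -> sap (fn f) = f by move=> Hf; extensionality x; apply: fnE.
by rewrite !E //; apply.
Qed.

Lemma ind_eq (f g : NM M -> NM M) : Rep1 f -> Rep1 g ->
  f 0 = g 0 -> (forall n, f n = g n -> f (nS n) = g (nS n)) ->
  forall n, f n = g n.
Proof.
move=> Hf Hg H0 HS n.
have H (z : NM M) : Rep1 (fun _ => z) by rewrite /Rep1; rep.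
apply: (ind_imp (H 0) (H 0) (H 0) (H 0) Hf Hg) => // {}n IH _.
by apply/HS/IH.
Qed.

Lemma nat_case x : x = 0 \/ x = nS (npred x).
Proof.
have H (z : NM M) : Rep1 (fun _ => z) by rewrite /Rep1; rep.
case: (pselect (x = 0)) => [|Hx]; [by left|right].
apply: (@ind_imp id (fun=> 0) (fun=> 0) (fun=> 1) id
  (fun x => nS (npred x))) => //; try by rewrite /Rep1; rep.
- by move/(_ erefl)/esym/succ_neq0.
- by move=> n _ _; rewrite npredS.
Qed.
End ArithmeticTheory.

Ltac eqind x :=
  revert x;
  match goal with |- forall x, @?f x = @?g x =>
    apply (@ind_eq _ f g); [rewrite /Rep1; rep|rewrite /Rep1; rep| |];
    cbv beta
  end.

Section OrderedSemiring.
Context {M : gmodel}.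
Implicit Types x y z : NM M.

Lemma nadd0l x : 0 + x = x.
Proof. by eqind x => [|x IH]; rewrite ?nadd0 // naddS IH. Qed.

Lemma naddSl x y : nS x + y = nS (x + y).
Proof. by eqind y => [|y IH]; rewrite ?nadd0 // !naddS IH. Qed.

Lemma naddC x y : x + y = y + x.
Proof.
by eqind x => [|x IH]; [rewrite nadd0 nadd0l|rewrite naddS naddSl IH].
Qed.

Lemma naddA x y z : x + (y + z) = x + y + z.
Proof. by eqind z => [|z IH]; rewrite ?nadd0 // !naddS IH. Qed.

Lemma nmul0l x : 0 * x = 0.
Proof. by eqind x => [|x IH]; rewrite ?nmul0 // nmulS IH nadd0. Qed.

Lemma nmulSl x y : nS x * y = x * y + y.
Proof.
eqind y => [|y IH]; first by rewrite !nmul0 nadd0.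
by rewrite !nmulS IH !naddS -!naddA (naddC x y).
Qed.

Lemma nmulC x y : x * y = y * x.
Proof.
by eqind x => [|x IH]; [rewrite nmul0 nmul0l|rewrite nmulS nmulSl IH].
Qed.

Lemma nmul_addl x y z : (x + y) * z = x * z + y * z.
Proof.
eqind z => [|z IH]; first by rewrite !nmul0 nadd0.
by rewrite !nmulS IH -!naddA; congr nadd; rewrite !naddA (naddC x).
Qed.

Lemma nmulA x y z : x * (y * z) = x * y * z.
Proof.
eqind z => [|z IH]; first by rewrite !nmul0.
by rewrite !nmulS (nmulC x) nmul_addl nmulC IH (nmulC y).
Qed.

Lemma nmul1l x : 1 * x = x.
Proof. by rewrite nmulSl nmul0l nadd0l. Qed.

Lemma NM_semiring :
  semi_ring_theory (R := NM M) szero (nS szero) nadd nmul (@eq (NM M)).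
Proof.
split; [exact: nadd0l|exact: naddC|exact: naddA|exact: nmul1l|exact: nmul0l|
  exact: nmulC|exact: nmulA|exact: nmul_addl].
Qed.
Add Ring NM_ring : NM_semiring.

Lemma nS_add x : nS x = x + 1.
Proof. by rewrite naddS nadd0. Qed.

Definition nle x y := x - y = 0.
Definition nlt x y := nle (nS x) y.

Lemma nsubSS x y : nS x - nS y = x - y.
Proof.
by eqind y => [|y IH]; rewrite nsubS; [rewrite !nsub0 npredS|rewrite IH nsubS].
Qed.

Lemma nsub_addr x y : (x + y) - y = x.
Proof. by eqind y => [|y IH]; [rewrite nadd0 nsub0|rewrite naddS nsubSS IH]. Qed.

Lemma nsub_lem1 x y : x - y = 0 \/ y + (x - y) = x.
Proof.
have H z : Rep1 (fun _ : NM M => z) by rewrite /Rep1; rep.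
case: (pselect (x - y = 0)) => [|Hx]; [by left|right].
apply: (@ind_imp M (fun y => x - y) (fun=> 0) (fun=> 0) (fun=> 1)
  (fun y => y + (x - y)) (fun=> x)) => //; try by rewrite /Rep1; rep.
- by move=> _; rewrite nsub0 nadd0l.
- move=> {Hx}y IH HS; have Hx : x - y <> 0.
    by move=> E; move: HS; rewrite nsubS E npred0 => /(_ erefl)/esym/succ_neq0.
  have := IH (fun e => False_ind _ (Hx e)).
  case: (nat_case (x - y)) => // E; rewrite E naddS => IHE.
  by rewrite nsubS naddSl IHE.
Qed.

Lemma nsub_lem2 x y : x - y = 0 -> x + (y - x) = y.
Proof.
have H z : Rep1 (fun _ : NM M => z) by rewrite /Rep1; rep.
move=> Hx; apply: (@ind_imp M (fun=> 0) (fun=> 0) (fun y => x - y) (fun=> 0)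
  (fun y => x + (y - x)) id) => //; try by rewrite /Rep1; rep.
- by move/(_ erefl); rewrite nsub0 => ->; rewrite nadd0l nsub0.
- move=> {Hx}y IH /(_ erefl); rewrite nsubS => E.
  case: (nat_case (x - y)) => E'.
    have {}IH := IH (fun=> E').
    have -> : nS y - x = nS (y - x).
      by rewrite -{1}IH -naddS naddC nsub_addr.
    by rewrite naddS IH.
  case: (nsub_lem1 x y) => [E''|].
    by rewrite E'' in E'; case: (succ_neq0 (esym E')).
  rewrite E' E naddS nadd0 => <-.
  have := nsub_addr 0 (nS y); rewrite nadd0l => ->; exact: nadd0.
Qed.

Lemma nleP x y : nle x y <-> exists z, y = x + z.
Proof.
split=> [/nsub_lem2 E|[z ->]]; first by exists (y - x).
rewrite /nle; eqind z => [|z IH]; first by rewrite -{1}(nadd0l x) nadd0 nsub_addr.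
by rewrite naddS nsubS IH npred0.
Qed.

Lemma nle_anti x y : nle x y -> nle y x -> x = y.
Proof. by rewrite /nle => /nsub_lem2 E E'; rewrite -{}E E' nadd0. Qed.

Lemma nadd_eq0 x y : x + y = 0 -> x = 0 /\ y = 0.
Proof.
case: (nat_case y) => [->|->]; first by rewrite nadd0.
by rewrite naddS => /succ_neq0.
Qed.

Lemma eqc_eq0 x y : (x - y) + (y - x) = 0 <-> x = y.
Proof.
split=> [/nadd_eq0[H H']|->]; first exact: nle_anti.
by have := nsub_addr 0 y; rewrite nadd0l => ->; rewrite nadd0.
Qed.

(** * Decidable predicates *)

(** The value 0 stands for truth, so that induction for equations applies to the predicate. *)
Definition Dec Γ (P : tup M Γ -> Prop) :=
  exists2 f : tup M Γ -> NM M, Rep f & forall ρ, P ρ <-> f ρ = 0.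

Lemma dec_iff Γ (P Q : tup M Γ -> Prop) :
  (forall ρ, P ρ <-> Q ρ) -> Dec P -> Dec Q.
Proof. by move=> H [f Hf HP]; exists f => // ρ; rewrite -H. Qed.

Lemma dec_eq Γ (f g : tup M Γ -> NM M) :
  Rep f -> Rep g -> Dec (fun ρ => f ρ = g ρ).
Proof.
move=> Hf Hg; exists (fun ρ => (f ρ - g ρ) + (g ρ - f ρ)).
  by rewrite /nadd /nsub; do ![apply: rep_ap => //|apply: rep_const].
by move=> ρ; rewrite eqc_eq0.
Qed.

Lemma dec_le Γ (f g : tup M Γ -> NM M) :
  Rep f -> Rep g -> Dec (fun ρ => nle (f ρ) (g ρ)).
Proof.
move=> Hf Hg; apply: dec_eq; last exact: rep_const.
by rewrite /nsub; do ![apply: rep_ap => //|apply: rep_const].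
Qed.

Lemma dec_false Γ : Dec (fun _ : tup M Γ => False).
Proof.
by exists (fun=> 1); [exact: rep_const|split=> // /succ_neq0].
Qed.

Lemma dec_imp Γ (P Q : tup M Γ -> Prop) :
  Dec P -> Dec Q -> Dec (fun ρ => P ρ -> Q ρ).
Proof.
move=> [f Hf HP] [g Hg HQ]; exists (fun ρ => ncond (f ρ) (g ρ) 0).
  by rewrite /ncond; do ![apply: rep_ap => //|apply: rep_const].
move=> ρ; rewrite HP HQ; case: (nat_case (f ρ)) => ->.
  by rewrite ncond0; split=> [|->//]; apply.
by rewrite ncondS; split=> // _ /succ_neq0.
Qed.

Lemma dec_not Γ (P : tup M Γ -> Prop) : Dec P -> Dec (fun ρ => ~ P ρ).
Proof. by move=> HP; apply: dec_imp HP (dec_false _). Qed.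

Lemma dec_and Γ (P Q : tup M Γ -> Prop) :
  Dec P -> Dec Q -> Dec (fun ρ => P ρ /\ Q ρ).
Proof.
move=> HP HQ; apply: dec_iff (dec_not (dec_imp HP (dec_not HQ))) => ρ; tauto.
Qed.

Lemma ind (P : NM M -> Prop) : Dec (fun ρ : tup M [tN] => P (fst ρ)) ->
  P 0 -> (forall n, P n -> P (nS n)) -> forall n, P n.
Proof.
move=> [f Hf HP] H0 HS n.
have H z : Rep1 (fun _ : NM M => z) by rewrite /Rep1; rep.
have HP' x : P x <-> f (x, tt) = 0 by exact: (HP (x, tt)).
apply/HP'; apply: (@ind_eq M (fun x => f (x, tt)) (fun=> 0)) => //.
- by apply: rep_ext Hf => -[x []].
- exact/HP'.
- by move=> {}n /HP' /HS /HP'.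
Qed.
End OrderedSemiring.

(** * Rational numbers *)

Section Fractions.
Context {M : gmodel}.
Implicit Types x y z : NM M.
Add Ring NM_ring : (@NM_semiring M).

Lemma nadd_inj x y z : x + z = y + z -> x = y.
Proof. by move/(congr1 (fun u => u - z)); rewrite !nsub_addr. Qed.

Lemma nle_total x y : nle x y \/ nle y x.
Proof.
case: (nsub_lem1 x y) => [|E]; [by left|right].
by apply/nleP; exists (x - y).
Qed.

Lemma nmul_eq0 x y : x * nS y = 0 -> x = 0.
Proof. by rewrite nmulS => /nadd_eq0[]. Qed.

Lemma nmul_inj x y z : x * nS z = y * nS z -> x = y.
Proof.
wlog: x y / nle x y.
  by move=> H; case: (nle_total x y) => [|Hle /esym/(H _ _ Hle)]; [exact: H|].
move/nleP=> [c ->] E; suff -> : c = 0 by rewrite nadd0.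
apply: (@nmul_eq0 _ z); apply: (@nadd_inj _ _ (x * nS z)).
by rewrite nadd0l {2}E; ring.
Qed.

Lemma nle_mul x y z : nle (x * nS z) (y * nS z) -> nle x y.
Proof.
case: (nle_total x y) => // /nleP[c ->] H; suff -> : c = 0.
  by rewrite nadd0; apply/nleP; exists 0; rewrite nadd0.
apply: (@nmul_eq0 _ z); apply: (@nadd_inj _ _ (y * nS z)).
rewrite nadd0l -nmul_addl (naddC c); apply: nle_anti => //.
by apply/nleP; exists (c * nS z); ring.
Qed.

Lemma nle_refl x : nle x x.
Proof. by apply/nleP; exists 0; rewrite nadd0. Qed.

(** The triple [(a, b, d)] represents [(a - b) / (d + 1)]. *)
Definition frac := (NM M * NM M * NM M)%type.
Definition fnum (p : frac) := p.1.1.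
Definition fneg (p : frac) := p.1.2.
Definition fden (p : frac) := nS p.2.
Definition mkfrac x y z : frac := (x, y, npred z).

Lemma fden_mk x y z1 z2 :
  fden (mkfrac x y (nS z1 * nS z2)) = nS z1 * nS z2.
Proof. by rewrite /fden /mkfrac /= nmulS naddS npredS. Qed.

Definition frel (p q : frac) :=
  fnum p * fden q + fneg q * fden p = fnum q * fden p + fneg p * fden q.

Lemma frel_sym p q : frel p q -> frel q p.
Proof. exact: esym. Qed.

Lemma frel_trans p q r : frel p q -> frel q r -> frel p r.
Proof.
rewrite /frel => E1 E2.
apply: (@nmul_inj _ _ q.2); rewrite -/(fden q).
apply: (@nadd_inj _ _ (fneg q * fden p * fden r + fnum q * fden p * fden r)).
have -> : (fnum p * fden r + fneg r * fden p) * fden q +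
    (fneg q * fden p * fden r + fnum q * fden p * fden r) =
  (fnum p * fden q + fneg q * fden p) * fden r +
  (fnum q * fden r + fneg r * fden q) * fden p by ring.
rewrite E1 E2; ring.
Qed.

Definition fadd (p q : frac) : frac :=
  mkfrac (fnum p * fden q + fnum q * fden p)
    (fneg p * fden q + fneg q * fden p) (fden p * fden q).
Definition fopp (p : frac) : frac := (fneg p, fnum p, p.2).
Definition fmul (p q : frac) : frac :=
  mkfrac (fnum p * fnum q + fneg p * fneg q)
    (fnum p * fneg q + fneg p * fnum q) (fden p * fden q).
Definition f0 : frac := (0, 0, 0).
Definition f1 : frac := (1, 0, 0).
Definition fpos (p : frac) := nle (fneg p) (fnum p).
Definition finv (p : frac) : frac :=
  if pselect (fpos p) then mkfrac (fden p) 0 (fnum p - fneg p)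
  else mkfrac 0 (fden p) (fneg p - fnum p).

(** A quotient with Leibniz equality can carry the structure of a mathcomp ordered field, which
    makes [lra] available for rationals of the model. *)
Definition QM := {P : frac -> Prop | exists p, P = frel p}.
Definition qc (p : frac) : QM := exist _ (frel p) (ex_intro _ p erefl).
Definition qrp (q : QM) : frac := proj1_sig (cid (proj2_sig q)).

Lemma qc_eq p q : qc p = qc q <-> frel p q.
Proof.
split=> [/(congr1 (fun u => proj1_sig u q)) /= ->//|H].
apply: eq_exist => /=; apply: funext => r; apply: propext.
by split; apply: frel_trans => //; apply: frel_sym.
Qed.

Lemma qrpK q : qc (qrp q) = q.
Proof.
case: q => P HP; rewrite /qrp; case: cid => /= p E.
by apply: eq_exist => /=; rewrite E.
Qed.

Definition qadd p q := qc (fadd (qrp p) (qrp q)).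
Definition qopp p := qc (fopp (qrp p)).
Definition qmul p q := qc (fmul (qrp p) (qrp q)).
Definition qinv p := if pselect (p = qc f0) then p else qc (finv (qrp p)).

Lemma frel_qrp p : frel (qrp (qc p)) p.
Proof. by apply/qc_eq; rewrite qrpK. Qed.

Lemma fden_add p q : fden (fadd p q) = fden p * fden q.
Proof. exact: fden_mk. Qed.
Lemma fden_mul p q : fden (fmul p q) = fden p * fden q.
Proof. exact: fden_mk. Qed.
Lemma fnum_add p q : fnum (fadd p q) = fnum p * fden q + fnum q * fden p.
Proof. by []. Qed.
Lemma fneg_add p q : fneg (fadd p q) = fneg p * fden q + fneg q * fden p.
Proof. by []. Qed.
Lemma fnum_mul p q : fnum (fmul p q) = fnum p * fnum q + fneg p * fneg q.
Proof. by []. Qed.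
Lemma fneg_mul p q : fneg (fmul p q) = fnum p * fneg q + fneg p * fnum q.
Proof. by []. Qed.
Lemma f_opp p : (fnum (fopp p) = fneg p) * (fneg (fopp p) = fnum p) *
  (fden (fopp p) = fden p).
Proof. by []. Qed.
Lemma f_01 : (fnum f0 = 0) * (fneg f0 = 0) * (fden f0 = 1) * (fnum f1 = 1) *
  (fneg f1 = 0) * (fden f1 = 1).
Proof. by []. Qed.
Definition fE := (fden_add, fden_mul, fnum_add, fneg_add, fnum_mul, fneg_mul,
  f_opp, f_01).

Lemma frel_add p p' q q' : frel p p' -> frel q q' ->
  frel (fadd p q) (fadd p' q').
Proof.
rewrite /frel !fE => E1 E2.
have -> : (fnum p * fden q + fnum q * fden p) * (fden p' * fden q') +
  (fneg p' * fden q' + fneg q' * fden p') * (fden p * fden q) =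
  (fnum p * fden p' + fneg p' * fden p) * (fden q * fden q') +
  (fnum q * fden q' + fneg q' * fden q) * (fden p * fden p') by ring.
by rewrite E1 E2; ring.
Qed.

Lemma frel_opp p p' : frel p p' -> frel (fopp p) (fopp p').
Proof. by rewrite /frel !fE => E; rewrite naddC -E; ring. Qed.

Lemma frel_mul1 p p' q : frel p p' -> frel (fmul p q) (fmul p' q).
Proof.
rewrite /frel !fE => E.
have -> : (fnum p * fnum q + fneg p * fneg q) * (fden p' * fden q) +
  (fnum p' * fneg q + fneg p' * fnum q) * (fden p * fden q) =
  (fnum p * fden p' + fneg p' * fden p) * (fnum q * fden q) +
  (fnum p' * fden p + fneg p * fden p') * (fneg q * fden q) by ring.
by rewrite {1}E -{2}E; ring.
Qed.

Lemma fmulC p q : fmul p q = fmul q p.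
Proof. by rewrite /fmul; congr mkfrac; ring. Qed.

Lemma frel_mul p p' q q' : frel p p' -> frel q q' ->
  frel (fmul p q) (fmul p' q').
Proof.
move=> E1 E2; apply: (@frel_trans _ (fmul p' q)); first exact: frel_mul1.
by rewrite !(fmulC p'); apply: frel_mul1.
Qed.

Lemma qaddE p q : qadd (qc p) (qc q) = qc (fadd p q).
Proof. by apply/qc_eq/frel_add; apply: frel_qrp. Qed.
Lemma qoppE p : qopp (qc p) = qc (fopp p).
Proof. by apply/qc_eq/frel_opp; apply: frel_qrp. Qed.
Lemma qmulE p q : qmul (qc p) (qc q) = qc (fmul p q).
Proof. by apply/qc_eq/frel_mul; apply: frel_qrp. Qed.

Lemma fpos_rel p q : frel p q -> fpos p -> fpos q.
Proof.
rewrite /frel /fpos => E /nleP[c Ea].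
apply: (@nle_mul _ _ p.2); rewrite -/(fden p); apply/nleP.
exists (c * fden q); apply: (@nadd_inj _ _ (fneg p * fden q)).
by rewrite -E Ea; ring.
Qed.

Definition qpos p : bool := `[< fpos (qrp p) >].
(* Sealed, because unification tends to unfold the order. *)
Fact qle_key :
  {r : QM -> QM -> bool | forall p q, r p q = qpos (qadd q (qopp p))}.
Proof. by exists (fun p q => qpos (qadd q (qopp p))). Qed.
Definition qle := proj1_sig qle_key.
Lemma qleE p q : qle p q = qpos (qadd q (qopp p)).
Proof. exact: (proj2_sig qle_key). Qed.

Lemma qposP p : reflect (fpos p) (qpos (qc p)).
Proof.
apply: (iffP (asboolP _)); apply: fpos_rel; first exact: frel_qrp.
exact/frel_sym/frel_qrp.
Qed.

Lemma qcP q : exists p, q = qc p.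
Proof. by exists (qrp q); rewrite qrpK. Qed.

Ltac qcs := repeat match goal with
  | |- forall _ : QM, _ => let p := fresh "p" in move=> p; have [{}p ->] := qcP p
  end.
Ltac qring := qcs; rewrite ?(qaddE, qmulE, qoppE); apply/qc_eq;
  rewrite /frel !fE; ring.

Lemma qaddA : associative qadd.
Proof. rewrite /associative; qring. Qed.
Lemma qaddC : commutative qadd.
Proof. rewrite /commutative; qring. Qed.
Lemma qadd0 : left_id (qc f0) qadd.
Proof. rewrite /left_id; qring. Qed.
Lemma qaddN : left_inverse (qc f0) qopp qadd.
Proof. rewrite /left_inverse; qring. Qed.
Lemma qmulA : associative qmul.
Proof. rewrite /associative; qring. Qed.
Lemma qmulC : commutative qmul.
Proof. rewrite /commutative; qring. Qed.
Lemma qmul1 : left_id (qc f1) qmul.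
Proof. rewrite /left_id; qring. Qed.
Lemma qmulD : left_distributive qmul qadd.
Proof. rewrite /left_distributive; qring. Qed.

Lemma q1_neq0 : qc f1 <> qc f0.
Proof.
move/qc_eq; rewrite /frel !fE.
have -> : 1 * 1 + 0 * 1 = 1 :> NM M by ring.
by have -> : 0 * 1 + 0 * 1 = 0 :> NM M; [ring|move/succ_neq0].
Qed.

Lemma fden_nz x y z : z <> 0 -> fden (mkfrac x y z) = z.
Proof. by rewrite /fden /=; case: (nat_case z) => ->//; rewrite npredS. Qed.

Lemma qmulV p : p <> qc f0 -> qmul (qinv p) p = qc f1.
Proof.
move=> Hp; rewrite /qinv; case: pselect => [//|Hq] /=; clear Hq; move: Hp.
rewrite -{1 3}(qrpK p) qmulE => Hp; apply/qc_eq; move: (qrp p) Hp => {}p Hp.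
have {}Hp : fnum p <> fneg p.
  by move=> E; apply/Hp/qc_eq; rewrite /frel !fE E; ring.
rewrite /finv; case: pselect => [Hp1|Hn].
  case: (proj1 (nleP _ _) Hp1) => c E.
  have E' : fnum p - fneg p = c by rewrite E naddC nsub_addr.
  have Hc : c <> 0 by move=> E0; apply: Hp; rewrite E E0 nadd0.
  by rewrite /frel !fE E' fden_nz // /fnum /fneg /= -/(fnum p) -/(fneg p) E; ring.
have Hle : nle (fnum p) (fneg p) by case: (nle_total (fneg p) (fnum p)).
case: (proj1 (nleP _ _) Hle) => c E.
have E' : fneg p - fnum p = c by rewrite E naddC nsub_addr.
have Hc : c <> 0 by move=> E0; apply: Hp; rewrite E E0 nadd0.
by rewrite /frel !fE E' fden_nz // /fnum /fneg /= -/(fnum p) -/(fneg p) E; ring.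
Qed.

Lemma qinv0 : qinv (qc f0) = qc f0.
Proof. by rewrite /qinv; case: pselect. Qed.

Definition qnorm p := if qpos p then p else qopp p.
Fact qlt_key :
  {r : QM -> QM -> bool | forall p q, r p q = asbool (q <> p) && qle p q}.
Proof. by exists (fun p q => asbool (q <> p) && qle p q). Qed.
Definition qlt := proj1_sig qlt_key.
Lemma qltE p q : qlt p q = asbool (q <> p) && qle p q.
Proof. exact: (proj2_sig qlt_key). Qed.
End Fractions.
Arguments QM : clear implicits.

HB.instance Definition _ M := gen_eqMixin (QM M).
HB.instance Definition _ M := gen_choiceMixin (QM M).
HB.instance Definition _ M := GRing.isZmodule.Build (QM M)
  (@qaddA M) (@qaddC M) (@qadd0 M) (@qaddN M).

Section FieldInstance.
Context {M : gmodel}.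
Implicit Types p q : QM M.
Add Ring NM_ring : (@NM_semiring M).

Lemma q1_neq0b : qc f1 != 0%R :> QM M.
Proof. by apply/eqP; apply: q1_neq0. Qed.
HB.instance Definition _ := GRing.Zmodule_isComNzRing.Build (QM M)
  (@qmulA M) (@qmulC M) (@qmul1 M) (@qmulD M) q1_neq0b.

Lemma qmulVb p : p != 0%R -> (qinv p * p = 1)%R.
Proof. by move/eqP; apply: qmulV. Qed.
HB.instance Definition _ := GRing.ComNzRing_isField.Build (QM M)
  qmulVb (@qinv0 M).

Lemma qle0E p : qle 0%R p = qpos p.
Proof. by rewrite qleE -[qadd p _]/(p - 0)%R GRing.subr0. Qed.

Lemma qle0_add p q : qle 0%R p -> qle 0%R q -> qle 0%R (p + q)%R.
Proof.
rewrite !qle0E; have [{}p ->] := qcP p; have [{}q ->] := qcP q.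
rewrite -[(qc p + qc q)%R]/(qadd (qc p) (qc q)) qaddE.
move=> /qposP /nleP[c E] /qposP /nleP[d E']; apply/qposP/nleP.
by exists (c * fden q + d * fden p); rewrite !fE E E'; ring.
Qed.

Lemma qle0_mul p q : qle 0%R p -> qle 0%R q -> qle 0%R (p * q)%R.
Proof.
rewrite !qle0E; have [{}p ->] := qcP p; have [{}q ->] := qcP q.
rewrite -[(qc p * qc q)%R]/(qmul (qc p) (qc q)) qmulE.
move=> /qposP /nleP[c E] /qposP /nleP[d E']; apply/qposP/nleP.
by exists (c * d); rewrite !fE E E'; ring.
Qed.

Lemma qle_p0 p : qle p 0%R = qpos (- p)%R.
Proof. by rewrite qleE -[qadd _ _]/(0 - p)%R GRing.sub0r. Qed.

Lemma qle0_anti p : qle 0%R p -> qle p 0%R -> p = 0%R.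
Proof.
rewrite qle0E qle_p0; have [{}p ->] := qcP p.
rewrite -[(- qc p)%R]/(qopp (qc p)) qoppE.
move=> /qposP H /qposP H'; apply/qc_eq; rewrite /frel !fE.
by rewrite (nle_anti H H'); ring.
Qed.

Lemma qsub_ge0 p q : qle 0%R (q - p)%R = qle p q.
Proof. by rewrite qle0E qleE. Qed.

Lemma qle0_total p : qle 0%R p || qle p 0%R.
Proof.
rewrite qle0E qle_p0; have [{}p ->] := qcP p.
rewrite -[(- qc p)%R]/(qopp (qc p)) qoppE.
apply/orP; case: (nle_total (fneg p) (fnum p)) => H; [left|right]; exact/qposP.
Qed.

Lemma qnormN p : qnorm (- p)%R = qnorm p.
Proof.
rewrite /qnorm -[qopp p]/(- p)%R -[qopp _]/(- - p)%R GRing.opprK.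
rewrite -(qle0E p) -(qle_p0 p).
case E: (qle 0%R p); case E': (qle p 0%R) => //.
  by rewrite (qle0_anti E E') GRing.oppr0.
by have := qle0_total p; rewrite E E'.
Qed.

Lemma qge0_norm p : qle 0%R p -> qnorm p = p.
Proof. by rewrite qle0E /qnorm => ->. Qed.

Lemma qlt_def p q : qlt p q = (q != p) && qle p q.
Proof.
by rewrite qltE; congr andb; apply/asboolP/idP => [H|/eqP//]; apply/eqP.
Qed.

HB.instance Definition _ := Num.IntegralDomain_isLeReal.Build (QM M)
  qle0_add qle0_mul qle0_anti qsub_ge0 qle0_total qnormN qge0_norm qlt_def.
End FieldInstance.

Open Scope ring_scope.

(** * The numbers of the model among its rationals *)

Section NaturalsInRationals.
Context {M : gmodel}.
Implicit Types x y z n : NM M.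

Definition nq x : QM M := qc (x, szero, szero).

Lemma nq0 : nq 0%nm = 0.
Proof. by []. Qed.

Add Ring NM_ring : (@NM_semiring M).

Lemma nqD x y : nq (x + y)%nm = nq x + nq y.
Proof.
rewrite -[nq x + nq y]/(qadd (nq x) (nq y)) /nq qaddE; apply/qc_eq.
by rewrite /frel !fE /fnum /fneg /fden /=; ring.
Qed.

Lemma nqM x y : nq (x * y)%nm = nq x * nq y.
Proof.
rewrite -[nq x * nq y]/(qmul (nq x) (nq y)) /nq qmulE; apply/qc_eq.
by rewrite /frel !fE /fnum /fneg /fden /=; ring.
Qed.

Lemma nq1 : nq 1%nm = 1.
Proof. by []. Qed.

Lemma nqS x : nq (nS x) = nq x + 1.
Proof. by rewrite nS_add nqD. Qed.

Lemma qc_le (p q : frac) : ((qc p : QM M) <= qc q) =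
  `[< nle (fnum p * fden q + fneg q * fden p)%nm
          (fnum q * fden p + fneg p * fden q)%nm >].
Proof.
rewrite -[_ <= _]/(qle _ _) qleE qoppE qaddE.
apply/qposP/asboolP; rewrite /fpos !fE => /nleP[c E]; apply/nleP; exists c;
  by rewrite E; ring.
Qed.

Lemma nq_le x y : nle x y <-> nq x <= nq y.
Proof.
rewrite /nq qc_le; rewrite /fnum /fneg /fden /=.
have -> : (x * 1 + 0 * 1 = x)%nm by ring.
have -> : (y * 1 + 0 * 1 = y)%nm by ring.
by split=> [H|/asboolP//]; apply/asboolP.
Qed.

Lemma nq_inj x y : nq x = nq y -> x = y.
Proof. by move=> E; apply: nle_anti; apply/nq_le; rewrite E. Qed.

Lemma nq_ge0 x : 0 <= nq x.
Proof. by rewrite -nq0; apply/nq_le/nleP; exists x; ring. Qed.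

Lemma nle0 x : nle 0%nm x.
Proof. by apply/nq_le; rewrite nq0 nq_ge0. Qed.

Lemma nltNge x y : nlt x y <-> ~ nle y x.
Proof.
split=> [/nq_le H /nq_le H'|H]; first by move: H; rewrite nqS => H; lra.
case: (nsub_lem1 y x) => // E; rewrite -E /nlt; apply/nq_le.
rewrite nqD nqS; have [E0|->] := nat_case (y - x)%nm; first by case: H.
by rewrite nqS; have := nq_ge0 (npred (y - x)%nm); lra.
Qed.

Lemma nq_lt x y : nlt x y <-> nq x < nq y.
Proof. by rewrite nltNge nq_le ltNge; split=> /negP. Qed.

Lemma nqB x y : nle y x -> nq (x - y)%nm = nq x - nq y.
Proof. by move=> /nsub_lem2 {2}<-; rewrite nqD; lra. Qed.

Lemma nle_sub x y : nle (x - y)%nm x.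
Proof.
case: (nsub_lem1 x y) => [->|{2}<-]; apply/nq_le; first exact: nq_ge0.
by rewrite nqD; have := nq_ge0 y; lra.
Qed.

Lemma nltS x y : nlt x (nS y) <-> nle x y.
Proof. by rewrite /nlt !nq_le !nqS; split; lra. Qed.

Lemma nlt0 x : ~ nlt x 0%nm.
Proof. by rewrite nq_lt nq0; have := nq_ge0 x; lra. Qed.

Lemma nlt_eqVlt x y : nlt x (nS y) <-> nlt x y \/ x = y.
Proof.
rewrite nltS; split=> [H|[|->]]; last exact: nle_refl.
  case: (nle_total y x) => [/(nle_anti H)|]; first by right.
  case: (pselect (nle y x)) => [/(nle_anti H)|/nltNge]; by auto.
by move/nq_lt/ltW/nq_le.
Qed.

Lemma nq_pos x : nlt 0%nm x <-> 0 < nq x.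
Proof. exact: nq_lt. Qed.

Lemma nq_predS x : nlt 0%nm x -> nS (npred x) = x.
Proof. by case: (nat_case x) => [->/nlt0//|->]; rewrite npredS. Qed.
End NaturalsInRationals.

(** * Powers of two, pairing and the values of terms *)

Section NatOperations.
Context {M : gmodel}.
Implicit Types x y z n : NM M.

Definition expC : M one :=
  fn (fun n => sR $ fn (fun _ => fn (fun r => nadd r r)) $ nS szero $ n).
Definition nexp n := expC $ n.
Definition triC : M one :=
  fn (fun n => sR $ fn (fun i => fn (fun r => nadd r (nS i))) $ szero $ n).
Definition ntri n := triC $ n.
Definition npair x y := nadd (ntri (nadd x y)) x.
Definition diagC : M one :=
  fn (fun n => sR $ fn (fun i => fn (fun r =>
    ncond (nsub (ntri (nS r)) (nS i)) (nS r) r)) $ szero $ n).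
Definition ndiag n := diagC $ n.
Definition nfst z := nsub z (ntri (ndiag z)).
Definition nsnd z := nsub (ndiag z) (nfst z).
Definition nmkQ x y z := npair (npair x y) z.
End NatOperations.

Ltac rep ::= intros; rewrite /nmkQ /nsnd /nfst /npair /nexp /ntri /ndiag /nS
  /nadd /npred /ncond /nmul /nsub; rep_core.

Ltac dec :=
  cbv beta;
  lazymatch goal with
  | |- Dec (fun ρ => @?P ρ /\ @?Q ρ) => apply (@dec_and _ _ P Q); dec
  | |- Dec (fun ρ => nle (@?f ρ) (@?g ρ)) => apply (@dec_le _ _ f g); rep
  | |- Dec (fun ρ => nlt (@?f ρ) (@?g ρ)) =>
      apply (@dec_le _ _ (fun ρ => nS (f ρ)) g); rep
  | |- Dec (fun ρ => @eq (dom _ tN) (@?f ρ) (@?g ρ)) =>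
      apply (@dec_eq _ _ f g); rep
  end.

Section NatOperationsTheory.
Context {M : gmodel}.
Implicit Types x y z n : NM M.

Lemma nexp0 : nexp 0%nm = 1%nm :> NM M.
Proof. by rewrite /nexp /expC; fnrw; rewrite sR0. Qed.
Lemma nexpS n : nexp (nS n) = (nexp n + nexp n)%nm.
Proof. by rewrite /nexp /expC; fnrw; rewrite sRS; fnrw. Qed.
Lemma ntri0 : ntri 0%nm = 0%nm :> NM M.
Proof. by rewrite /ntri /triC; fnrw; rewrite sR0. Qed.
Lemma ntriS n : ntri (nS n) = (ntri n + nS n)%nm.
Proof. by rewrite /ntri /triC; fnrw; rewrite sRS; fnrw. Qed.
Lemma ndiag0 : ndiag 0%nm = 0%nm :> NM M.
Proof. by rewrite /ndiag /diagC; fnrw; rewrite sR0. Qed.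
Lemma ndiagS n : ndiag (nS n) =
  ncond (ntri (nS (ndiag n)) - nS n)%nm (nS (ndiag n)) (ndiag n).
Proof. by rewrite /ndiag /diagC; fnrw; rewrite sRS; fnrw. Qed.

Lemma teval_lam Γ (ρ : env M Γ) σ τ (t : tm (σ :: Γ) τ) (x : M σ) :
  teval ρ (lam t) $ x = teval (econs x ρ) t.
Proof.
elim: t => [υ v| | |a b|a b c| |a b f IHf u IHu] /=; rewrite ?sKE //;
  last by rewrite sSE IHf IHu.
move: υ v; match goal with |- forall υ v, @?P υ v => apply: (@var_case _ _ P) end.
  by rewrite /= sSE sKE.
by move=> υ v; rewrite /= sKE.
Qed.

Lemma teval_Lam Γ (ρ : env M Γ) σ τ (f : tm (σ :: Γ) σ -> tm (σ :: Γ) τ)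
  (x : M σ) :
  teval ρ (Lam σ f) $ x = teval (econs x ρ) (f (tvar v0)).
Proof. exact: teval_lam. Qed.

Lemma teval_rec Γ (ρ : env M Γ) (f : tm Γ (tN ⇒ tN ⇒ tN)) (s t : tm Γ tN) :
  teval ρ (tR · f · s · t)%tm = sR $ teval ρ f $ teval ρ s $ teval ρ t.
Proof. by []. Qed.

Lemma teval_S Γ (ρ : env M Γ) t : teval ρ (S1 t) = nS (teval ρ t).
Proof. by []. Qed.

Lemma teval_addN Γ (ρ : env M Γ) s t :
  teval ρ (addN s t) = nadd (teval ρ s) (teval ρ t).
Proof.
rewrite /nadd /addC /addN; fnrw; rewrite teval_rec; congr (_ $ _ $ _ $ _).
by apply: sap_ext => y; fnrw; rewrite teval_Lam.
Qed.

Lemma teval_predN Γ (ρ : env M Γ) t : teval ρ (predN t) = npred (teval ρ t).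
Proof. by rewrite /npred /predC; fnrw. Qed.

Lemma teval_cond0 Γ (ρ : env M Γ) c s t :
  teval ρ (cond0 c s t) = ncond (teval ρ c) (teval ρ s) (teval ρ t).
Proof.
rewrite /ncond /condC /cond0; fnrw; rewrite teval_rec; congr (_ $ _ $ _ $ _).
apply: sap_ext => y; fnrw; rewrite teval_Lam; apply: sap_ext => z; fnrw.
by rewrite teval_Lam /= teval_lift.
Qed.

Lemma teval_mulN Γ (ρ : env M Γ) s t :
  teval ρ (mulN s t) = nmul (teval ρ s) (teval ρ t).
Proof.
rewrite /nmul /mulC /mulN; fnrw; rewrite teval_rec; congr (_ $ _ $ _ $ _).
apply: sap_ext => y; fnrw; rewrite teval_Lam; apply: sap_ext => z; fnrw.
by rewrite teval_Lam teval_addN !teval_lift.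
Qed.

Lemma teval_subN Γ (ρ : env M Γ) s t :
  teval ρ (subN s t) = nsub (teval ρ s) (teval ρ t).
Proof.
rewrite /nsub /subC /subN; fnrw; rewrite teval_rec; congr (_ $ _ $ _ $ _).
apply: sap_ext => y; fnrw; rewrite teval_Lam; apply: sap_ext => z; fnrw.
by rewrite teval_Lam teval_predN !teval_lift.
Qed.

Lemma teval_expN2 Γ (ρ : env M Γ) t : teval ρ (expN2 t) = nexp (teval ρ t).
Proof.
rewrite /nexp /expC /expN2; fnrw; rewrite teval_rec; congr (_ $ _ $ _ $ _).
apply: sap_ext => y; fnrw; rewrite teval_Lam; apply: sap_ext => z; fnrw.
by rewrite teval_Lam teval_addN !teval_lift.
Qed.

Lemma teval_triN Γ (ρ : env M Γ) t : teval ρ (triN t) = ntri (teval ρ t).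
Proof.
rewrite /ntri /triC /triN; fnrw; rewrite teval_rec; congr (_ $ _ $ _ $ _).
apply: sap_ext => y; fnrw; rewrite teval_Lam; apply: sap_ext => z; fnrw.
by rewrite teval_Lam teval_addN teval_S !teval_lift.
Qed.

Lemma teval_pairN Γ (ρ : env M Γ) s t :
  teval ρ (pairN s t) = npair (teval ρ s) (teval ρ t).
Proof. by rewrite /pairN teval_addN teval_triN teval_addN. Qed.

Lemma teval_diagN Γ (ρ : env M Γ) t : teval ρ (diagN t) = ndiag (teval ρ t).
Proof.
rewrite /ndiag /diagC /diagN; fnrw; rewrite teval_rec; congr (_ $ _ $ _ $ _).
apply: sap_ext => y; fnrw; rewrite teval_Lam; apply: sap_ext => z; fnrw.
by rewrite teval_Lam teval_cond0 teval_subN teval_triN !teval_S !teval_lift.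
Qed.

Lemma teval_fstN Γ (ρ : env M Γ) t : teval ρ (fstN t) = nfst (teval ρ t).
Proof. by rewrite /fstN teval_subN teval_triN teval_diagN. Qed.

Lemma teval_sndN Γ (ρ : env M Γ) t : teval ρ (sndN t) = nsnd (teval ρ t).
Proof. by rewrite /sndN teval_subN teval_diagN teval_fstN. Qed.

Lemma sat_leN Γ (ρ : env M Γ) s t :
  sat (leN s t) ρ <-> nle (teval ρ s) (teval ρ t).
Proof.
rewrite /leN -[sat _ _]/(sE (teval ρ (subN s t)) szero) (good_E (gmP M)).
by rewrite teval_subN.
Qed.

Lemma sat_ltN Γ (ρ : env M Γ) s t :
  sat (ltN s t) ρ <-> nlt (teval ρ s) (teval ρ t).
Proof. exact: sat_leN. Qed.

Lemma ntri_le x y : nle x y -> nle (ntri x) (ntri y).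
Proof.
move=> /nleP[c ->]; move: c; apply: ind; first by dec.
- by rewrite nadd0; apply: nle_refl.
- move=> c /nq_le IH; rewrite naddS ntriS; apply/nq_le; rewrite nqD.
  by have := nq_ge0 (nS (nadd x c)); lra.
Qed.

Lemma ntri_ge x : nle x (ntri x).
Proof.
move: x; apply: ind; first by dec.
- by rewrite ntri0; apply: nle_refl.
- move=> x _; rewrite ntriS; apply/nq_le; rewrite nqD.
  by have := nq_ge0 (ntri x); lra.
Qed.

Lemma ndiag_spec z : nle (ntri (ndiag z)) z /\ nlt z (ntri (nS (ndiag z))).
Proof.
move: z; apply: ind; first by dec.
  rewrite ndiag0 ntri0; split; first exact: nle_refl.
  by rewrite ntriS ntri0 nadd0l; apply: nle_refl.
move=> z [/nq_le H1 /nq_lt H2]; rewrite ndiagS.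
case: (nat_case (ntri (nS (ndiag z)) - nS z)%nm) => E; rewrite E ?ncond0 ?ncondS.
  split=> //; apply/nq_lt; rewrite ntriS nqD !nqS.
  by move: H2; have := nq_ge0 (ndiag z); rewrite ntriS nqD nqS; lra.
have H : nlt (nS z) (ntri (nS (ndiag z))).
  by apply/nltNge => H; rewrite H in E; apply: (succ_neq0 (esym E)).
by split=> //; apply/nq_le; rewrite nqS; lra.
Qed.

Lemma ndiag_uniq z d : nle (ntri d) z -> nlt z (ntri (nS d)) -> ndiag z = d.
Proof.
move=> /nq_le H1 /nq_lt H2; have [/nq_le H3 /nq_lt H4] := ndiag_spec z.
apply: NNPP => Hn; have [H|H] := nle_total (ndiag z) d.
  have /ntri_le/nq_le : nle (nS (ndiag z)) d.
    by apply/nltNge => H'; apply/Hn/nle_anti.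
  by lra.
have /ntri_le/nq_le : nle (nS d) (ndiag z).
  by apply/nltNge => H'; apply/Hn/nle_anti.
by lra.
Qed.

Lemma ndiag_pair x y : ndiag (npair x y) = nadd x y.
Proof.
apply: ndiag_uniq; first by apply/nq_le; rewrite nqD; have := nq_ge0 x; lra.
apply/nq_lt; rewrite ntriS /npair !nqD nqS nqD.
by have := nq_ge0 y; lra.
Qed.

Lemma nfst_pair x y : nfst (npair x y) = x.
Proof. by rewrite /nfst ndiag_pair /npair naddC nsub_addr. Qed.

Lemma nsnd_pair x y : nsnd (npair x y) = y.
Proof. by rewrite /nsnd nfst_pair ndiag_pair naddC nsub_addr. Qed.

Lemma nfst_le z : nle (nfst z) z.
Proof. exact: nle_sub. Qed.

Lemma nle_trans y x z : nle x y -> nle y z -> nle x z.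
Proof. by rewrite !nq_le; apply: le_trans. Qed.

Lemma nsnd_le z : nle (nsnd z) z.
Proof.
apply: nle_trans (nle_sub _ _) _; apply: nle_trans (ntri_ge _) _.
by have [] := ndiag_spec z.
Qed.
End NatOperationsTheory.

Lemma invr_double (R : realFieldType) (x : R) : (x + x)^-1 = x^-1 / 2.
Proof. by have -> : x + x = x * 2 by [lra]; rewrite invfM. Qed.

Section RationalCodes.
Context {M : gmodel}.
Implicit Types x y z n : NM M.
Add Ring NM_ring : (@NM_semiring M).

Definition cfrac z : @frac M := (nfst (nfst z), nsnd (nfst z), nsnd z).
Definition qv z : QM M := qc (cfrac z).

Lemma cfrac_mk x y z : cfrac (nmkQ x y z) = (x, y, z).
Proof. by rewrite /cfrac /nmkQ !(nfst_pair, nsnd_pair). Qed.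

Lemma fden_gt0 (p : @frac M) : 0 < nq (fden p).
Proof. by rewrite /fden nqS; have := nq_ge0 p.2; lra. Qed.

Lemma qcE (p : @frac M) : qc p = (nq (fnum p) - nq (fneg p)) / nq (fden p).
Proof.
have H := lt0r_neq0 (fden_gt0 p); apply: (mulIf H); rewrite divfK //.
rewrite -[qc p * _]/(qmul _ _) -[nq (fnum p) - _]/(qadd _ (qopp _)) /nq.
rewrite qmulE qoppE qaddE; apply/qc_eq; rewrite /frel !fE.
have E x : (fnum (x, szero, szero) = x) * (fneg (x, szero, szero) = szero) *
  (fden (x, szero, szero) = nS (szero : NM M)) by [].
by rewrite !E; ring.
Qed.

Lemma qv_mk x y z : qv (nmkQ x y z) = (nq x - nq y) / (nq z + 1).
Proof. by rewrite /qv cfrac_mk qcE -nqS. Qed.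

Lemma qv_surj (q : QM M) : exists z, qv z = q.
Proof.
by have [[[x y] z] ->] := qcP q; exists (nmkQ x y z); rewrite /qv cfrac_mk.
Qed.

Definition addp x y := let p := fadd (cfrac x) (cfrac y) in nmkQ p.1.1 p.1.2 p.2.
Definition mulp x y := let p := fmul (cfrac x) (cfrac y) in nmkQ p.1.1 p.1.2 p.2.
Definition oppp x := nmkQ (fneg (cfrac x)) (fnum (cfrac x)) (nsnd x).
Definition invp x :=
  ncond x (nmkQ szero szero szero) (nmkQ (nS szero) szero (npred x)).

(** As elements of the model, the operations on codes enter expressions through application, which
    [rep_core] handles without unfolding them. *)
Definition caddC : M (tN ⇒ tN ⇒ tN) := fn (fun x => fn (fun y => addp x y)).
Definition cmulC : M (tN ⇒ tN ⇒ tN) := fn (fun x => fn (fun y => mulp x y)).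
Definition coppC : M one := fn (fun x => oppp x).
Definition cinvC : M one := fn (fun x => invp x).
Definition cadd x y := caddC $ x $ y.
Definition cmul x y := cmulC $ x $ y.
Definition copp x := coppC $ x.
Definition cinv x := cinvC $ x.

Ltac comb := rewrite /addp /mulp /oppp /invp /fadd /fmul /mkfrac /fnum /fneg
  /fden /cfrac; cbn [fst snd]; rep.

Lemma caddE x y : cadd x y = addp x y.
Proof.
rewrite /cadd /caddC fnE; last by comb.
by rewrite fnE //; comb.
Qed.
Lemma cmulE x y : cmul x y = mulp x y.
Proof.
rewrite /cmul /cmulC fnE; last by comb.
by rewrite fnE //; comb.
Qed.
Lemma coppE x : copp x = oppp x.
Proof. by rewrite /copp /coppC fnE //; comb. Qed.
Lemma cinvE x : cinv x = invp x.
Proof. by rewrite /cinv /cinvC fnE //; comb. Qed.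

Lemma qv_add x y : qv (cadd x y) = qv x + qv y.
Proof.
rewrite caddE -[RHS]/(qadd (qv x) (qv y)) /qv qaddE cfrac_mk.
by congr qc; apply: injective_projections => //; apply: injective_projections.
Qed.

Lemma qv_mul x y : qv (cmul x y) = qv x * qv y.
Proof.
rewrite cmulE -[RHS]/(qmul (qv x) (qv y)) /qv qmulE cfrac_mk.
by congr qc; apply: injective_projections => //; apply: injective_projections.
Qed.

Lemma qv_opp x : qv (copp x) = - qv x.
Proof. by rewrite coppE -[RHS]/(qopp (qv x)) /qv qoppE cfrac_mk. Qed.

Lemma qv_inv x : qv (cinv x) = (nq x)^-1.
Proof.
rewrite cinvE /invp; case: (nat_case x) => ->.
  by rewrite ncond0 qv_mk nq0 subrr mul0r invr0.
by rewrite ncondS qv_mk npredS !nqS nq0 subr0 add0r mul1r.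
Qed.

Lemma qv_le x y : (qv x <= qv y) <->
  nle (fnum (cfrac x) * fden (cfrac y) + fneg (cfrac y) * fden (cfrac x))%nm
      (fnum (cfrac y) * fden (cfrac x) + fneg (cfrac x) * fden (cfrac y))%nm.
Proof. by rewrite /qv qc_le; split=> /asboolP. Qed.

Definition pw n : QM M := (nq (nexp n))^-1.

Lemma nexp_gt0 n : 0 < nq (nexp n).
Proof.
apply/nq_pos; move: n; apply: ind; first by dec.
  by rewrite nexp0; apply: nle_refl.
move=> n /nq_lt; rewrite nq0 => H; rewrite nexpS; apply/nq_lt.
by rewrite nqD nq0; lra.
Qed.

Lemma pw0 : pw 0%nm = 1.
Proof. by rewrite /pw nexp0 nq1 invr1. Qed.

Lemma pwS n : pw (nS n) = pw n / 2.
Proof.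
by rewrite /pw nexpS nqD invr_double.
Qed.

Lemma pw_gt0 n : 0 < pw n.
Proof. by rewrite invr_gt0 nexp_gt0. Qed.

Lemma nexp_gt n : nq n < nq (nexp n).
Proof.
apply/nq_lt; move: n; apply: ind; first by dec.
  by rewrite nexp0; apply: nle_refl.
move=> n /nq_lt H; rewrite nexpS; apply/nq_lt; rewrite nqD nqS.
have : nle 1%nm (nexp n) by apply/nq_pos/nexp_gt0.
by move/nq_le; rewrite nq1; lra.
Qed.

(** The bound is a number of the model and may be nonstandard; the field need not be Archimedean in
    the usual sense. The numerator plus one is large enough because denominators are at least 1. *)
Lemma archi (q : QM M) : exists n, q < nq n.
Proof.
have [p ->] := qcP q; exists (nS (fnum p)); rewrite qcE nqS.
rewrite ltr_pdivrMr ?fden_gt0 //.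
have H1 := nq_ge0 (fnum p); have H2 := nq_ge0 (fneg p).
have H3 : 1 <= nq (fden p) by rewrite /fden nqS; have := nq_ge0 p.2; lra.
by nra.
Qed.

Lemma pw_small (q : QM M) : 0 < q -> exists n, pw n < q.
Proof.
move=> Hq; have [n Hn] := archi q^-1; exists n.
rewrite -[q]invrK /pw ltf_pV2 ?posrE ?invr_gt0 ?nexp_gt0 //.
exact: lt_trans Hn (nexp_gt n).
Qed.

Lemma pw_le m n : nle m n -> pw n <= pw m.
Proof.
move=> /nleP[c ->]; suff H : nle (nexp m) (nexp (nadd m c)).
  by rewrite /pw lef_pV2 ?posrE ?nexp_gt0 //; apply/nq_le.
move: c; apply: ind; first by dec.
  by rewrite nadd0; apply: nle_refl.
move=> c /nq_le IH; rewrite naddS nexpS; apply/nq_le; rewrite nqD.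
by have := nexp_gt0 (nadd m c); lra.
Qed.

(** * Functions with representable rational codes *)

Definition RQ Γ (h : tup M Γ -> QM M) :=
  exists2 f : tup M Γ -> NM M, Rep f & forall ρ, qv (f ρ) = h ρ.

Lemma rq_qv Γ (f : tup M Γ -> NM M) : Rep f -> RQ (fun ρ => qv (f ρ)).
Proof. by exists f. Qed.

Lemma rq_const Γ (q : QM M) : RQ (fun _ : tup M Γ => q).
Proof. by have [z <-] := qv_surj q; apply: rq_qv; apply: rep_const. Qed.
End RationalCodes.

#[global] Opaque caddC cmulC coppC cinvC.

Section RationalFunctions.
Context {M : gmodel}.

Ltac comb := rewrite /cadd /cmul /copp /cinv /fnum /fneg /fden /cfrac;
  cbn [fst snd]; rep.

Lemma rep_op1 Γ (c : NM M -> NM M) (f : tup M Γ -> NM M) :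
  Rep (fun ρ : tup M (tN :: nil)%list => c ρ.1) ->
  Rep f -> Rep (fun ρ => c (f ρ)).
Proof.
move=> [C HC] Hf; apply: rep_ext (rep_ap (rep_const Γ (C : M (tN ⇒ tN))) Hf) => ρ.
exact: (HC (f ρ, tt)).
Qed.

Lemma rep_op2 Γ (c : NM M -> NM M -> NM M) (f g : tup M Γ -> NM M) :
  Rep (fun ρ : tup M (tN :: tN :: nil)%list => c ρ.2.1 ρ.1) ->
  Rep f -> Rep g -> Rep (fun ρ => c (f ρ) (g ρ)).
Proof.
move=> [C HC] Hf Hg.
apply: rep_ext (rep_ap (rep_ap (rep_const Γ (C : M (tN ⇒ tN ⇒ tN))) Hf) Hg) => ρ.
exact: (HC (g ρ, (f ρ, tt))).
Qed.

Lemma rq_add Γ (f g : tup M Γ -> QM M) :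
  RQ f -> RQ g -> RQ (fun ρ => f ρ + g ρ).
Proof.
move=> [a Ha Ea] [b Hb Eb]; exists (fun ρ => cadd (a ρ) (b ρ)).
  by apply: rep_op2 => //; comb.
by move=> ρ; rewrite qv_add Ea Eb.
Qed.

Lemma rq_mul Γ (f g : tup M Γ -> QM M) :
  RQ f -> RQ g -> RQ (fun ρ => f ρ * g ρ).
Proof.
move=> [a Ha Ea] [b Hb Eb]; exists (fun ρ => cmul (a ρ) (b ρ)).
  by apply: rep_op2 => //; comb.
by move=> ρ; rewrite qv_mul Ea Eb.
Qed.

Lemma rq_opp Γ (f : tup M Γ -> QM M) : RQ f -> RQ (fun ρ => - f ρ).
Proof.
move=> [a Ha Ea]; exists (fun ρ => copp (a ρ)).
  by apply: rep_op1 => //; comb.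
by move=> ρ; rewrite qv_opp Ea.
Qed.

Lemma rq_nq Γ (f : tup M Γ -> NM M) : Rep f -> RQ (fun ρ => nq (f ρ)).
Proof.
move=> Hf; exists (fun ρ => nmkQ (f ρ) szero szero).
  by apply: (rep_op1 (c := fun x => nmkQ x szero szero)) => //; comb.
by move=> ρ; rewrite qv_mk nq0 subr0 add0r divr1.
Qed.

Lemma rq_inv_nq Γ (f : tup M Γ -> NM M) : Rep f -> RQ (fun ρ => (nq (f ρ))^-1).
Proof.
move=> Hf; exists (fun ρ => cinv (f ρ)); last by move=> ρ; rewrite qv_inv.
by apply: rep_op1 => //; comb.
Qed.

Lemma rq_pw Γ (f : tup M Γ -> NM M) : Rep f -> RQ (fun ρ => pw (f ρ)).
Proof.
by move=> Hf; apply: rq_inv_nq; apply: rep_op1 => //; comb.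
Qed.

Lemma dec_leq Γ (f g : tup M Γ -> QM M) :
  RQ f -> RQ g -> Dec (fun ρ => f ρ <= g ρ).
Proof.
move=> [a Ha Ea] [b Hb Eb].
apply: (@dec_iff _ _ (fun ρ => nle
  (fnum (cfrac (a ρ)) * fden (cfrac (b ρ)) +
     fneg (cfrac (b ρ)) * fden (cfrac (a ρ)))%nm
  (fnum (cfrac (b ρ)) * fden (cfrac (a ρ)) +
     fneg (cfrac (a ρ)) * fden (cfrac (b ρ)))%nm)).
  by move=> ρ; rewrite -Ea -Eb qv_le.
apply: dec_le.
  apply: (rep_op2 (c := fun x y => fnum (cfrac x) * fden (cfrac y) +
     fneg (cfrac y) * fden (cfrac x))%nm) => //; comb.
apply: (rep_op2 (c := fun x y => fnum (cfrac y) * fden (cfrac x) +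
     fneg (cfrac x) * fden (cfrac y))%nm) => //; comb.
Qed.

Lemma dec_ltq Γ (f g : tup M Γ -> QM M) :
  RQ f -> RQ g -> Dec (fun ρ => f ρ < g ρ).
Proof.
move=> Hf Hg; apply: dec_iff (dec_not (dec_leq Hg Hf)) => ρ.
by rewrite ltNge; split=> /negP.
Qed.

Lemma dec_eqq Γ (f g : tup M Γ -> QM M) :
  RQ f -> RQ g -> Dec (fun ρ => f ρ = g ρ).
Proof.
move=> Hf Hg; apply: dec_iff (dec_and (dec_leq Hf Hg) (dec_leq Hg Hf)) => ρ.
by split=> [[]|->//]; lra.
Qed.

Lemma rep_if Γ (b : tup M Γ -> bool) (f g : tup M Γ -> NM M) :
  Dec (fun ρ => b ρ) -> Rep f -> Rep g -> Rep (fun ρ => if b ρ then f ρ else g ρ).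
Proof.
move=> [c Hc Ec] Hf Hg.
apply: (@rep_ext _ _ _ (fun ρ => ncond (c ρ) (f ρ) (g ρ))).
  move=> ρ; have := Ec ρ; case: (nat_case (c ρ)) => ->; rewrite ?ncond0 ?ncondS.
    by case=> _ ->.
  by case: (b ρ) => // -[/(_ isT)/succ_neq0].
by rewrite /ncond; do ![apply: rep_ap => //|apply: rep_const].
Qed.

Lemma rq_if Γ (b : tup M Γ -> bool) (f g : tup M Γ -> QM M) :
  Dec (fun ρ => b ρ) -> RQ f -> RQ g -> RQ (fun ρ => if b ρ then f ρ else g ρ).
Proof.
move=> Hb [x Hx Ex] [y Hy Ey]; exists (fun ρ => if b ρ then x ρ else y ρ).
  exact: rep_if.
by move=> ρ; case: (b ρ).
Qed.

Lemma rq_max Γ (f g : tup M Γ -> QM M) :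
  RQ f -> RQ g -> RQ (fun ρ => Num.max (f ρ) (g ρ)).
Proof. by move=> Hf Hg; apply: rq_if => //; apply: dec_ltq. Qed.

Lemma rq_min Γ (f g : tup M Γ -> QM M) :
  RQ f -> RQ g -> RQ (fun ρ => Num.min (f ρ) (g ρ)).
Proof. by move=> Hf Hg; apply: rq_if => //; apply: dec_ltq. Qed.

Lemma rq_norm Γ (f : tup M Γ -> QM M) : RQ f -> RQ (fun ρ => `|f ρ|).
Proof.
move=> Hf; have [a Ha Ea] := rq_max Hf (rq_opp Hf); exists a => // ρ.
rewrite Ea; case: (lerP 0 (f ρ)) => H.
  by rewrite ger0_norm // max_l; lra.
by rewrite ltr0_norm // max_r; lra.
Qed.

(** * Sequences of rationals and their sums *)

(** Junk unless [h] is representable, see [codedE]. *)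
Definition coded (h : NM M -> QM M) : M one :=
  epsilon (dom_inh M one) (fun c => forall n, qv (c $ n) = h n).

Definition RQ1 (h : NM M -> QM M) := RQ (fun ρ : tup M (tN :: nil) => h ρ.1).

Lemma codedE h : RQ1 h -> forall n, qv (coded h $ n) = h n.
Proof.
move=> [a Ha Ea]; apply: (epsilon_spec (dom_inh M one)
  (fun c => forall n, qv (c $ n) = h n)).
exists (fn (fun n => a (n, tt))) => n; rewrite fnE ?Ea //.
by apply: rep_ext Ha => -[x []].
Qed.

Definition sumC : M (one ⇒ one) := fn (fun c => fn (fun n =>
  sR $ fn (fun i => fn (fun r => cadd r (c $ i))) $ nmkQ szero szero szero $ n)).

Lemma sumC0 c : qv (sumC $ c $ szero) = 0.
Proof.
rewrite /sumC fnE; last by comb.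
rewrite fnE; last by comb.
by rewrite sR0 qv_mk nq0 subrr mul0r.
Qed.

Lemma sumCS c n : qv (sumC $ c $ nS n) = qv (sumC $ c $ n) + qv (c $ n).
Proof.
rewrite /sumC fnE; last by comb.
rewrite fnE; last by comb.
rewrite fnE; last by comb.
rewrite sRS fnE; last by comb.
by rewrite fnE ?qv_add //; comb.
Qed.

Definition qsum (h : NM M -> QM M) n := qv (sumC $ coded h $ n).

Lemma qsum0 h : qsum h szero = 0.
Proof. exact: sumC0. Qed.

Lemma qsumS h n : RQ1 h -> qsum h (nS n) = qsum h n + h n.
Proof. by move=> Hh; rewrite /qsum sumCS codedE. Qed.

(** The codes picked by [coded] need not be uniform in [ρ]. But the value of a sum depends only on
    the values of its terms, so the uniform codes [a] can be summed instead. *)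
Lemma rq_sum Γ (h : tup M Γ -> NM M -> QM M) (f : tup M Γ -> NM M) :
  RQ (fun ρ : tup M (tN :: Γ) => h ρ.2 ρ.1) -> Rep f ->
  RQ (fun ρ => qsum (h ρ) (f ρ)).
Proof.
move=> [a Ha Ea] Hf; exists (fun ρ => sumC $ fn (fun i => a (i, ρ)) $ f ρ).
  apply: rep_ap => //; apply: rep_ap; first exact: rep_const.
  by apply: rep_fn; apply: rep_ext Ha => -[].
move=> ρ; rewrite /qsum; move: (f ρ) => n.
have Hc i : qv (fn (fun i => a (i, ρ)) $ i) = h ρ i.
  rewrite fnE ?Ea //.
  have [A HA] := Ha.
  exists (@apps M Γ _ A ρ) => -[x []] /=.
  by rewrite -[LHS]/(@apps M (tN :: Γ) _ A (x, ρ)) HA.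
have Hh : RQ1 (h ρ).
  exists (fun r => fn (fun i => a (i, ρ)) $ r.1); last by move=> r; rewrite Hc.
  by apply: rep_ap; [apply: rep_const|apply: rep_v0].
move: n; apply: ind; first by apply: dec_eqq; apply: rq_qv; rep.
  by rewrite !sumC0.
by move=> n IH; rewrite !sumCS IH codedE // Hc.
Qed.

Lemma rq_comp1 Γ (h : NM M -> QM M) (f : tup M Γ -> NM M) :
  RQ1 h -> Rep f -> RQ (fun ρ => h (f ρ)).
Proof.
move=> [a Ha Ea] Hf; exists (fun ρ => a (f ρ, tt)); last by move=> ρ; rewrite Ea.
apply: (rep_op1 (c := fun x => a (x, tt))) => //.
by apply: rep_ext Ha => -[x []].
Qed.

Definition RQ2 (h : NM M -> NM M -> QM M) :=
  RQ (fun ρ : tup M (tN :: tN :: nil) => h ρ.2.1 ρ.1).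

Lemma rq_comp2 Γ (h : NM M -> NM M -> QM M) (f g : tup M Γ -> NM M) :
  RQ2 h -> Rep f -> Rep g -> RQ (fun ρ => h (f ρ) (g ρ)).
Proof.
move=> [a Ha Ea] Hf Hg; exists (fun ρ => a (g ρ, (f ρ, tt))).
  apply: (rep_op2 (c := fun x y => a (y, (x, tt)))) => //.
  by apply: rep_ext Ha => -[x [y []]].
by move=> ρ; rewrite Ea.
Qed.

Lemma qsum_le (h : NM M -> QM M) m n : RQ1 h -> (forall j, 0 <= h j) ->
  nle m n -> qsum h m <= qsum h n.
Proof.
move=> Hh H0 /nleP[c ->]; move: c; apply: ind.
- apply: dec_leq; first exact: rq_const.
  by apply: rq_sum; [apply: rq_comp1 => //; rep|rep].
- by rewrite nadd0.
- by move=> c IH; rewrite naddS qsumS //; apply: (le_trans IH); rewrite lerDl.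
Qed.

Lemma ler_qsum (h g : NM M -> QM M) n : RQ1 h -> RQ1 g ->
  (forall j, nlt j n -> h j <= g j) -> qsum h n <= qsum g n.
Proof.
move=> Hh Hg H; suff Hk : forall k, nle k n -> qsum h k <= qsum g k.
  exact/Hk/nle_refl.
apply: ind.
- apply: dec_imp; first by dec.
  by apply: dec_leq; apply: rq_sum; (try apply: rq_comp1 => //); rep.
- by rewrite !qsum0.
- move=> k IH Hk; rewrite !qsumS //; apply: lerD; last exact: H.
  by apply: IH; apply: nle_trans Hk; apply/nq_le; rewrite nqS; lra.
Qed.

(** The number of counterexamples below the bound is a sum of zeros and ones, and the statement
    holds iff this sum is 0. *)
Lemma dec_all Γ (P : NM M -> tup M Γ -> Prop) (b : tup M Γ -> NM M) :
  Dec (fun ρ : tup M (tN :: Γ) => P ρ.1 ρ.2) -> Rep b ->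
  Dec (fun ρ => forall j, nlt j (b ρ) -> P j ρ).
Proof.
move=> HP Hb; pose h ρ j : QM M := if `[< P j ρ >] then 0 else 1.
have Hh : RQ (fun ρ : tup M (tN :: Γ) => h ρ.2 ρ.1).
  apply: (rq_if (b := fun ρ : tup M (tN :: Γ) => `[< P ρ.1 ρ.2 >]));
    [|exact: rq_const..].
  by apply: dec_iff HP => ρ; split=> /asboolP.
apply: dec_iff (dec_eqq (rq_sum Hh Hb) (rq_const _ 0)) => ρ.
have {}Hh : RQ1 (h ρ).
  have [a [A HA] Ea] := Hh.
  exists (fun r => a (r.1, ρ)); last by move=> r; rewrite Ea.
  by exists (@apps M Γ _ A ρ) => -[x []] /=; apply: (HA (x, ρ)).
have h0 j : 0 <= h ρ j by rewrite /h; case: ifP.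
split=> [E j Hj|H].
  apply/asboolP; have := qsum_le Hh h0 Hj; have := qsum_le Hh h0 (nle0 j).
  by rewrite qsumS // qsum0 E {3}/h; case: ifP => // _; lra.
apply: le_anti; apply/andP; split.
  suff <- : qsum (fun _ => 0) (b ρ) = 0.
    by apply: ler_qsum => // [|j /H/asboolP]; [exact: rq_const|rewrite /h => ->].
  move: (b ρ); apply: ind.
    by apply: dec_eqq; [apply: rq_sum; [exact: rq_const|rep]|exact: rq_const].
    exact: qsum0.
  by move=> n IH; rewrite qsumS ?IH ?addr0 //; exact: rq_const.
by rewrite -(qsum0 (h ρ)); apply: qsum_le => //; apply: nle0.
Qed.
End RationalFunctions.
#[global] Opaque sumC addC mulC subC predC condC expC triC diagC.

Definition rv (M : gmodel) (x : M one) (n : NM M) : QM M := qv (x $ n).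

Ltac unfold_ops := rewrite /rv /cadd /cmul /copp /cinv /nmkQ /nsnd /nfst
  /npair /nexp /ntri /ndiag /nS /nadd /npred /ncond /nmul /nsub.

Ltac rauto_core :=
  cbv beta;
  lazymatch goal with
  | H : ?P |- ?P => exact H
  | |- Rep (fun _ => ?c) => apply rep_const
  | |- Rep (fun ρ => sap (@?f ρ) (@?g ρ)) =>
      apply (@rep_ap _ _ _ _ f g); rauto_core
  | |- Rep (fun ρ => fn (@?h ρ)) => apply (@rep_fn _ _ _ _ h); rauto_core
  | |- Rep _ => first [rep_leaf | apply rep_if; rauto_core]
  | |- RQ (fun _ => ?c) => apply rq_const
  | |- RQ (fun ρ => @?f ρ + @?g ρ) => apply (@rq_add _ _ f g); rauto_core
  | |- RQ (fun ρ => - @?f ρ) => apply (@rq_opp _ _ f); rauto_core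
  | |- RQ (fun ρ => @?f ρ * @?g ρ) => apply (@rq_mul _ _ f g); rauto_core
  | |- RQ (fun ρ => nq (@?f ρ)) => apply (@rq_nq _ _ f); rauto_core
  | |- RQ (fun ρ => (nq (@?f ρ))^-1) => apply (@rq_inv_nq _ _ f); rauto_core
  | |- RQ (fun ρ => pw (@?f ρ)) => apply (@rq_pw _ _ f); rauto_core
  | |- RQ (fun ρ => qv (@?f ρ)) => apply (@rq_qv _ _ f); rauto_core
  | |- RQ (fun ρ => Num.max (@?f ρ) (@?g ρ)) =>
      apply (@rq_max _ _ f g); rauto_core
  | |- RQ (fun ρ => Num.min (@?f ρ) (@?g ρ)) =>
      apply (@rq_min _ _ f g); rauto_core
  | |- RQ (fun ρ => `|@?f ρ|) => apply (@rq_norm _ _ f); rauto_core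
  | |- RQ (fun ρ => qsum (@?h ρ) (@?f ρ)) =>
      apply (@rq_sum _ _ h f); rauto_core
  | H : RQ2 ?h |- RQ (fun ρ => ?h (@?f ρ) (@?g ρ)) =>
      apply (@rq_comp2 _ _ h f g); [exact H|rauto_core..]
  | H : RQ1 ?h |- RQ (fun ρ => ?h (@?f ρ)) =>
      apply (@rq_comp1 _ _ h f); [exact H|rauto_core]
  | |- RQ _ => apply rq_if; rauto_core
  | |- RQ1 _ => rewrite /RQ1; rauto_core
  | |- RQ2 _ => rewrite /RQ2; rauto_core
  | |- Dec (fun ρ => @?P ρ /\ @?Q ρ) => apply (@dec_and _ _ P Q); rauto_core
  | |- Dec (fun ρ => ~ (@?P ρ)) => apply (@dec_not _ _ P); rauto_core
  | |- Dec (fun ρ => nle (@?f ρ) (@?g ρ)) =>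
      apply (@dec_le _ _ f g); rauto_core
  | |- Dec (fun ρ => nlt (@?f ρ) (@?g ρ)) =>
      apply (@dec_le _ _ (fun ρ => ssucc $ (f ρ)) g); rauto_core
  | |- Dec (fun ρ => is_true (asbool (@?P ρ))) =>
      apply (@dec_iff _ _ P); [intro; split=> /asboolP; done|rauto_core]
  | |- Dec (fun ρ => is_true (@?f ρ <= @?g ρ)) =>
      apply (@dec_leq _ _ f g); rauto_core
  | |- Dec (fun ρ => is_true (@?f ρ < @?g ρ)) =>
      apply (@dec_ltq _ _ f g); rauto_core
  | |- Dec (fun ρ => @eq (dom _ tN) (@?f ρ) (@?g ρ)) =>
      apply (@dec_eq _ _ f g); rauto_core
  | |- Dec (fun ρ => @eq _ (@?f ρ) (@?g ρ)) =>
      apply (@dec_eqq _ _ f g); rauto_core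
  | |- Dec (fun ρ => forall j, nlt j (@?b ρ) -> @?P ρ j) =>
      apply (@dec_all _ _ (fun j ρ => P ρ j) b); rauto_core
  | |- Dec (fun ρ => @?P ρ -> @?Q ρ) => apply (@dec_imp _ _ P Q); rauto_core
  | |- _ => idtac
  end.
Ltac rauto := intros; unfold_ops; rauto_core.

(** * Choice and induction *)

Section Choice.
Context {M : gmodel}.

Definition Dec2 (P : NM M -> NM M -> Prop) :=
  Dec (fun ρ : tup M (tN :: tN :: nil) => P ρ.2.1 ρ.1).

Lemma dec_comp2 Γ (P : NM M -> NM M -> Prop) (f g : tup M Γ -> NM M) :
  Dec2 P -> Rep f -> Rep g -> Dec (fun ρ => P (f ρ) (g ρ)).
Proof.
move=> [a Ha Ea] Hf Hg; exists (fun ρ => a (g ρ, (f ρ, tt))).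
  apply: (rep_op2 (c := fun x y => a (y, (x, tt)))) => //.
  by apply: rep_ext Ha => -[x [y []]].
by move=> ρ; rewrite -(Ea (g ρ, (f ρ, tt))).
Qed.

(** QF-AC chooses numbers for sequences; a number [m] is passed to it as the constant sequence [m]
    and recovered as the value at 0. *)
Lemma choice00 (P : NM M -> NM M -> Prop) : Dec2 P ->
  (forall m, exists n, P m n) -> exists g : M one, forall m, P m (g $ m).
Proof.
move=> [a [A HA] Ea] H.
have HA' m n : A $ m $ n = a (n, (m, tt)) by rewrite -HA.
have EP m n : P m n <-> A $ m $ n = szero by rewrite HA' -Ea.
pose F : M (one ⇒ tN ⇒ tN) := fn (fun x => A $ (x $ szero)).
have FE x n : F $ x $ n = A $ (x $ szero) $ n by rewrite /F fnE //; rauto.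
have [x|G HG] := @qf_ac M F.
  by have [n Hn] := H (x $ szero); exists n; rewrite FE; apply/EP.
exists (fn (fun m => G $ fn (fun _ => m))) => m; apply/EP.
rewrite fnE; last by rauto.
by have := HG (fn (fun _ => m)); rewrite FE fnE //; rauto.
Qed.

Lemma ind_S1 (P : NM M -> NM M -> Prop) : Dec2 P -> (exists n, P szero n) ->
  (forall m, (exists n, P m n) -> exists n, P (nS m) n) ->
  forall m, exists n, P m n.
Proof.
move=> HP [n0 H0] HS.
(* [g] turns a witness at [m] into one at [m + 1]; it is iterated from [n0]. *)
have [||g Hg] := @choice00 (fun e n =>
    P (nfst e) (nsnd e) -> P (nS (nfst e)) n).
- by apply: dec_imp; apply: (dec_comp2 HP); rauto.
- move=> e; case: (pselect (P (nfst e) (nsnd e))) => [He|]; last by exists szero.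
  by have [|n Hn] := HS (nfst e); [exists (nsnd e)|exists n].
pose r m := sR $ fn (fun m => fn (fun r => g $ npair m r)) $ n0 $ m.
have r0 : r szero = n0 by rewrite /r sR0.
have rS m : r (nS m) = g $ npair m (r m).
  by rewrite /r sRS fnE ?fnE //; rauto.
move=> m; exists (r m); move: m; apply: ind.
- by rewrite /r; apply: (dec_comp2 HP); rauto.
- by rewrite r0.
- move=> m IH; rewrite rS; have := Hg (npair m (r m)).
  by rewrite nfst_pair nsnd_pair; apply.
Qed.

(** Counting down: if the claim fails at [c], then by Sigma-1 induction on [d] it fails at [c - d],
    hence at 0. *)
Lemma ind_P1 (P : NM M -> NM M -> Prop) : Dec2 P -> (forall n, P szero n) ->
  (forall m, (forall n, P m n) -> forall n, P (nS m) n) -> forall m n, P m n.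
Proof.
move=> HP H0 HS c n0; apply: NNPP => Hn.
have [|||n] := @ind_S1 (fun d n => ~ P (nsub c d) n) _ _ _ c.
- by apply: dec_not; apply: (dec_comp2 HP); rauto.
- by exists n0; rewrite nsub0.
- move=> d [n Hd]; rewrite nsubS.
  case: (nat_case (nsub c d)) => E; first by exists n; rewrite E npred0 -E.
  apply: NNPP => H; apply: Hd; rewrite E; apply: HS => k.
  by apply: NNPP => Hk; apply: H; exists k.
- by have := nsub_addr szero c; rewrite nadd0l => ->; apply.
Qed.

Lemma least_S1 (P : NM M -> NM M -> Prop) : Dec2 P -> forall i n, P i n ->
  exists2 i, exists n, P i n & forall j, nlt j i -> forall n, ~ P j n.
Proof.
move=> HP i n Hi; apply: NNPP => H.
(* With the unbounded [n] quantified before the bounded [j], the matrix remains decidable and Pi-1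
   induction applies. *)
have /(_ (nS i) n i) : forall i n j, nlt j i -> ~ P j n.
  apply: ind_P1.
  - rewrite /Dec2; apply: (@dec_all M (tN :: tN :: nil) (fun j ρ => ~ P j ρ.1)
      (fun ρ => ρ.2.1)); last by rauto.
    by apply: dec_not; apply: (dec_comp2 HP); rauto.
  - by move=> k j /nlt0.
  - move=> m IH k j /nlt_eqVlt[|-> Hk]; first exact: IH.
    by apply: H; exists m; [exists k|move=> j' Hj' k'; apply: IH].
by apply=> //; apply: nle_refl.
Qed.
End Choice.

Lemma imp_eq (A B A' B' : Prop) : A = A' -> B = B' -> (A -> B) = (A' -> B').
Proof. by move=> -> ->. Qed.
Lemma ex_eq (X : Type) (P Q : X -> Prop) :
  (forall x, P x = Q x) -> (exists x, P x) = (exists x, Q x).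
Proof. by move=> H; congr ex; apply: funext. Qed.

(** * Real numbers *)

Section Reals.
Context {M : gmodel}.
Implicit Types (x y z : M one) (n q : NM M).

Definition c0 : NM M := nmkQ szero szero szero.
Definition c1 : NM M := nmkQ (nS szero) szero szero.
Definition rrat q : M one := fn (fun _ => q).
Definition radd x y : M one := fn (fun n => cadd (x $ nS n) (y $ nS n)).
Definition ropp x : M one := fn (fun n => copp (x $ n)).
Definition rsub x y := radd x (ropp y).
Definition rsum (x : M (tN ⇒ one)) n : M one := fn (fun k =>
  sR $ fn (fun i => fn (fun r => cadd r (x $ i $ nadd k n))) $ c0 $ n).

(** These are the readings of the formulas of the statement in the model, nested in the same way;
    the lemmas named [sat_] followed by a formula identify the two. *)
Definition IsR x := forall n i, `|rv x n - rv x (nadd n i)| < pw n.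
Definition EqR x y := forall n, `|rv x n - rv y n| <= pw n + pw n.
Definition LtR x y := exists n, rv x n + (pw n + pw n) < rv y n.
Definition LeR x y := ~ LtR y x.
Definition In01 x := LeR (rrat c0) x /\ LeR x (rrat c1).
Definition InOpen x y z := LtR x z /\ LtR z y.
Definition Intervals x y := forall n, rv x n < rv y n.
Definition InUnion x y z := exists n, InOpen (rrat (x $ n)) (rrat (y $ n)) z.
Definition InClosed x y z := In01 z /\ ~ InUnion x y z.
Definition TotalLt x y z := exists d, IsR d /\ (LtR d z /\ forall n,
  LeR (rsum (fn (fun i => rrat (cadd (y $ i) (copp (x $ i))))) n) d).
Definition NullClosed x y := forall e, IsR e -> LtR (rrat c0) e ->
  exists c d, Intervals c d /\ (TotalLt c d e /\
    forall z, IsR z -> InClosed x y z -> InUnion c d z).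

Definition Fun01 (Ψ : M (one ⇒ one)) :=
  (forall x, IsR x -> In01 x -> IsR (Ψ $ x)) /\
  (forall x, IsR x -> forall y, IsR y -> In01 x -> In01 y -> EqR x y ->
     EqR (Ψ $ x) (Ψ $ y)).
Definition Positive01 (Ψ : M (one ⇒ one)) :=
  forall x, IsR x -> In01 x -> LtR (rrat c0) (Ψ $ x).
Definition ContAt (Ψ : M (one ⇒ one)) x := forall e, IsR e ->
  LtR (rrat c0) e -> exists d, IsR d /\ (LtR (rrat c0) d /\
    forall y, IsR y -> In01 y -> InOpen (rsub x d) (radd x d) y ->
      InOpen (rsub (Ψ $ x) e) (radd (Ψ $ x) e) (Ψ $ y)).
Definition ContAE (Ψ : M (one ⇒ one)) := exists a b,
  Intervals a b /\ (NullClosed a b /\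
    forall x, IsR x -> In01 x -> ~ InClosed a b x -> ContAt Ψ x).
Definition InI (Ψ : M (one ⇒ one)) y x :=
  InOpen (rsub y (Ψ $ y)) (radd y (Ψ $ y)) x.
Definition InJ (Ψ : M (one ⇒ one)) (y : M (tN ⇒ one)) n x :=
  InI Ψ (y $ n) x /\ ~ exists j, nlt j n /\ InI Ψ (y $ j) x.
Definition LengthIs (A : M one -> Prop) x := exists m (a b : M (tN ⇒ one)),
  (forall j, nlt j m -> IsR (a $ j) /\ (IsR (b $ j) /\ LeR (a $ j) (b $ j))) /\
  ((forall j, nlt (nS j) m -> LeR (b $ j) (a $ nS j)) /\
  ((forall z, IsR z ->
     (forall j, nlt j m -> ~ EqR z (a $ j) /\ ~ EqR z (b $ j)) ->
     (A z <-> exists j, nlt j m /\ InOpen (a $ j) (b $ j) z)) /\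
   EqR x (rsum (fn (fun j => rsub (b $ j) (a $ j))) m))).
Definition WHBU (Ψ : M (one ⇒ one)) e := exists k (y : M (tN ⇒ one)),
  (forall i, nle i k -> IsR (y $ i) /\ In01 (y $ i)) /\
  ((forall i j, nlt i j -> nle j k -> ~ EqR (y $ i) (y $ j)) /\
   exists l : M (tN ⇒ one),
     (forall i, nle i k -> IsR (l $ i) /\ LengthIs (InJ Ψ y i) (l $ i)) /\
     LtR (rsub (rrat c1) e) (rsum l (nS k))).

Section Atoms.
Context (Γ : ctx) (ρ : env M Γ).
Implicit Types s t : tm Γ tN.

Lemma teval_mkQ s t u : teval ρ (mkQ s t u) =
  nmkQ (teval ρ s) (teval ρ t) (teval ρ u).
Proof. by rewrite /mkQ !teval_pairN. Qed.

Lemma teval_denQ t : teval ρ (denQ t) = fden (cfrac (teval ρ t)).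
Proof. by rewrite /denQ teval_S teval_sndN. Qed.
Lemma teval_posQ t : teval ρ (posQ t) = fnum (cfrac (teval ρ t)).
Proof. by rewrite /posQ !teval_fstN. Qed.
Lemma teval_negpQ t : teval ρ (negpQ t) = fneg (cfrac (teval ρ t)).
Proof. by rewrite /negpQ teval_sndN teval_fstN. Qed.

Definition tevalQ := (teval_mkQ, teval_denQ, teval_posQ, teval_negpQ,
  @teval_sndN M Γ ρ, @teval_predN M Γ ρ, @teval_mulN M Γ ρ, @teval_addN M Γ ρ).

Lemma teval_addQ s t : teval ρ (addQ s t) = cadd (teval ρ s) (teval ρ t).
Proof. by rewrite caddE /addQ !tevalQ. Qed.
Lemma teval_oppQ s : teval ρ (oppQ s) = copp (teval ρ s).
Proof. by rewrite coppE /oppQ !tevalQ. Qed.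
Lemma teval_subQ s t :
  teval ρ (subQ s t) = cadd (teval ρ s) (copp (teval ρ t)).
Proof. by rewrite /subQ teval_addQ teval_oppQ. Qed.
Lemma teval_zeroQ : teval ρ zeroQ = c0.
Proof. exact: teval_mkQ. Qed.
Lemma teval_oneQ : teval ρ oneQ = c1.
Proof. exact: teval_mkQ. Qed.

Lemma sat_leQ s t : sat (leQ s t) ρ = (qv (teval ρ s) <= qv (teval ρ t)).
Proof.
apply: propext; rewrite /leQ sat_leN !teval_addN !teval_mulN !tevalQ.
by rewrite qv_le.
Qed.
Lemma sat_ltQ s t : sat (ltQ s t) ρ = (qv (teval ρ s) < qv (teval ρ t)).
Proof.
by rewrite /ltQ sat_Not sat_leQ ltNge; apply: propext; split=> /negP.
Qed.
Lemma qv_pow2Q t : qv (teval ρ (pow2Q t)) = pw (teval ρ t).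
Proof.
rewrite /pow2Q teval_mkQ teval_S teval_predN teval_expN2 qv_mk.
rewrite -nqS nq_predS; last by apply/nq_pos/nexp_gt0.
by rewrite /= nqS nq0 subr0 add0r div1r.
Qed.
Lemma qv_pow2Q' t :
  qv (teval ρ (pow2Q' t)) = pw (teval ρ t) + pw (teval ρ t).
Proof. by rewrite /pow2Q' teval_addQ qv_add qv_pow2Q. Qed.
End Atoms.

Lemma qv_c0 : qv c0 = 0.
Proof. by rewrite qv_mk nq0 subrr mul0r. Qed.
Lemma qv_c1 : qv c1 = 1.
Proof. by rewrite qv_mk nqS nq0 subr0 add0r divr1. Qed.
End Reals.

Ltac unfold_ops ::= rewrite /rsub /radd /ropp /rrat /rv /cadd /cmul /copp /cinv
  /nmkQ /nsnd /nfst /npair /nexp /ntri /ndiag /nS /nadd /npred /ncond /nmul /nsub.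

(** * Interpretation of the formulas about reals *)

Section RealOperations.
Context {M : gmodel}.

Lemma rv_rrat (q n : NM M) : rv (rrat q) n = qv q.
Proof. by rewrite /rv /rrat fnE //; rauto. Qed.
Lemma rv_radd (x y : M one) n : rv (radd x y) n = rv x (nS n) + rv y (nS n).
Proof. by rewrite /rv /radd fnE ?qv_add //; rauto. Qed.
Lemma rv_ropp (x : M one) n : rv (ropp x) n = - rv x n.
Proof. by rewrite /rv /ropp fnE ?qv_opp //; rauto. Qed.
Lemma rv_rsub (x y : M one) n : rv (rsub x y) n = rv x (nS n) - rv y (nS n).
Proof. by rewrite /rsub rv_radd rv_ropp. Qed.

Lemma rv_rsum (x : M (tN ⇒ one)) n k :
  rv (rsum x n) k = qsum (fun i => rv (x $ i) (nadd k n)) n.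
Proof.
rewrite {1}/rv /rsum fnE; last by rauto.
move: (nadd k n) => K; move: n; apply: ind.
- apply: dec_eqq; first by apply: rq_qv; rauto.
  by rauto.
- by rewrite sR0 qsum0 qv_c0.
- move=> n IH; rewrite sRS fnE; last by rauto.
  rewrite fnE; last by rauto.
  by rewrite qv_add IH qsumS //; rauto.
Qed.

Lemma teval_lap Γ Δ (e : emb Γ Δ) (ρ : env M Δ) σ τ (f : tm Γ (σ ⇒ τ)) t :
  teval ρ (lift f · t)%tm = teval ρ (lift f) $ teval ρ t.
Proof. by []. Qed.
Lemma teval_lap2 Γ Δ (e : emb Γ Δ) (ρ : env M Δ) σ τ υ
  (f : tm Γ (σ ⇒ τ ⇒ υ)) t u :
  teval ρ (lift f · t · u)%tm = teval ρ (lift f) $ teval ρ t $ teval ρ u.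
Proof. by []. Qed.

Lemma teval_ratR Γ (ρ : env M Γ) (q : tm Γ tN) :
  teval ρ (ratR q) = rrat (teval ρ q).
Proof.
apply: sap_ext => n; rewrite teval_Lam teval_lift /rrat fnE //; rauto.
Qed.

Lemma teval_addR Γ (ρ : env M Γ) (s t : tm Γ one) :
  teval ρ (addR s t) = radd (teval ρ s) (teval ρ t).
Proof.
apply: sap_ext => n; rewrite teval_Lam /radd fnE; last by rauto.
by rewrite teval_addQ !teval_lap !teval_S !teval_lift.
Qed.

Lemma teval_oppR Γ (ρ : env M Γ) (s : tm Γ one) :
  teval ρ (oppR s) = ropp (teval ρ s).
Proof.
apply: sap_ext => n; rewrite teval_Lam /ropp fnE; last by rauto.
by rewrite teval_oppQ !teval_lap !teval_lift.
Qed.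

Lemma teval_subR Γ (ρ : env M Γ) (s t : tm Γ one) :
  teval ρ (subR s t) = rsub (teval ρ s) (teval ρ t).
Proof. by rewrite /subR teval_addR teval_oppR. Qed.

Lemma sat_isR Γ (ρ : env M Γ) (s : tm Γ one) : sat (isR s) ρ = IsR (teval ρ s).
Proof.
rewrite /isR sat_AllB; apply: forall_eq => n; rewrite sat_AllB.
apply: forall_eq => i; rewrite sat_And !sat_ltQ qv_pow2Q !teval_subQ.
rewrite ?teval_lap2 ?teval_lap !teval_addN !teval_lift.
rewrite !qv_add !qv_opp /rv; apply: propext; rewrite ltr_norml.
by split=> [[H1 H2]|/andP[H1 H2]]; [apply/andP|]; split; lra.
Qed.

Lemma sat_eqR Γ (ρ : env M Γ) (s t : tm Γ one) :
  sat (eqR s t) ρ = EqR (teval ρ s) (teval ρ t).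
Proof.
rewrite /eqR sat_AllB; apply: forall_eq => n.
rewrite sat_And !sat_leQ qv_pow2Q' !teval_subQ.
rewrite ?teval_lap2 ?teval_lap !teval_lift.
rewrite !qv_add !qv_opp /rv; apply: propext; rewrite ler_norml.
by split=> [[H1 H2]|/andP[H1 H2]]; [apply/andP|]; split; lra.
Qed.

Lemma sat_ltR Γ (ρ : env M Γ) (s t : tm Γ one) :
  sat (ltR s t) ρ = LtR (teval ρ s) (teval ρ t).
Proof.
rewrite /ltR sat_ExB; apply: ex_eq => n.
by rewrite sat_ltQ teval_addQ qv_add qv_pow2Q' ?teval_lap2 ?teval_lap !teval_lift.
Qed.

Lemma sat_leR Γ (ρ : env M Γ) (s t : tm Γ one) :
  sat (leR s t) ρ = LeR (teval ρ s) (teval ρ t).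
Proof. by rewrite /leR sat_Not sat_ltR. Qed.

Lemma sat_in01 Γ (ρ : env M Γ) (s : tm Γ one) :
  sat (in01 s) ρ = In01 (teval ρ s).
Proof.
by rewrite /in01 sat_And !sat_leR !teval_ratR teval_zeroQ teval_oneQ.
Qed.

Lemma sat_inOpen Γ (ρ : env M Γ) (s t u : tm Γ one) :
  sat (inOpen s t u) ρ = InOpen (teval ρ s) (teval ρ t) (teval ρ u).
Proof. by rewrite /inOpen sat_And !sat_ltR. Qed.

Lemma teval_sumR Γ (ρ : env M Γ) (s : tm Γ (tN ⇒ one)) (q : tm Γ tN) :
  teval ρ (sumR s q) = rsum (teval ρ s) (teval ρ q).
Proof.
apply: sap_ext => k; rewrite teval_Lam teval_rec /rsum fnE; last by rauto.
rewrite teval_zeroQ teval_lift; congr (_ $ _ $ _ $ _).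
apply: sap_ext => i; rewrite teval_Lam fnE; last by rauto.
apply: sap_ext => r; rewrite teval_Lam fnE; last by rauto.
rewrite teval_addQ ?teval_lap2 ?teval_lap teval_addN !teval_lift.
by [].
Qed.

Lemma sat_intervals Γ (ρ : env M Γ) (s t : tm Γ one) :
  sat (intervals s t) ρ = Intervals (teval ρ s) (teval ρ t).
Proof.
rewrite /intervals sat_AllB; apply: forall_eq => n.
by rewrite sat_ltQ ?teval_lap2 ?teval_lap !teval_lift.
Qed.

Lemma sat_inUnion Γ (ρ : env M Γ) (s t u : tm Γ one) :
  sat (inUnion s t u) ρ = InUnion (teval ρ s) (teval ρ t) (teval ρ u).
Proof.
rewrite /inUnion sat_ExB; apply: ex_eq => n.
by rewrite sat_inOpen !teval_ratR ?teval_lap2 ?teval_lap !teval_lift.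
Qed.

Lemma sat_inClosed Γ (ρ : env M Γ) (s t u : tm Γ one) :
  sat (inClosed s t u) ρ = InClosed (teval ρ s) (teval ρ t) (teval ρ u).
Proof. by rewrite /inClosed sat_And sat_Not sat_in01 sat_inUnion. Qed.

Lemma sat_totalLt Γ (ρ : env M Γ) (s t u : tm Γ one) :
  sat (totalLt s t u) ρ = TotalLt (teval ρ s) (teval ρ t) (teval ρ u).
Proof.
rewrite /totalLt sat_ExB; apply: ex_eq => d.
rewrite sat_And sat_isR; congr and; rewrite sat_And sat_ltR !teval_lift.
congr and; rewrite sat_AllB; apply: forall_eq => n.
rewrite sat_leR teval_sumR !teval_lift; congr LeR; congr rsum.
apply: sap_ext => i; rewrite teval_Lam fnE; last by rauto.
rewrite teval_ratR teval_subQ ?teval_lap2 ?teval_lap !teval_lift.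
by [].
Qed.
End RealOperations.

Lemma sat_ltNE (M : gmodel) Γ (ρ : env M Γ) s t :
  sat (ltN s t) ρ = nlt (teval ρ s) (teval ρ t).
Proof. by apply: propext; apply: sat_ltN. Qed.

Lemma sat_leNE (M : gmodel) Γ (ρ : env M Γ) s t :
  sat (leN s t) ρ = nle (teval ρ s) (teval ρ t).
Proof. by apply: propext; apply: sat_leN. Qed.

Ltac tsimp := cbn [teval]; repeat match goal with
  | |- context [teval ?ρ (@lift ?Γ ?Δ ?e ?σ ?t)] =>
      rewrite (@teval_lift _ Γ Δ e ρ σ t)
  | |- context [teval ?ρ (ratR ?t)] => rewrite (teval_ratR ρ t)
  | |- context [teval ?ρ zeroQ] => rewrite (teval_zeroQ ρ)
  | |- context [teval ?ρ oneQ] => rewrite (teval_oneQ ρ)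
  | |- context [teval ?ρ (subR ?s ?t)] => rewrite (teval_subR ρ s t)
  | |- context [teval ?ρ (addR ?s ?t)] => rewrite (teval_addR ρ s t)
  | |- context [teval ?ρ (sumR ?s ?t)] => rewrite (teval_sumR ρ s t)
  | |- context [teval _ (tapp _ _)] => cbn [teval]
  end;
  lazymatch goal with |- context [Lam] => idtac | |- _ => try reflexivity end.

Ltac sem :=
  lazymatch goal with
  | |- sat (AllB _ _) _ = _ => rewrite sat_AllB; apply: forall_eq => ?; sem
  | |- sat (ExB _ _) _ = _ => rewrite sat_ExB; apply: ex_eq => ?; sem
  | |- sat (And _ _) _ = _ => rewrite sat_And; refine (f_equal2 and _ _); sem
  | |- sat (Iff _ _) _ = _ => rewrite sat_Iff; refine (f_equal2 iff _ _); sem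
  | |- sat (Not _) _ = _ => rewrite sat_Not; refine (f_equal not _); sem
  | |- sat (Imp _ _) _ = _ => rewrite sat_Imp; apply: imp_eq; sem
  | |- sat (ltN _ _) _ = _ => rewrite sat_ltNE; tsimp
  | |- sat (leN _ _) _ = _ => rewrite sat_leNE; tsimp
  | |- sat (isR _) _ = _ => rewrite sat_isR; tsimp
  | |- sat (eqR _ _) _ = _ => rewrite sat_eqR; tsimp
  | |- sat (ltR _ _) _ = _ => rewrite sat_ltR; tsimp
  | |- sat (leR _ _) _ = _ => rewrite sat_leR; tsimp
  | |- sat (in01 _) _ = _ => rewrite sat_in01; tsimp
  | |- sat (inOpen _ _ _) _ = _ => rewrite sat_inOpen; tsimp
  | |- sat (intervals _ _) _ = _ => rewrite sat_intervals; tsimp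
  | |- sat (inUnion _ _ _) _ = _ => rewrite sat_inUnion; tsimp
  | |- sat (inClosed _ _ _) _ = _ => rewrite sat_inClosed; tsimp
  | |- sat (totalLt _ _ _) _ = _ => rewrite sat_totalLt; tsimp
  | |- sat _ _ = _ => idtac
  | |- _ => tsimp
  end.

(* Otherwise [rewrite] unfolds these terms in search of a match. *)
Opaque S1 sumR subR addR ratR zeroQ oneQ Lam addQ subQ.

Section Formulas.
Context {M : gmodel}.

Lemma sat_nullClosed Γ (ρ : env M Γ) (s t : tm Γ one) :
  sat (nullClosed s t) ρ = NullClosed (teval ρ s) (teval ρ t).
Proof. by rewrite /nullClosed; sem. Qed.

Lemma sat_fun01 Γ (ρ : env M Γ) (s : tm Γ (one ⇒ one)) :
  sat (fun01 s) ρ = Fun01 (teval ρ s).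
Proof. by rewrite /fun01; sem. Qed.

Lemma sat_positive01 Γ (ρ : env M Γ) (s : tm Γ (one ⇒ one)) :
  sat (positive01 s) ρ = Positive01 (teval ρ s).
Proof. by rewrite /positive01; sem. Qed.

Lemma sat_contAt Γ (ρ : env M Γ) (s : tm Γ (one ⇒ one)) (t : tm Γ one) :
  sat (contAt s t) ρ = ContAt (teval ρ s) (teval ρ t).
Proof. by rewrite /contAt; sem. Qed.

Lemma sat_inI Γ (ρ : env M Γ) (s : tm Γ (one ⇒ one)) (t u : tm Γ one) :
  sat (inI s t u) ρ = InI (teval ρ s) (teval ρ t) (teval ρ u).
Proof. by rewrite /inI; sem. Qed.

Lemma sat_contAE Γ (ρ : env M Γ) (s : tm Γ (one ⇒ one)) :
  sat (contAE s) ρ = ContAE (teval ρ s).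
Proof.
by rewrite /contAE; sem; rewrite ?sat_nullClosed ?sat_contAt; tsimp.
Qed.

Lemma sat_inJ Γ (ρ : env M Γ) (s : tm Γ (one ⇒ one)) (t : tm Γ (tN ⇒ one)) q u :
  sat (inJ s t q u) ρ = InJ (teval ρ s) (teval ρ t) (teval ρ q) (teval ρ u).
Proof.
by rewrite /inJ; sem; rewrite sat_inI; tsimp.
Qed.

Lemma sat_lengthIs Γ (ρ : env M Γ) (A : fm (one :: Γ)) (t : tm Γ one) :
  sat (lengthIs A t) ρ =
  LengthIs (fun x => sat A (econs x ρ)) (teval ρ t).
Proof.
rewrite /lengthIs; sem.
- rewrite sat_sub; congr (sat A _).
  by apply: env_ext => [|υ v].
- match goal with |- EqR _ (rsum ?a _) = EqR _ (rsum ?b _) =>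
    have -> : a = b; last reflexivity end.
  apply: sap_ext => j; rewrite teval_Lam fnE; last by rauto.
  by tsimp.
Qed.

Lemma sat_lengthJ Γ (ρ : env M Γ) (s : tm Γ (one ⇒ one)) (t : tm Γ (tN ⇒ one)) q u :
  sat (lengthJ s t q u) ρ =
  LengthIs (InJ (teval ρ s) (teval ρ t) (teval ρ q)) (teval ρ u).
Proof.
rewrite /lengthJ sat_lengthIs; congr (LengthIs _ _); apply: funext => x.
by rewrite sat_inJ !teval_lift.
Qed.

Lemma sat_WHBU_at Γ (ρ : env M Γ) (s : tm Γ (one ⇒ one)) (t : tm Γ one) :
  sat (WHBU_at s t) ρ = WHBU (teval ρ s) (teval ρ t).
Proof.
rewrite /WHBU_at; sem.
by rewrite sat_lengthJ; tsimp.
Qed.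

Lemma sat_WHBU_ae : sat WHBU_ae (@enil M) =
  forall Ψ : M (one ⇒ one), Fun01 Ψ -> Positive01 Ψ -> ContAE Ψ ->
    forall e, IsR e -> LtR (rrat c0) e -> WHBU Ψ e.
Proof.
rewrite /WHBU_ae; sem.
- by rewrite sat_fun01.
- by rewrite sat_positive01.
- by rewrite sat_contAE.
- by rewrite sat_WHBU_at.
Qed.

(** * Weak Koenig's lemma *)

Definition snocC (s b : NM M) := nS (nadd (nadd s s) b).
Definition nrestr (f : M one) n : NM M :=
  sR $ fn (fun i => fn (fun s => snocC s (f $ i))) $ szero $ n.

Lemma nrestr0 f : nrestr f szero = szero.
Proof. exact: sR0. Qed.
Lemma nrestrS f n : nrestr f (nS n) = snocC (nrestr f n) (f $ n).
Proof.
rewrite /nrestr sRS fnE; last by rewrite /snocC; rauto.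
by rewrite fnE //; rewrite /snocC; rauto.
Qed.

Lemma sat_mem Γ (ρ : env M Γ) s X :
  sat (Defs.mem s X) ρ = (teval ρ X $ teval ρ s = nS szero).
Proof. by apply: propext; rewrite /Defs.mem -(good_E (gmP M)). Qed.

Lemma sat_Eq0 Γ (ρ : env M Γ) (s t : tm Γ tN) :
  sat (Eq0 s t) ρ = (teval ρ s = teval ρ t).
Proof. by apply: propext; rewrite -(good_E (gmP M)). Qed.

Lemma teval_restr Γ (ρ : env M Γ) f n :
  teval ρ (restr f n) = nrestr (teval ρ f) (teval ρ n).
Proof.
rewrite /restr teval_rec /nrestr; congr (_ $ _ $ _ $ _).
apply: sap_ext => i; rewrite teval_Lam fnE; last by rewrite /snocC; rauto.
apply: sap_ext => s; rewrite teval_Lam fnE; last by rewrite /snocC; rauto.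
by rewrite /snocB teval_S !teval_addN; tsimp.
Qed.

Lemma sat_bintree Γ (ρ : env M Γ) T : sat (bintree T) ρ = forall s,
  (teval ρ T $ snocC s szero = nS szero \/
   teval ρ T $ snocC s (nS szero) = nS szero) -> teval ρ T $ s = nS szero.
Proof.
rewrite /bintree sat_AllB; apply: forall_eq => s; rewrite sat_Imp sat_Or.
apply: imp_eq; last by rewrite sat_mem; tsimp.
by apply: (f_equal2 or); rewrite sat_mem /snocB teval_S !teval_addN; tsimp.
Qed.

Lemma sat_infinite Γ (ρ : env M Γ) X : sat (infinite X) ρ = forall m,
  exists s, nle m s /\ teval ρ X $ s = nS szero.
Proof.
rewrite /infinite; sem.
by rewrite sat_mem; tsimp.
Qed.

Lemma wkl (T : M one) :
  (forall s, T $ snocC s szero = nS szero \/ T $ snocC s (nS szero) = nS szero ->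
     T $ s = nS szero) ->
  (forall m, exists s, nle m s /\ T $ s = nS szero) ->
  exists f : M one, (forall n, f $ n = szero \/ f $ n = nS szero) /\
    forall n, T $ nrestr f n = nS szero.
Proof.
have : sat (WKL nil) (@enil M) by apply: (good_models (gmP M)); right.
rewrite /WKL sat_AllB => /(_ T).
rewrite sat_Imp sat_bintree sat_Imp sat_infinite sat_ExB => H H1 H2.
have [f Hf] := H H1 H2; exists f; move: Hf.
rewrite sat_And 2!sat_AllB => -[Hf1 Hf2]; split=> n.
  by have := Hf1 n; rewrite sat_Or !sat_Eq0.
by have := Hf2 n; rewrite sat_mem teval_restr.
Qed.
End Formulas.
Transparent S1 sumR subR addR ratR zeroQ oneQ Lam addQ subQ.

(** * The order of the reals *)

Section RealOrder.
Context {M : gmodel}.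
Implicit Types x y z : M one.

Lemma nle_addr (m k : NM M) : nle m (nadd m k).
Proof. by apply/nleP; exists k. Qed.
Lemma nle_addl (m k : NM M) : nle m (nadd k m).
Proof. by rewrite naddC; apply: nle_addr. Qed.
Hint Resolve nle_addr nle_addl nle_refl : core.

Lemma pw_small_ge (q : QM M) m : 0 < q -> exists n, nle m n /\ pw n < q.
Proof.
move=> /pw_small[k Hk]; exists (nadd m k); split=> //.
exact: le_lt_trans (pw_le (nle_addl _ _)) Hk.
Qed.

Lemma real_close x m n : IsR x -> nle m n -> `|rv x m - rv x n| < pw m.
Proof. by move=> Hx /nleP[i ->]; apply: Hx. Qed.

Lemma real_close2 x m n : IsR x -> `|rv x m - rv x n| < pw m + pw n.
Proof.
move=> Hx; have Hm := pw_gt0 m; have Hn := pw_gt0 n.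
case: (nle_total m n) => /(real_close Hx) H; first lra.
by rewrite distrC; lra.
Qed.

(** At the index [m] of the witness, the difference exceeds [2 * 2^-m], and each sequence moves by
    less than [2^-m] afterwards; the surplus is [d]. With the converse [ev_ltR], questions about
    reals become linear inequalities between late approximations. *)
Lemma ltR_ev x y : IsR x -> IsR y -> LtR x y ->
  exists d m, 0 < d /\ forall n, nle m n -> rv x n + d < rv y n.
Proof.
move=> Hx Hy [m Hm]; exists (rv y m - rv x m - pw m - pw m), m.
split=> [|n Hn]; first by lra.
have := real_close Hx Hn; have := real_close Hy Hn.
by rewrite !ltr_norml => /andP[? ?] /andP[? ?]; lra.
Qed.

Lemma ev_ltR x y d m : 0 < d -> (forall n, nle m n -> rv x n + d <= rv y n) ->
  LtR x y.
Proof.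
move=> Hd H; have [|n [Hn Hp]] := @pw_small_ge (d / 2) m; first by lra.
by exists n; have := H n Hn; lra.
Qed.

Lemma leRP x y : LeR x y <-> forall n, rv x n <= rv y n + (pw n + pw n).
Proof.
split=> [H n|H [n Hn]]; last by have := H n; lra.
by rewrite leNgt; apply/negP => Hn; apply: H; exists n.
Qed.

Lemma ltRW x y : IsR x -> IsR y -> LtR x y -> LeR x y.
Proof.
move=> Hx Hy /(ltR_ev Hx Hy)[d [m [Hd H]]] /(ltR_ev Hy Hx)[d' [m' [Hd' H']]].
have := H (nadd m m') (nle_addr _ _); have := H' (nadd m m') (nle_addl _ _); lra.
Qed.

Lemma leR_refl x : LeR x x.
Proof. by apply/leRP => n; have := pw_gt0 n; lra. Qed.

Lemma leR_ltR_trans x y z : IsR x -> IsR y -> IsR z ->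
  LeR x y -> LtR y z -> LtR x z.
Proof.
move=> Hx Hy Hz /leRP Hle /(ltR_ev Hy Hz)[d [m [Hd H]]].
have [|n0 [Hn0 Hp]] := @pw_small_ge (d / 4) m; first by lra.
apply: (@ev_ltR _ _ (d / 2) n0) => [|n Hn]; first by lra.
have := H n (nle_trans Hn0 Hn); have := Hle n; have := pw_le Hn; lra.
Qed.

Lemma ltR_leR_trans x y z : IsR x -> IsR y -> IsR z ->
  LtR x y -> LeR y z -> LtR x z.
Proof.
move=> Hx Hy Hz /(ltR_ev Hx Hy)[d [m [Hd H]]] /leRP Hle.
have [|n0 [Hn0 Hp]] := @pw_small_ge (d / 4) m; first by lra.
apply: (@ev_ltR _ _ (d / 2) n0) => [|n Hn]; first by lra.
have := H n (nle_trans Hn0 Hn); have := Hle n; have := pw_le Hn; lra.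
Qed.

Lemma ltR_trans x y z :
  IsR x -> IsR y -> IsR z -> LtR x y -> LtR y z -> LtR x z.
Proof.
by move=> Hx Hy Hz Hxy; apply: leR_ltR_trans => //; apply: ltRW.
Qed.

Lemma leR_trans x y z :
  IsR x -> IsR y -> IsR z -> LeR x y -> LeR y z -> LeR x z.
Proof. by move=> Hx Hy Hz H1 H2 H3; apply: H2; apply: ltR_leR_trans H3 H1. Qed.

Lemma ltR_irr x : ~ LtR x x.
Proof. exact: leR_refl. Qed.

Lemma leR_neq x y : LeR x y -> ~ EqR x y -> LtR x y.
Proof.
move=> /leRP H HN; apply: NNPP => /leRP H'; apply: HN => n.
by rewrite ler_norml; have := H n; have := H' n => ? ?; apply/andP; split; lra.
Qed.

Lemma EqR_sym x y : EqR x y -> EqR y x.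
Proof. by move=> H n; rewrite distrC. Qed.

Lemma isR_rrat (q : NM M) : IsR (rrat q).
Proof. by move=> n i; rewrite !rv_rrat subrr normr0 pw_gt0. Qed.

Lemma isR_radd x y : IsR x -> IsR y -> IsR (radd x y).
Proof.
move=> Hx Hy n i; rewrite !rv_radd -naddSl.
have := Hx (nS n) i; have := Hy (nS n) i; rewrite !ltr_norml pwS.
by move=> /andP[? ?] /andP[? ?]; apply/andP; split; lra.
Qed.

Lemma isR_rsub x y : IsR x -> IsR y -> IsR (rsub x y).
Proof.
move=> Hx Hy; apply: isR_radd => // n i; rewrite !rv_ropp.
by rewrite -opprD normrN; apply: Hy.
Qed.

Lemma in01P (q : NM M) : In01 (rrat q) <-> 0 <= qv q <= 1.
Proof.
rewrite /In01 !leRP; split=> [[H1 H2]|/andP[H1 H2]].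
  apply/andP; split; rewrite leNgt; apply/negP => H.
    have [|n Hn] := @pw_small _ (- qv q / 2); first by lra.
    by have := H1 n; rewrite !rv_rrat qv_c0; lra.
  have [|n Hn] := @pw_small _ ((qv q - 1) / 2); first by lra.
  by have := H2 n; rewrite !rv_rrat qv_c1; lra.
by split=> n; rewrite !rv_rrat ?qv_c0 ?qv_c1; have := pw_gt0 n; lra.
Qed.

Lemma EqR_rrat (p q : NM M) : qv p = qv q -> EqR (rrat p) (rrat q).
Proof. by move=> E n; rewrite !rv_rrat E subrr normr0; have := pw_gt0 n; lra. Qed.

Lemma nexp_le (m n : NM M) : nle m n -> nle (nexp m) (nexp n).
Proof.
move=> /pw_le; by rewrite /pw lef_pV2 ?posrE ?nexp_gt0 // => H; apply/nq_le.
Qed.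

Lemma pw_mul (n : NM M) : nq (nexp n) * pw n = 1.
Proof. by rewrite mulfV // lt0r_neq0 // nexp_gt0. Qed.

Lemma nexpD (m n : NM M) : nq (nexp (nadd m n)) = nq (nexp m) * nq (nexp n).
Proof.
rewrite -nqM; congr nq; move: n; apply: ind; first by rauto.
  by rewrite nadd0 nexp0 nmulC nmul1l.
move=> n IH; rewrite naddS !nexpS IH; apply: nq_inj.
by rewrite !(nqM, nqD); lra.
Qed.

Lemma pwD (m n : NM M) : pw (nadd m n) = pw m * pw n.
Proof. by rewrite /pw nexpD invfM. Qed.
End RealOrder.
#[global] Hint Resolve nle_addr nle_addl nle_refl : core.

(** * Compactness of the unit interval *)

Section HeineBorel.
Context {M : gmodel}.
Variables lo hi : NM M -> QM M.
Hypotheses (Hlo : RQ1 lo) (Hhi : RQ1 hi).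

(** The length of the string with code [s], computed as the integer part of the binary logarithm of
    [s + 1]. *)
Definition lev (s : NM M) : NM M :=
  sR $ fn (fun i => fn (fun r =>
    if `[< nle (nexp (nS r)) (nS (nS i)) >] then nS r else r)) $ szero $ s.

Lemma lev0 : lev szero = szero.
Proof. exact: sR0. Qed.
Lemma levS s : lev (nS s) =
  if `[< nle (nexp (nS (lev s))) (nS (nS s)) >] then nS (lev s) else lev s.
Proof.
rewrite /lev sRS fnE; last by rauto.
by rewrite fnE //; rauto.
Qed.

Lemma lev_spec s : nle (nexp (lev s)) (nS s) /\ nlt (nS s) (nexp (nS (lev s))).
Proof.
move: s; apply: ind; first by rewrite /lev; rauto.
  rewrite lev0 nexpS nexp0; split; apply/nq_le; rewrite ?nqD !nqS nq0; lra.
move=> s [/nq_le H1 /nq_lt H2]; rewrite levS; case: asboolP => H.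
  split=> //; apply/nq_lt; move: H2; rewrite (nexpS (nS (lev s))) nqD (nqS (nS s)).
  by have := nexp_gt (nS (lev s)); have := nq_ge0 (lev s); rewrite nqS; lra.
by split; [apply/nq_le; rewrite (nqS (nS s)); lra|exact/nltNge].
Qed.

Lemma lev_uniq s d :
  nle (nexp d) (nS s) -> nlt (nS s) (nexp (nS d)) -> lev s = d.
Proof.
move=> /nq_le H1 /nq_lt H2; have [/nq_le H3 /nq_lt H4] := lev_spec s.
apply: NNPP => Hn; have [H|H] := nle_total (lev s) d.
  have /nexp_le/nq_le : nle (nS (lev s)) d.
    by apply/nltNge => H'; apply/Hn/nle_anti.
  by lra.
have /nexp_le/nq_le : nle (nS d) (lev s).
  by apply/nltNge => H'; apply/Hn/nle_anti.
by lra.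
Qed.

Lemma lev_snoc s b : nle b (nS szero) -> lev (snocC s b) = nS (lev s).
Proof.
move=> /nq_le; rewrite nqS nq0 => Hb; have Hb0 := nq_ge0 b.
have [/nq_le H1 /nq_le H2] := lev_spec s.
apply: lev_uniq.
  by apply/nq_le; move: H1; rewrite /snocC nexpS !(nqS, nqD); lra.
by apply/nq_le; move: H2; rewrite /snocC (nexpS (nS _)) !(nqS, nqD); lra.
Qed.

(** The binary string with code [s] stands for the dyadic interval
    [[left s, left s + pw (lev s)]] because [s + 1] is [2 ^ lev s] plus the
    number with the binary expansion given by the string. *)
Definition left s : QM M := nq (nS s) * pw (lev s) - 1.

Lemma left_snoc s b : nle b (nS szero) ->
  left (snocC s b) = left s + nq b * pw (nS (lev s)).
Proof.
move=> Hb; rewrite /left lev_snoc // pwS /snocC !(nqS, nqD).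
by move: (nq s) (nq b) (pw _) => S B P; lra.
Qed.

(** The strings whose dyadic interval is not yet seen to lie in one interval of the cover. Only the
    intervals numbered below the length of the string are examined: this makes the tree decidable,
    and along a path every interval gets its turn. *)
Definition bad s := forall e, nlt e (lev s) ->
  ~ (lo e < left s /\ left s + pw (lev s) < hi e).

Definition badC : M one :=
  fn (fun s => if `[< bad s >] then nS szero else szero).

Lemma badE s : badC $ s = nS szero <-> bad s.
Proof.
rewrite /badC fnE; last by rewrite /bad /left /lev; rauto.
by case: asboolP => // H; split=> // /esym/succ_neq0.
Qed.

Lemma bad_parent s b : nle b (nS szero) -> bad (snocC s b) -> bad s.
Proof.
move=> Hb H e He [H1 H2]; apply: (H e).
  by rewrite lev_snoc //; apply/nlt_eqVlt; left.
rewrite left_snoc // lev_snoc // pwS; have := pw_gt0 (lev s).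
move/nq_le: Hb; rewrite nqS nq0; have := nq_ge0 b; move: H1 H2.
by move: (nq b) (left s) (pw _) => B L P; split; nra.
Qed.

Section Path.
Variable f : M one.
Hypothesis Hf : forall n, f $ n = szero \/ f $ n = nS szero.

Lemma path_bit n : nle (f $ n) (nS szero).
Proof. by case: (Hf n) => ->; apply/nq_le; rewrite nqS nq0; lra. Qed.

Lemma lev_path n : lev (nrestr f n) = n.
Proof.
move: n; apply: ind; first by rewrite /lev /nrestr /snocC; rauto.
  by rewrite nrestr0 lev0.
by move=> n IH; rewrite nrestrS lev_snoc ?IH //; apply: path_bit.
Qed.

Definition path_real : M one := coded (fun n => left (nrestr f n)).

Lemma path_realE n : rv path_real n = left (nrestr f n).
Proof.
by rewrite /rv /path_real codedE // /left /nrestr /lev /snocC; rauto.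
Qed.

Lemma path_realS n :
  rv path_real (nS n) = rv path_real n + nq (f $ n) * (pw n / 2).
Proof.
rewrite (path_realE (nS n)) nrestrS (left_snoc _ (path_bit n)).
by rewrite lev_path pwS -path_realE.
Qed.

Lemma path_step n i : rv path_real n <= rv path_real (nadd n i) /\
  rv path_real (nadd n i) + pw (nadd n i) <= rv path_real n + pw n.
Proof.
move: i; apply: ind; first by rauto.
  by rewrite nadd0; split; lra.
move=> i []; rewrite naddS path_realS pwS.
have /nq_le := path_bit (nadd n i); have := nq_ge0 (f $ nadd n i).
rewrite nqS nq0; have := pw_gt0 (nadd n i).
move: (nq _) (rv _ _) (rv _ _) (pw _) (pw _) => B L L' P P'.
by split; nra.
Qed.

Lemma path_isR : IsR path_real.
Proof.
move=> n i; have [H1 H2] := path_step n i.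
by have := pw_gt0 (nadd n i); rewrite distrC ger0_norm; lra.
Qed.

Lemma path_bounds n : 0 <= rv path_real n /\ rv path_real n + pw n <= 1.
Proof.
have [] := path_step szero n; rewrite nadd0l.
have -> : rv path_real szero = 0.
  by rewrite path_realE nrestr0 /left lev0 pw0 nqS nq0; lra.
by rewrite pw0; lra.
Qed.

Lemma path_in01 : In01 path_real.
Proof.
split; apply/leRP => n; have [H1 H2] := path_bounds n; have := pw_gt0 n;
  by rewrite rv_rrat ?qv_c0 ?qv_c1; lra.
Qed.

Lemma path_dyadic n : exists j, rv path_real n = nq j * pw n.
Proof.
have [H1 _] := lev_spec (nrestr f n); rewrite lev_path in H1.
exists (nsub (nS (nrestr f n)) (nexp n)).
by rewrite nqB // path_realE /left lev_path mulrBl pw_mul.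
Qed.
End Path.

(** The hypothesis concerns only reals whose [n]-th approximation is a multiple of [2^-n], as is the
    case for the left endpoints along a path. Such an approximation directly names a dyadic centre,
    as used in [cover_cont]. *)
Lemma heine_borel :
  (forall x, IsR x -> In01 x -> (forall n, exists j, rv x n = nq j * pw n) ->
     exists e n, lo e + (pw n + pw n) < rv x n /\
                 rv x n + (pw n + pw n) < hi e) ->
  exists L, forall j, nlt j (nexp L) -> exists e, nlt e L /\
    (lo e < nq j * pw L /\ nq (nS j) * pw L < hi e).
Proof.
move=> Hcov.
(* Otherwise the bad strings form an infinite tree, and an interval around the real of a path
   contains all late cells of that path. *)
have [L HL] : exists m, forall s, nle m s -> ~ bad s.
  apply: NNPP => HN; have [s|m|f [Hf Hbad]] := @wkl M badC.
  - rewrite !badE => -[]; apply: bad_parent; apply/nq_le; rewrite !nqS nq0; lra.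
  - apply: NNPP => Hm; apply: HN; exists m => s Hs Hb; apply: Hm.
    by exists s; split=> //; apply/badE.
  - have [e [n [H1 H2]]] := Hcov _ (path_isR Hf) (path_in01 Hf) (path_dyadic Hf).
    have Hc := real_close (path_isR Hf) (nle_addr n (nS e)).
    have /badE /(_ e) := Hbad (nadd n (nS e)).
    (* At length [n + e + 1] the interval [e] is examined. The cell starts within [2^-n] of the
       [n]-th approximation and has length at most [2^-n], so it fits into the margin [2 * 2^-n]. *)
    rewrite lev_path // -path_realE //; apply; first exact: nle_addl.
    have := pw_le (nle_addr n (nS e)).
    by move: Hc; rewrite ltr_norml => /andP[? ?]; split; lra.
exists L => j Hj.
(* The string of length [L] whose cell is the [j]-th one. *)
pose s := npred (nadd (nexp L) j).
have Es : nS s = nadd (nexp L) j.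
  apply: nq_predS; apply/nq_lt; rewrite nq0 nqD.
  by have := nexp_gt0 L; have := nq_ge0 j; lra.
have Els : lev s = L.
  apply: lev_uniq; rewrite Es //; apply/nq_lt; rewrite nexpS !nqD.
  by move/nq_lt: Hj; lra.
have El : left s = nq j * pw L.
  by rewrite /left Els Es nqD mulrDl pw_mul; lra.
have Hs : nle L s.
  apply/nq_le; have := nexp_gt L; have := nq_ge0 j.
  suff : nq L + 1 <= nq (nexp L) by move: (f_equal nq Es); rewrite nqS nqD; lra.
  by rewrite -nqS; apply/nq_le/nq_lt/nexp_gt.
have := HL s Hs; rewrite /bad Els El => Hb.
apply: NNPP => HN; apply: Hb => e He [H1 H2]; apply: HN; exists e; split=> //.
by split=> //; rewrite nqS mulrDl mul1r.
Qed.
End HeineBorel.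

(** * The covering *)

Section Cover.
Context {M : gmodel}.

Lemma rq2_element (h : NM M -> NM M -> QM M) : RQ2 h ->
  exists c : M (tN ⇒ tN ⇒ tN), forall i j, qv (c $ i $ j) = h i j.
Proof.
move=> [f [F HF] Ef]; exists F => i j.
by rewrite -(Ef (j, (i, tt))) -HF.
Qed.

(** The minimum with 1 keeps all these points in the unit interval, where alone the values of [Ψ]
    are under control. *)
Lemma dyadic_key : {c : M (tN ⇒ tN ⇒ tN) |
  forall h j, qv (c $ h $ j) = Num.min (nq j * pw h) 1}.
Proof. by apply: cid; apply: rq2_element; rauto. Qed.
Definition dyC := proj1_sig dyadic_key.

Lemma qv_dyC h j : qv (dyC $ h $ j) = Num.min (nq j * pw h) 1.
Proof. exact: (proj2_sig dyadic_key). Qed.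

Lemma in01_dyC h j : In01 (rrat (dyC $ h $ j)).
Proof.
apply/in01P; rewrite qv_dyC.
have : 0 <= nq j * pw h by rewrite mulr_ge0 ?nq_ge0 // ltW // pw_gt0.
by case: (lerP (nq j * pw h) 1) => H1 H2; apply/andP; split; lra.
Qed.

(** The two inequalities have different witnesses, but both persist with a gap, so a late index
    serves both. *)
Lemma between (x y z : M one) : IsR x -> IsR y -> IsR z -> InOpen x y z ->
  exists n, rv x n + (pw n + pw n) < rv z n /\ rv z n + (pw n + pw n) < rv y n.
Proof.
move=> Hx Hy Hz [].
move=> /(ltR_ev Hx Hz)[d [m [Hd H]]] /(ltR_ev Hz Hy)[d' [m' [Hd' H']]].
have [|k Hk] := @pw_small _ (Num.min d d' / 2).
  by case: (lerP d d'); lra.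
exists (nadd (nadd m m') k).
have Hm : nle m (nadd (nadd m m') k) by apply: nle_trans (nle_addr _ _).
have Hm' : nle m' (nadd (nadd m m') k).
  by apply: nle_trans (nle_addr _ _); apply: nle_addl.
have := H _ Hm; have := H' _ Hm'.
have := pw_le (nle_addl k (nadd m m')).
by move: Hk; case: (lerP d d') => *; split; lra.
Qed.

Variable Ψ : M (one ⇒ one).
Hypotheses (HΨ : Fun01 Ψ) (Hpos : Positive01 Ψ).
Variables c d : M one.

(** A code [e] stands for the interval [(lo e, hi e)]: the pair of [0] and [v]
    for the [v]-th of the intervals covering the null set, and the triple of
    [h > 0], [j] and [p] for the [p]-th rational approximation from within of
    the interval of [Ψ] around the dyadic rational [j / 2^h]. *)
Definition cen e := qv (dyC $ nfst e $ nfst (nsnd e)).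
Definition rad e :=
  rv (Ψ $ rrat (dyC $ nfst e $ nfst (nsnd e))) (nsnd (nsnd e)) -
  pw (nsnd (nsnd e)).
Definition lo e :=
  if `[< nfst e = szero >] then qv (c $ nsnd e) else cen e - rad e.
Definition hi e :=
  if `[< nfst e = szero >] then qv (d $ nsnd e) else cen e + rad e.

Lemma rq_lo : RQ1 lo.
Proof. by rewrite /lo /cen /rad; rauto. Qed.
Lemma rq_hi : RQ1 hi.
Proof. by rewrite /hi /cen /rad; rauto. Qed.

Lemma cover_null x : IsR x -> InUnion c d x -> exists e n,
  lo e + (pw n + pw n) < rv x n /\ rv x n + (pw n + pw n) < hi e.
Proof.
move=> Hx [v Hv]; have [n] := between (isR_rrat _) (isR_rrat _) Hx Hv.
rewrite !rv_rrat => Hn.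
exists (npair szero v), n; rewrite /lo /hi nfst_pair nsnd_pair.
by case: asboolP.
Qed.

(** Near [x], the values of [Ψ] exceed a fixed positive rational, hence the
    interval around a sufficiently close dyadic rational contains [x]. *)
Lemma cover_cont x : IsR x -> In01 x ->
  (forall n, exists j, rv x n = nq j * pw n) -> ContAt Ψ x -> exists e n,
  lo e + (pw n + pw n) < rv x n /\ rv x n + (pw n + pw n) < hi e.
Proof.
move=> Hx H01 Hdy Hc; have HR := HΨ.1 x Hx H01.
have [n0 Hn0] := Hpos Hx H01; rewrite rv_rrat qv_c0 in Hn0.
(* From the index [n0] on, the approximations of [Ψ $ x] exceed [2^-n0]. Continuity with half of
   this as tolerance keeps the values of [Ψ] near [x] above [2^-n0 / 2]. *)
have [ce Hce] := qv_surj (pw (nS n0)); rewrite pwS in Hce.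
have Hp0 := pw_gt0 n0.
have [|δ [Hδ [[n1 Hn1] HC]]] := Hc (rrat ce) (isR_rrat ce).
  apply: (@ev_ltR _ _ _ (pw n0 / 2) szero) => [|n _]; first by lra.
  by rewrite !rv_rrat qv_c0 Hce; lra.
rewrite rv_rrat qv_c0 in Hn1; have Hp1 := pw_gt0 n1.
(* The level must be positive since 0 marks the intervals for the null set. The centre will be
   within [3 * 2^-h] of [x], which has to be small compared with both [δ] and the lower bound for
   [Ψ]. *)
have [|h [Hh Hph]] := @pw_small_ge _ (Num.min (pw n1) (pw n0 / 2) / 16) (nS szero).
  by case: (lerP (pw n1) (pw n0 / 2)); lra.
have {Hph} [Hph1 Hph2] : pw h < pw n1 / 16 /\ pw h < pw n0 / 32.
  by move: Hph; case: (lerP (pw n1) (pw n0 / 2)) => *; split; lra.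
have [j Hj] := Hdy h; have Hph0 := pw_gt0 h.
set y := rrat (dyC $ h $ j).
pose q := qv (dyC $ h $ j); have Eq : qv (dyC $ h $ j) = q by [].
(* The centre is the approximation of [x] itself, or 1 if that approximation exceeds 1, which it
   does by at most [2 * 2^-h]. *)
have Hq : rv x h - (pw h + pw h) <= q <= rv x h.
  have := proj1 (leRP _ _) H01.2 h; rewrite rv_rrat qv_c1 /q qv_dyC -Hj.
  by case: (lerP (rv x h) 1) => *; apply/andP; split; lra.
have Hxq m : nle h m -> q - 3 * pw h < rv x m < q + 3 * pw h.
  move=> /(real_close Hx); rewrite ltr_norml => /andP[? ?].
  by case/andP: Hq => *; apply/andP; split; lra.
have Hy : IsR y by apply: isR_rrat.
have Hy01 : In01 y by apply: in01_dyC.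
have HRy := HΨ.1 y Hy Hy01.
have Hδn n : nle n1 n -> pw n1 < rv δ n.
  by move=> /(real_close Hδ); rewrite ltr_norml => /andP[? ?]; lra.
have HRn n : nle n0 n -> pw n0 < rv (Ψ $ x) n.
  by move=> /(real_close HR); rewrite ltr_norml => /andP[? ?]; lra.
have nleS (m n : NM M) : nle m n -> nle m (nS n).
  by move=> H; apply: nle_trans H _; rewrite nS_add.
have [|Hlow _] := HC y Hy Hy01.
  split; (apply: (@ev_ltR _ _ _ (pw n1 / 2) (nadd h n1)) => [|n Hn];
    first by lra).
    have /andP[_ H1] := Hxq (nS n) (nleS _ _ (nle_trans (nle_addr _ _) Hn)).
    have := Hδn (nS n) (nleS _ _ (nle_trans (nle_addl _ _) Hn)).
    by rewrite rv_rsub rv_rrat Eq; lra.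
  have /andP[H1 _] := Hxq (nS n) (nleS _ _ (nle_trans (nle_addr _ _) Hn)).
  have := Hδn (nS n) (nleS _ _ (nle_trans (nle_addl _ _) Hn)).
  by rewrite rv_radd rv_rrat Eq; lra.
have [d2 [m2 [Hd2 Hm2]]] := ltR_ev (isR_rsub HR (isR_rrat ce)) HRy Hlow.
(* The rational radius then exceeds [(1/2 - 1/8) * 2^-n0], while [x] is closer to the centre than
   [3/32 * 2^-n0]. *)
have [|p [Hp Hpp]] := @pw_small_ge _ (pw n0 / 8) (nadd m2 n0); first by lra.
have {}Hm2 := Hm2 p (nle_trans (nle_addr _ _) Hp).
rewrite rv_rsub rv_rrat Hce in Hm2.
have HR' := HRn (nS p) (nleS _ _ (nle_trans (nle_addl _ _) Hp)).
have [|n [Hn Hpn]] := @pw_small_ge _ (pw n0 / 64) h; first by lra.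
have /andP[H1 H2] := Hxq n Hn; have Hpn0 := pw_gt0 n.
exists (npair h (npair j p)), n; rewrite /lo /hi /cen /rad !(nfst_pair, nsnd_pair).
case: asboolP => [E|_]; first by rewrite E in Hh; case: (@nlt0 M szero).
by rewrite Eq -/y; split; lra.
Qed.
End Cover.

(** * Maxima of finitely many reals *)

Lemma max_lipschitz (R : realFieldType) (a b a' b' e : R) :
  `|a - a'| < e -> `|b - b'| < e -> `|Num.max a b - Num.max a' b'| < e.
Proof.
rewrite !ltr_norml => /andP[? ?] /andP[? ?].
by case: (lerP a b); case: (lerP a' b') => *; apply/andP; split; lra.
Qed.

Section Maxima.
Context {M : gmodel}.

Definition mxC : M (tN ⇒ one ⇒ tN ⇒ tN) :=
  fn (fun z => fn (fun f => fn (fun j =>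
    sR $ fn (fun s => fn (fun t => if qv t < qv (f $ s) then f $ s else t))
      $ z $ j))).

Lemma mxCE z f j : mxC $ z $ f $ j =
  sR $ fn (fun s => fn (fun t => if qv t < qv (f $ s) then f $ s else t)) $ z $ j.
Proof. by rewrite /mxC; do 3 (rewrite fnE; last by rauto). Qed.

Lemma mxC0 z f : mxC $ z $ f $ szero = z.
Proof. by rewrite mxCE sR0. Qed.

Lemma mxCS z f j :
  qv (mxC $ z $ f $ nS j) = Num.max (qv (mxC $ z $ f $ j)) (qv (f $ j)).
Proof.
rewrite !mxCE sRS; do 2 (rewrite fnE; last by rauto); rewrite /Order.max.
by case: ifP.
Qed.

Lemma mxC_ge0 z f j : qv z <= qv (mxC $ z $ f $ j).
Proof.
move: j; apply: ind; first by rauto.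
  by rewrite mxC0.
by move=> j IH; rewrite mxCS le_max IH.
Qed.

Lemma mxC_ge z f j s : nlt s j -> qv (f $ s) <= qv (mxC $ z $ f $ j).
Proof.
move: j s; apply: ind; first by rauto.
  by move=> s /nlt0.
move=> j IH s; rewrite mxCS le_max => /nlt_eqVlt[/IH ->//|->].
by rewrite lexx orbT.
Qed.

Lemma mxC_le z f j t : qv z <= t -> (forall s, nlt s j -> qv (f $ s) <= t) ->
  qv (mxC $ z $ f $ j) <= t.
Proof.
move=> Hz Hf; suff H : forall k, nle k j -> qv (mxC $ z $ f $ k) <= t.
  exact: H (nle_refl j).
apply: ind; first by rauto.
  by rewrite mxC0.
move=> k IH Hk; rewrite mxCS ge_max Hf // andbT; apply: IH.
by apply: nle_trans Hk; rewrite nS_add; apply: nle_addr.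
Qed.

Lemma mxC_lip z f z' f' e j : `|qv z - qv z'| < e ->
  (forall s, nlt s j -> `|qv (f $ s) - qv (f' $ s)| < e) ->
  `|qv (mxC $ z $ f $ j) - qv (mxC $ z' $ f' $ j)| < e.
Proof.
move=> Hz Hf; suff H : forall k, nle k j ->
    `|qv (mxC $ z $ f $ k) - qv (mxC $ z' $ f' $ k)| < e.
  exact: H (nle_refl j).
apply: ind; first by rauto.
  by rewrite !mxC0.
move=> k IH Hk; rewrite !mxCS; apply: max_lipschitz; last exact: Hf.
by apply: IH; apply: nle_trans Hk; rewrite nS_add; apply: nle_addr.
Qed.
#[global] Opaque mxC.

(** The maximum of [x] and the first [j] terms of [u], formed approximation by approximation. No
    reals are compared, and the result converges as fast as its arguments because the maximum is
    1-Lipschitz. *)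
Definition mxR (x : M one) (u : M (tN ⇒ one)) (j : NM M) : M one :=
  fn (fun n => mxC $ (x $ n) $ fn (fun s => u $ s $ n) $ j).

Lemma rv_mxR x u j n :
  rv (mxR x u j) n = qv (mxC $ (x $ n) $ fn (fun s => u $ s $ n) $ j).
Proof. by rewrite /rv /mxR fnE //; rauto. Qed.

Lemma mxR_isR x u j : IsR x -> (forall s, nlt s j -> IsR (u $ s)) ->
  IsR (mxR x u j).
Proof.
move=> Hx Hu n i; rewrite !rv_mxR; apply: mxC_lip; first exact: Hx.
by move=> s Hs; do 2 (rewrite fnE; last by rauto); apply: Hu.
Qed.

Lemma mxR_ge0 x u j : LeR x (mxR x u j).
Proof.
apply/leRP => n; rewrite rv_mxR.
by have := mxC_ge0 (x $ n) (fn (fun s => u $ s $ n)) j; have := pw_gt0 n;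
  rewrite /rv; lra.
Qed.

Lemma mxR_ge x u j s : nlt s j -> LeR (u $ s) (mxR x u j).
Proof.
move=> Hs; apply/leRP => n; rewrite rv_mxR.
have := mxC_ge (x $ n) (fn (fun s => u $ s $ n)) Hs.
by rewrite fnE; [have := pw_gt0 n; rewrite /rv; lra|rauto].
Qed.

Lemma mxR_le x u j z : LeR x z -> (forall s, nlt s j -> LeR (u $ s) z) ->
  LeR (mxR x u j) z.
Proof.
move=> /leRP Hx Hu; apply/leRP => n; rewrite rv_mxR; apply: mxC_le.
  exact: Hx.
by move=> s Hs; rewrite fnE; [have /leRP := Hu s Hs; apply|rauto].
Qed.

Lemma isR_ropp (x : M one) : IsR x -> IsR (ropp x).
Proof.
by move=> Hx n i; rewrite !rv_ropp -opprD normrN; apply: Hx.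
Qed.

Lemma leR_opp (x y : M one) : LeR (ropp x) (ropp y) <-> LeR y x.
Proof.
by rewrite !leRP; split=> H n; have := H n; rewrite ?rv_ropp; lra.
Qed.

Lemma leR_oppl (x y : M one) : LeR (ropp x) y <-> LeR (ropp y) x.
Proof.
by rewrite !leRP; split=> H n; have := H n; rewrite ?rv_ropp; lra.
Qed.

Lemma leR_oppr (x y : M one) : LeR x (ropp y) <-> LeR y (ropp x).
Proof.
by rewrite !leRP; split=> H n; have := H n; rewrite ?rv_ropp; lra.
Qed.
End Maxima.

(** * Dividing the sets [J] into ordered intervals *)

Section Pieces.
Context {M : gmodel}.
Variables (y l r : M (tN ⇒ one)) (K : NM M).
Hypotheses (Hl : forall i, nle i K -> IsR (l $ i))
  (Hr : forall i, nle i K -> IsR (r $ i))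
  (Hy : forall i, nle i K -> IsR (y $ i))
  (Hly : forall i, nle i K -> LtR (l $ i) (y $ i))
  (Hyr : forall i, nle i K -> LtR (y $ i) (r $ i))
  (Hyy : forall i j, nlt i j -> nle j K -> LtR (y $ i) (y $ j)).

(** As [y] is increasing, the parts of the [i]-th interval outside the earlier
    ones are the [[pa i j, pg i j]] for [j <= i]: beyond the first [j] intervals
    and before the later ones. Truncating with [pb] makes the empty ones
    degenerate, and no real numbers have to be compared. *)
Definition lower j i : M (tN ⇒ one) := fn (fun s => fn (fun n =>
  if `[< nle j s >] then copp (l $ s $ n) else copp (r $ i $ n))).
Definition pa i j : M one := mxR (l $ i) r j.
(** The minimum of [r $ i] and the [l $ s] for [j <= s < i], as a maximum of negatives; [lower] pads
    the indices below [j] with [r $ i]. *)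
Definition pg i j : M one := ropp (mxR (ropp (r $ i)) (lower j i) i).
Definition pb i j : M one := mxR (pa i j) (fn (fun _ => pg i j)) (nS szero).

Definition inGap i z := InOpen (l $ i) (r $ i) z /\
  ~ exists s, nlt s i /\ InOpen (l $ s) (r $ s) z.

Lemma nlt_le (i j : NM M) : nlt i j -> nle i j.
Proof. by apply: nle_trans; rewrite nS_add; apply: nle_addr. Qed.

Lemma lowerE j i s : lower j i $ s =
  if pselect (nle j s) then ropp (l $ s) else ropp (r $ i).
Proof.
apply: sap_ext => n; rewrite /lower fnE; last by rauto.
rewrite fnE; last by rauto.
by case: asboolP; case: pselect => // *; rewrite /ropp fnE //; rauto.
Qed.

Section Fixed.
Variable i : NM M.
Hypothesis Hi : nle i K.

Lemma ltK s : nlt s i -> nle s K.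
Proof. by move=> /nlt_le Hs; apply: nle_trans Hs Hi. Qed.

Lemma lower_isR j s : nlt s i -> IsR (lower j i $ s).
Proof.
move=> /ltK Hs; rewrite lowerE; case: pselect => H; apply: isR_ropp; auto.
Qed.

Lemma pa_isR j : nle j i -> IsR (pa i j).
Proof.
move=> Hj; apply: mxR_isR; first exact: Hl.
by move=> s Hs; apply/Hr/ltK; apply: nle_trans Hs Hj.
Qed.

Lemma pg_isR j : IsR (pg i j).
Proof.
by apply/isR_ropp/mxR_isR; [apply/isR_ropp/Hr|apply: lower_isR].
Qed.

Lemma const_seqE (x : M one) s : fn (fun _ : NM M => x) $ s = x.
Proof. by rewrite fnE //; rauto. Qed.

Lemma pb_isR j : nle j i -> IsR (pb i j).
Proof.
move=> Hj; apply: mxR_isR; first exact: pa_isR.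
by move=> s _; rewrite const_seqE; apply: pg_isR.
Qed.

Lemma pg_le_r j : LeR (pg i j) (r $ i).
Proof. by apply/leR_oppl/mxR_ge0. Qed.

Lemma pg_le_l j s : nle j s -> nlt s i -> LeR (pg i j) (l $ s).
Proof.
move=> Hj Hs; apply/leR_oppl; have := @mxR_ge M (ropp (r $ i)) (lower j i) i s Hs.
by rewrite lowerE; case: pselect.
Qed.

Lemma pg_ge j z : LeR z (r $ i) ->
  (forall s, nle j s -> nlt s i -> LeR z (l $ s)) -> LeR z (pg i j).
Proof.
move=> Hz Hs; apply/leR_oppr/mxR_le; first exact/leR_opp.
by move=> s H; rewrite lowerE; case: pselect => *; apply/leR_opp => //; apply: Hs.
Qed.

Lemma pa_le_pb j : LeR (pa i j) (pb i j).
Proof. exact: mxR_ge0. Qed.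

Lemma pg_le_pb j : LeR (pg i j) (pb i j).
Proof.
have := @mxR_ge M (pa i j) (fn (fun _ => pg i j)) (nS szero) szero (nle_refl _).
by rewrite const_seqE.
Qed.

Lemma pb_le j z : LeR (pa i j) z -> LeR (pg i j) z -> LeR (pb i j) z.
Proof.
by move=> H1 H2; apply: mxR_le => // s _; rewrite const_seqE.
Qed.

(** The left end [pa i j] grows with [j], and [pg i j <= l $ j < r $ j <= pa i (nS j)]. *)
Lemma pieces_ordered j : nlt j i -> LeR (pb i j) (pa i (nS j)).
Proof.
move=> Hj; have HjK := ltK Hj.
have Hra : LeR (r $ j) (pa i (nS j)) by apply: mxR_ge; apply: nle_refl.
apply: pb_le; first apply: mxR_le; first exact: mxR_ge0.
  move=> s Hs; apply: mxR_ge; apply: nle_trans Hs _.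
  by rewrite nS_add; apply: nle_addr.
apply: (@leR_trans _ _ (l $ j)); auto using pg_isR, pa_isR, pg_le_l, nle_refl.
apply: (@leR_trans _ _ (r $ j)); auto using pa_isR.
by apply: ltRW; auto; apply: (@ltR_trans _ _ (y $ j)); auto.
Qed.

(** Let [j] be least with [z < r $ j]. For [j <= s < i], either [z < r $ s], and [z <= l $ s]
    because [z] is outside the [s]-th interval, or [j < s] and [r $ s <= z]. In the latter case
    [l $ j < y $ j < y $ s < z < r $ j], so [z] is in the [j]-th interval, which is excluded. Here
    the centres have to increase. *)
Lemma gap_piece z : IsR z -> inGap i z ->
  exists j, nle j i /\ (LeR (pa i j) z /\ LeR z (pg i j)).
Proof.
move=> Hz [[Hlz Hzr] Hn]; have [k0 Hk0] := Hzr.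
have [||j [k Hj] Hmin] := @least_S1 M
  (fun s k => rv z k + (pw k + pw k) < rv (r $ s) k) _ i k0;
  [by rewrite /Dec2; rauto|by []|].
have {k Hj} Hzj : LtR z (r $ j) by exists k.
have {}Hmin s : nlt s j -> LeR (r $ s) z.
  by move=> Hs [k Hk]; apply: (Hmin s Hs k).
have Hji : nle j i.
  by apply: NNPP => /nltNge /Hmin; apply.
have HjK := nle_trans Hji Hi.
have Hnot s : nlt s i -> LtR z (r $ s) -> LeR z (l $ s).
  by move=> Hs Hzs Hls; apply: Hn; exists s.
exists j; split=> //; split.
  apply: mxR_le; first by apply: ltRW; auto.
  by move=> s Hs; apply: Hmin.
apply: pg_ge; first by apply: ltRW; auto.
move=> s Hjs Hs; have HsK := ltK Hs; apply: (Hnot s) => //; apply: NNPP => Hzs.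
have Hjs' : nlt j s.
  by apply/nltNge => H; apply: Hzs; rewrite (nle_anti H Hjs).
apply: (Hnot j) => //; first by apply: nle_trans (nlt_le Hs); apply: nle_trans Hjs' _.
apply: (@ltR_trans _ _ (y $ j)); auto.
apply: (@ltR_trans _ _ (y $ s)); auto.
by apply: (@ltR_leR_trans _ _ (r $ s)); auto.
Qed.

Lemma piece_gap z j :
  IsR z -> nle j i -> InOpen (pa i j) (pb i j) z -> inGap i z.
Proof.
move=> Hz Hj [Haz Hzb].
have Ha := pa_isR Hj; have Hg := pg_isR j; have Hb := pb_isR Hj.
(* Between [pa] and [pb] the piece is not degenerate: if [z] is not below [pg], it is above both
   terms of the maximum [pb]. *)
have Hzg : LtR z (pg i j).
  apply: NNPP => Hzg; apply: (pb_le (z := z) (j := j) _ _ Hzb) => //.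
  by apply: ltRW.
split; first split.
- by apply: (@leR_ltR_trans _ _ (pa i j)); auto; apply: mxR_ge0.
- by apply: (@ltR_leR_trans _ _ (pg i j)); auto; apply: pg_le_r.
- move=> [s [Hs [Hls Hsr]]]; have HsK := ltK Hs.
  case: (pselect (nle j s)) => [Hjs|/nltNge Hsj].
    apply: (@ltR_irr _ z); apply: (@ltR_trans _ _ (l $ s)); auto.
    by apply: (@ltR_leR_trans _ _ (pg i j)); auto; apply: pg_le_l.
  apply: (@ltR_irr _ z); apply: (@ltR_trans _ _ (r $ s)); auto.
  by apply: (@leR_ltR_trans _ _ (pa i j)); auto; apply: mxR_ge.
Qed.

Lemma gapP z : IsR z ->
  (forall j, nlt j (nS i) -> ~ EqR z (pa i j) /\ ~ EqR z (pb i j)) ->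
  inGap i z <-> exists j, nlt j (nS i) /\ InOpen (pa i j) (pb i j) z.
Proof.
move=> Hz HE; split=> [/(gap_piece Hz)[j [Hj [H1 H2]]]|[j [/nltS Hj]]];
  last exact: piece_gap.
have Hj' : nlt j (nS i) by apply/nltS.
have [E1 E2] := HE j Hj'; exists j; split=> //; split.
  by apply: leR_neq => // /EqR_sym.
apply: leR_neq => //; apply: (@leR_trans _ _ (pg i j)); auto using pg_isR, pb_isR.
exact: pg_le_pb.
Qed.
End Fixed.

(** The endpoints must be sequences of the model, uniformly in [i], both for [LengthIs] and for the
    sequence of lengths. *)
Lemma pieces_rep : exists a b : M (tN ⇒ tN ⇒ one),
  forall i j, a $ i $ j = pa i j /\ b $ i $ j = pb i j.
Proof.
exists (fn (fun i => fn (fun j => pa i j))), (fn (fun i => fn (fun j => pb i j))).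
move=> i j; split.
  rewrite (@fnE _ _ _ (fun i => fn (fun j => pa i j))); last first.
    by rewrite /pa /mxR; rauto.
  by rewrite (@fnE _ _ _ (pa i)) // /pa /mxR; rauto.
rewrite (@fnE _ _ _ (fun i => fn (fun j => pb i j))); last first.
  by rewrite /pb /pg /pa /mxR /lower; rauto.
by rewrite (@fnE _ _ _ (pb i)) // /pb /pg /pa /mxR /lower; rauto.
Qed.
End Pieces.

(** * Lengths *)

Section Overlap.
Context {R : realFieldType}.
Implicit Types a b x h : R.

(** The length of [[a, b] ∩ (-oo, x]]. *)
Definition overlap a b x := Num.max 0 (Num.min x b - a).

Lemma overlap_mono a b x h : 0 <= h -> overlap a b x <= overlap a b (x + h).
Proof.
move=> Hh; rewrite /overlap; case: (lerP x b); case: (lerP (x + h) b) => *;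
  rewrite ge_max !le_max lexx /=; apply/orP; right; lra.
Qed.

Lemma overlap_step a b x h : 0 <= h -> a <= x -> x + h <= b ->
  overlap a b x + h <= overlap a b (x + h).
Proof.
move=> Hh Hx Hb; rewrite /overlap (min_l Hb) min_l; last by lra.
rewrite max_r ?max_r; lra.
Qed.

Lemma overlap_le a b x : a <= b -> overlap a b x <= b - a.
Proof.
move=> Hab; rewrite /overlap ge_max; apply/andP; split; first by lra.
by case: (lerP x b) => *; lra.
Qed.

Lemma overlap_ge0 a b x : 0 <= overlap a b x.
Proof. by rewrite /overlap le_max lexx. Qed.
End Overlap.

(** * Finite sums and the counting of grid cells *)

Section Sums.
Context {M : gmodel}.
Implicit Types h g : NM M -> QM M.

Lemma nleS (n : NM M) : nle n (nS n).
Proof. by rewrite nS_add; apply: nle_addr. Qed.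

Lemma qsum_addc h n (d : QM M) : RQ1 h ->
  qsum (fun j => h j + d) n = qsum h n + nq n * d.
Proof.
move=> Hh; have Hd : RQ1 (fun j => h j + d) by rauto.
move: n; apply: ind; first by rauto.
  by rewrite !qsum0 nq0 mul0r addr0.
move=> n IH; rewrite !qsumS // IH nqS mulrDl mul1r.
by move: (qsum _ _) (h n) (_ * _) => *; lra.
Qed.

Lemma qsum_close h g n d : RQ1 h -> RQ1 g ->
  (forall j, nlt j n -> `|h j - g j| <= d) -> `|qsum h n - qsum g n| <= nq n * d.
Proof.
move=> Hh Hg H; rewrite ler_norml.
have H1 : qsum h n <= qsum g n + nq n * d.
  rewrite -qsum_addc //; apply: ler_qsum => //; first by rauto.
  by move=> j /H; rewrite ler_norml => /andP[? ?]; lra.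
have H2 : qsum g n <= qsum h n + nq n * d.
  rewrite -qsum_addc //; apply: ler_qsum => //; first by rauto.
  by move=> j /H; rewrite ler_norml => /andP[? ?]; lra.
by apply/andP; split; lra.
Qed.

Lemma qsum_step h g n j0 d : RQ1 h -> RQ1 g ->
  (forall j, nlt j n -> h j <= g j) -> nlt j0 n -> h j0 + d <= g j0 ->
  qsum h n + d <= qsum g n.
Proof.
move=> Hh Hg H Hj0 Hd.
have : forall k, nle k n ->
    qsum h k + (if `[< nlt j0 k >] then d else 0) <= qsum g k.
  apply: ind; first by rauto.
    by rewrite !qsum0; case: asboolP => [/nlt0//|_]; rewrite addr0.
  move=> k IH Hk; rewrite !qsumS //.
  have {}IH := IH (nle_trans (nleS k) Hk); have Hhk := H k Hk.
  case: asboolP => [/nlt_eqVlt[Hlt|E]|Hn]; move: IH; case: asboolP => H'.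
  - by move: (qsum h k) (qsum g k) => *; lra.
  - by [].
  - by rewrite E in H'; case: (proj1 (nltNge _ _) H').
  - by rewrite -E in Hhk *; move: (qsum h j0) (qsum g j0) => *; lra.
  - by case: Hn; apply/nlt_eqVlt; left.
  - by move: (qsum h k) (qsum g k) => *; lra.
by move/(_ n (nle_refl n)); case: asboolP.
Qed.

(** With summands evaluated at [k + n], the total error is at most [n * 2^-(k + n)], which is below
    [2^-k] since [n < 2^n]. *)
Lemma rsum_isR (x : M (tN ⇒ one)) n : (forall j, nlt j n -> IsR (x $ j)) ->
  IsR (rsum x n).
Proof.
move=> Hx k i; rewrite !rv_rsum; set h := fun _ => _; set g := fun _ => _.
have H : `|qsum h n - qsum g n| <= nq n * pw (nadd k n).
  apply: qsum_close; [by rewrite /h; rauto|by rewrite /g; rauto|move=> j /Hx Hj].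
  apply/ltW/real_close => //; apply/nq_le; rewrite !nqD; have := nq_ge0 i; lra.
apply: le_lt_trans H _; rewrite pwD mulrCA -[ltRHS]mulr1 ltr_pM2l ?pw_gt0 //.
by rewrite -(pw_mul n) ltr_pM2r ?pw_gt0 // nexp_gt.
Qed.

(** As the grid point [g / 2^w] moves from [0] to [1], the total overlap of the
    intervals with [(-oo, g / 2^w]] grows by at least [1 / 2^w] in each step. *)
Lemma sweep (c d : NM M -> QM M) (a b : NM M -> NM M -> QM M)
  (L K w : NM M) :
  RQ1 c -> RQ1 d -> RQ2 a -> RQ2 b ->
  (forall v, c v <= d v) ->
  (forall i j, nlt i K -> nlt j (nS i) -> a i j <= b i j) ->
  (forall g : NM M, nlt g (nexp w) ->
     (exists v, nlt v L /\ c v <= nq g * pw w <= d v) \/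
     (exists i j, nlt i K /\ (nlt j (nS i) /\ a i j <= nq g * pw w <= b i j))) ->
  1 <= qsum (fun v => d v - c v + pw w) L +
       qsum (fun i => qsum (fun j => b i j - a i j + pw w) (nS i)) K.
Proof.
move=> Hc Hd Ha Hb Hcd Hab Hcov; have Hw := pw_gt0 w.
(* Each interval is prolonged by one cell to the right: a grid point in the interval then puts the
   whole next cell into the prolonged one. This is the source of the summands [pw w] in the
   conclusion. *)
pose f (g : NM M) v := overlap (c v) (d v + pw w) (nq g * pw w).
pose h (g : NM M) i j := overlap (a i j) (b i j + pw w) (nq g * pw w).
pose h' (g : NM M) i := qsum (h g i) (nS i).
have Hf : RQ2 f by rewrite /f /overlap; rauto.
have Hf1 (g : NM M) : RQ1 (f g) by rewrite /f /overlap; rauto.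
have Hh (g : NM M) i : RQ1 (h g i) by rewrite /h /overlap; rauto.
have Hh' : RQ2 h' by rewrite /h' /h /overlap; rauto.
have h'E (g : NM M) i : h' g i = qsum (h g i) (nS i) by [].
have Eg (g : NM M) : nq (nS g) * pw w = nq g * pw w + pw w.
  by rewrite nqS mulrDl mul1r.
have f0 (g : NM M) v : 0 <= f g v by apply: overlap_ge0.
have h0 (g : NM M) i j : 0 <= h g i j by apply: overlap_ge0.
have fS (g : NM M) v : f g v <= f (nS g) v.
  by rewrite /f Eg; apply: overlap_mono; apply: ltW.
have hS (g : NM M) i j : h g i j <= h (nS g) i j.
  by rewrite /h Eg; apply: overlap_mono; apply: ltW.
have f1 (g : NM M) v : c v <= nq g * pw w <= d v -> f g v + pw w <= f (nS g) v.
  move=> /andP[H1 H2]; rewrite /f Eg.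
  by apply: overlap_step; [exact: ltW|exact: H1|rewrite lerD2r].
have h1 (g : NM M) i j : a i j <= nq g * pw w <= b i j ->
    h g i j + pw w <= h (nS g) i j.
  move=> /andP[H1 H2]; rewrite /h Eg.
  by apply: overlap_step; [exact: ltW|exact: H1|rewrite lerD2r].
have fle (g : NM M) v : f g v <= d v - c v + pw w.
  rewrite /f; apply: le_trans (overlap_le _ _) _; have := Hcd v; lra.
have hle (g : NM M) i j : nlt i K -> nlt j (nS i) ->
    h g i j <= b i j - a i j + pw w.
  move=> Hi Hj; rewrite /h; apply: le_trans (overlap_le _ _) _;
    have := Hab i j Hi Hj; lra.
clearbody h' f h.
have Hh1 (g : NM M) : RQ1 (h' g) by rauto.
have h'S (g : NM M) i : h' g i <= h' (nS g) i.
  rewrite !h'E; exact: (ler_qsum (Hh g i) (Hh (nS g) i) (fun j _ => hS g i j)).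
have h'0 (g : NM M) i : 0 <= h' g i.
  by rewrite h'E -(qsum0 (h g i)); exact: (qsum_le (Hh g i) (h0 g i) (nle0 _)).
have H : forall g : NM M, nle g (nexp w) ->
    nq g * pw w <= qsum (f g) L + qsum (h' g) K.
  apply: ind; first by rauto.
    move=> _; rewrite nq0 mul0r.
    have := qsum_le (Hf1 szero) (f0 szero) (nle0 L).
    have := qsum_le (Hh1 szero) (h'0 szero) (nle0 K).
    by rewrite !qsum0; move: (qsum _ _) (qsum _ _) => *; lra.
  move=> g IH Hg; have {}IH := IH (nle_trans (nleS g) Hg).
  rewrite Eg.
  have Hf2 := ler_qsum (Hf1 g) (Hf1 (nS g)) (fun v (_ : nlt v L) => fS g v).
  have Hh2 := ler_qsum (Hh1 g) (Hh1 (nS g)) (fun i (_ : nlt i K) => h'S g i).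
  case: (Hcov g Hg) => [[v [Hv Hv1]]|[i [j [Hi [Hj Hj1]]]]].
    have := qsum_step (Hf1 g) (Hf1 (nS g)) (fun v _ => fS g v) Hv (f1 g v Hv1).
    by move: IH Hf2 Hh2; move: (qsum _ _) (qsum _ _) (qsum _ _) (qsum _ _) => *; lra.
  have := qsum_step (Hh g i) (Hh (nS g) i) (fun j _ => hS g i j) Hj (h1 g i j Hj1).
  rewrite -!h'E.
  move/(qsum_step (Hh1 g) (Hh1 (nS g)) (fun i _ => h'S g i) Hi).
  by move: IH Hf2 Hh2; move: (qsum _ _) (qsum _ _) (qsum _ _) (qsum _ _) => *; lra.
have := H (nexp w) (nle_refl _); rewrite pw_mul => /le_trans; apply; apply: lerD.
  by apply: ler_qsum; [exact: Hf1|rauto|move=> v _; exact: fle].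
apply: ler_qsum; [exact: Hh1|rauto|move=> i Hi; rewrite h'E].
apply: ler_qsum; [exact: Hh|rauto|move=> j Hj; exact: hle].
Qed.
End Sums.

(** * Covering the grid by the pieces *)

Section GridPoints.
Context {M : gmodel}.

Lemma EqR_leR (x y : M one) : EqR x y -> LeR x y.
Proof.
move=> H; apply/leRP => n; have := H n.
by rewrite ler_norml => /andP[? ?]; lra.
Qed.

(** If no cell contained [x], induction along the grid would give [1 <= x]. *)
Lemma dyadic_cell (x : QM M) L : 0 <= x -> x < 1 ->
  exists j, nlt j (nexp L) /\ nq j * pw L <= x <= nq (nS j) * pw L.
Proof.
move=> H0 H1; apply: NNPP => HN.
have H : forall j, nle j (nexp L) -> nq j * pw L <= x.
  apply: ind; first by rauto.
    by rewrite nq0 mul0r.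
  move=> j IH Hj; have {}IH := IH (nle_trans (nleS j) Hj).
  rewrite leNgt; apply/negP => Hx; apply: HN; exists j; split=> //.
  by rewrite IH ltW.
by have := H _ (nle_refl _); rewrite pw_mul; lra.
Qed.

(** Every centre of a level up to [L], also one truncated to 1, is among the points of level [L]. *)
Lemma dyadic_refine u j L : nle u L ->
  exists i, nle i (nexp L) /\ qv (@dyC M $ L $ i) = qv (@dyC M $ u $ j).
Proof.
move=> /nleP[k ->]; rewrite qv_dyC.
have H1 : nq (nexp (nadd u k)) * pw (nadd u k) = 1 by rewrite pw_mul.
case: (lerP (nq j * pw u) 1) => H.
  exists (nmul j (nexp k)).
  have E : nq (nmul j (nexp k)) * pw (nadd u k) = nq j * pw u.
    by rewrite nqM pwD mulrACA pw_mul mulr1.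
  split; last by rewrite qv_dyC E min_l.
  apply/nq_le; rewrite -(ler_pM2r (pw_gt0 (nadd u k))) E H1.
  by [].
exists (nexp (nadd u k)); split; first exact: nle_refl.
by rewrite qv_dyC H1 minxx.
Qed.

Variable Ψ : M (one ⇒ one).
Hypotheses (HΨ : Fun01 Ψ) (Hpos : Positive01 Ψ).
Variables c d : M one.
Variable L : NM M.
Hypothesis HL : forall j, nlt j (nexp L) -> exists e, nlt e L /\
  (lo Ψ c e < nq j * pw L /\ nq (nS j) * pw L < hi Ψ d e).

Let K := nexp L.
Definition ypt : M (tN ⇒ one) := fn (fun i => rrat (dyC $ L $ i)).
Definition lpt : M (tN ⇒ one) := fn (fun i => rsub (ypt $ i) (Ψ $ (ypt $ i))).
Definition rpt : M (tN ⇒ one) := fn (fun i => radd (ypt $ i) (Ψ $ (ypt $ i))).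

Lemma yptE i : ypt $ i = rrat (dyC $ L $ i).
Proof. by rewrite /ypt fnE //; rauto. Qed.
Lemma lptE i : lpt $ i = rsub (ypt $ i) (Ψ $ (ypt $ i)).
Proof. by rewrite /lpt fnE //; rauto. Qed.
Lemma rptE i : rpt $ i = radd (ypt $ i) (Ψ $ (ypt $ i)).
Proof. by rewrite /rpt fnE //; rauto. Qed.

Lemma ypt_isR i : IsR (ypt $ i).
Proof. by rewrite yptE; apply: isR_rrat. Qed.
Lemma ypt_in01 i : In01 (ypt $ i).
Proof. by rewrite yptE; apply: in01_dyC. Qed.
Lemma Ψpt_isR i : IsR (Ψ $ (ypt $ i)).
Proof. by apply: HΨ.1; [apply: ypt_isR|apply: ypt_in01]. Qed.
Lemma lpt_isR i : IsR (lpt $ i).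
Proof. by rewrite lptE; apply: isR_rsub; [apply: ypt_isR|apply: Ψpt_isR]. Qed.
Lemma rpt_isR i : IsR (rpt $ i).
Proof. by rewrite rptE; apply: isR_radd; [apply: ypt_isR|apply: Ψpt_isR]. Qed.

Lemma Ψpt_gt0 i :
  exists q m, 0 < q /\ forall n, nle m n -> q < rv (Ψ $ (ypt $ i)) n.
Proof.
have [q [m [Hq H]]] :=
  ltR_ev (isR_rrat c0) (Ψpt_isR i) (Hpos (ypt_isR i) (ypt_in01 i)).
by exists q, m; split=> // n /H; rewrite rv_rrat qv_c0 add0r.
Qed.

Lemma lpt_lt i : LtR (lpt $ i) (ypt $ i).
Proof.
have [q [m [Hq H]]] := Ψpt_gt0 i; apply: (@ev_ltR _ _ _ q m) => // n Hn.
have := H (nS n) (nle_trans Hn (nleS n)).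
by rewrite lptE rv_rsub yptE !rv_rrat; lra.
Qed.

Lemma rpt_gt i : LtR (ypt $ i) (rpt $ i).
Proof.
have [q [m [Hq H]]] := Ψpt_gt0 i; apply: (@ev_ltR _ _ _ q m) => // n Hn.
have := H (nS n) (nle_trans Hn (nleS n)).
by rewrite rptE rv_radd yptE !rv_rrat; lra.
Qed.

Lemma ypt_lt i j : nlt i j -> nle j K -> LtR (ypt $ i) (ypt $ j).
Proof.
move=> /nq_le Hij /nq_le HjK; have Hw := pw_gt0 L; rewrite nqS in Hij.
apply: (@ev_ltR _ _ _ (pw L) szero) => // n _; rewrite !yptE !rv_rrat !qv_dyC.
have Hj1 : nq j * pw L <= 1 by rewrite -(pw_mul L) ler_pM2r.
have Hij1 : nq i * pw L + pw L <= nq j * pw L.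
  by rewrite -[X in _ + X]mul1r -mulrDl ler_pM2r.
by rewrite (min_l Hj1) min_l //; lra.
Qed.

Lemma grid_cover (x : QM M) : 0 <= x -> x < 1 ->
  (exists v, nlt v L /\ qv (c $ v) <= x <= qv (d $ v)) \/
  (exists i z, nle i K /\ (qv z = x /\ InOpen (lpt $ i) (rpt $ i) (rrat z))).
Proof.
move=> H0 H1; have [j [Hj /andP[Hx1 Hx2]]] := dyadic_cell L H0 H1.
have [e [He [Hlo Hhi]]] := HL Hj; move: Hlo Hhi; rewrite /lo /hi.
case: asboolP => [_|_] Hlo Hhi.
  (* The components of a pair do not exceed its code, so the bound [L] for [e] passes to the index
     here and to the level below. *)
  left; exists (nsnd e); split; last by apply/andP; split; lra.
  apply: nle_trans He; move/nq_le: (nsnd_le e) => H; apply/nq_le.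
  by rewrite !nqS; lra.
right; have Hu : nle (nfst e) L by apply: nle_trans (nfst_le e) (nlt_le He).
have [i [Hi Ei]] := dyadic_refine (nfst (nsnd e)) Hu.
have [z Ez] := qv_surj x; exists i, z; split=> //; split=> //.
move: Hlo Hhi; rewrite /cen /rad -Ei.
set q := rrat (dyC $ nfst e $ _); set p := nsnd (nsnd e) => Hlo Hhi.
have Hq : IsR q by apply: isR_rrat.
have Hq01 : In01 q by apply: in01_dyC.
have HΨq : IsR (Ψ $ q) by apply: HΨ.1.
(* The two centres are equal rationals with possibly different codes, so [Ψ] has to respect equality
   of reals. *)
have HE : EqR (Ψ $ q) (Ψ $ (ypt $ i)).
  apply: HΨ.2 => //; [exact: ypt_isR|exact: ypt_in01|].
  by rewrite yptE; apply: EqR_rrat.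
pose t := rv (Ψ $ q) p - pw p.
(* The distance of [x] from the nearer end of the rational interval; it absorbs the error in
   approximating [Ψ]. *)
pose s := Num.min (x - (qv (dyC $ L $ i) - t)) (qv (dyC $ L $ i) + t - x).
have Hs : 0 < s /\ qv (dyC $ L $ i) - t + s <= x /\ x <= qv (dyC $ L $ i) + t - s.
  rewrite /s /t; set A := x - _; set B := _ - x.
  by case: (lerP A B); rewrite /A /B => ?; split; try split; lra.
have [|m Hm] := @pw_small _ (s / 4); first by lra.
have HΨi n : nle m n -> t - 2 * pw m <= rv (Ψ $ (ypt $ i)) (nS n).
  move=> /pw_le Hn; have := HE (nS n); have := real_close2 p (nS n) HΨq.
  rewrite pwS ltr_norml ler_norml /t => /andP[? ?] /andP[? ?]; lra.
split; apply: (@ev_ltR _ _ _ (s / 2) m); try lra; move=> n /HΨi Hn.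
  by rewrite lptE rv_rsub yptE !rv_rrat Ez; rewrite yptE in Hn; lra.
by rewrite rptE rv_radd yptE !rv_rrat Ez; rewrite yptE in Hn; lra.
Qed.

Let pieces_a := pa lpt rpt.
Let pieces_b := pb lpt rpt.

(** The indices [N] are arbitrary because the nested sums in [total_gt] evaluate the endpoints at an
    index depending on [i]. *)
Lemma grid_piece (x : QM M) (N : NM M -> NM M) : 0 <= x -> x < 1 ->
  (exists v, nlt v L /\ qv (c $ v) <= x <= qv (d $ v)) \/
  (exists i j, nlt i (nS K) /\ (nlt j (nS i) /\
     rv (pieces_a i j) (N i) - (pw (N i) + pw (N i)) <= x <=
     rv (pieces_b i j) (N i) + (pw (N i) + pw (N i)))).
Proof.
move=> H0 H1; case: (grid_cover H0 H1) => [|[i [z [Hi [Ez Hz]]]]]; [by left|right].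
have Hzr := isR_rrat z.
have [k Hk] := between (lpt_isR i) (rpt_isR i) Hzr Hz.
(* The first interval that contains the point; membership is Sigma-1, so a least index exists. *)
have [|i0 [k0 [Hk1 Hk2]] Hmin] := @least_S1 M (fun i k =>
    rv (lpt $ i) k + (pw k + pw k) < rv (rrat z) k /\
    rv (rrat z) k + (pw k + pw k) < rv (rpt $ i) k) _ i k Hk.
  by rewrite /Dec2; rauto.
have Hi0 : nle i0 K.
  apply: nle_trans Hi; apply: NNPP => /nltNge /Hmin /(_ k); exact.
have Hgap : inGap lpt rpt i0 (rrat z).
  split; first by split; [exists k0|exists k0].
  move=> [s [Hs Hzs]].
  have [k' Hk'] := between (lpt_isR s) (rpt_isR s) Hzr Hzs.
  exact: Hmin Hs k' Hk'.
have [j [Hj [H2 H3]]] := @gap_piece M ypt lpt rpt K (fun i _ => lpt_isR i)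
  (fun i _ => rpt_isR i) (fun i _ => ypt_isR i) (fun i _ => lpt_lt i)
  (fun i _ => rpt_gt i) ypt_lt i0 Hi0 (rrat z) Hzr Hgap.
exists i0, j; split; first exact/nltS.
split; first exact/nltS.
have := proj1 (leRP _ _) H2 (N i0).
have : LeR (rrat z) (pieces_b i0 j).
  apply: (@leR_trans _ _ (pg lpt rpt i0 j)) => //; last exact: pg_le_pb.
    exact: (@pg_isR M lpt rpt K (fun i _ => lpt_isR i) (fun i _ => rpt_isR i)).
  exact: (@pb_isR M lpt rpt K (fun i _ => lpt_isR i) (fun i _ => rpt_isR i)).
move/leRP/(_ (N i0)); rewrite rv_rrat Ez => *; apply/andP; split; lra.
Qed.
End GridPoints.

(** * The final estimate *)

Section Bound.
Context {M : gmodel}.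

Lemma qsum_ext (h g : NM M -> QM M) n : RQ1 h -> RQ1 g ->
  (forall j, h j = g j) -> qsum h n = qsum g n.
Proof.
move=> Hh Hg H; apply: le_anti; apply/andP.
by split; apply: ler_qsum => // j _; rewrite H.
Qed.

Variables (Ψ : M (one ⇒ one)) (e : M one).
Hypotheses (HΨ : Fun01 Ψ) (Hpos : Positive01 Ψ) (He : IsR e).
Variables c d : M one.
Hypotheses (Hcd : Intervals c d) (Htot : TotalLt c d e).
Variable L : NM M.
Hypothesis HL : forall j, nlt j (nexp L) -> exists e, nlt e L /\
  (lo Ψ c e < nq j * pw L /\ nq (nS j) * pw L < hi Ψ d e).

Let K := nexp L.
Let y := @ypt M L.
Let l := lpt Ψ L.
Let r := rpt Ψ L.
Let HlR i (_ : nle i K) : IsR (l $ i) := lpt_isR HΨ L i.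
Let HrR i (_ : nle i K) : IsR (r $ i) := rpt_isR HΨ L i.
Let HyR i (_ : nle i K) : IsR (y $ i) := ypt_isR L i.
Let Hly i (_ : nle i K) : LtR (l $ i) (y $ i) := lpt_lt HΨ Hpos L i.
Let Hyr i (_ : nle i K) : LtR (y $ i) (r $ i) := rpt_gt HΨ Hpos L i.

Variables aa bb : M (tN ⇒ tN ⇒ one).
Hypothesis Hab : forall i j, aa $ i $ j = pa l r i j /\ bb $ i $ j = pb l r i j.

Definition len : M (tN ⇒ one) :=
  fn (fun i => rsum (fn (fun j => rsub (bb $ i $ j) (aa $ i $ j))) (nS i)).

Lemma lenE i :
  len $ i = rsum (fn (fun j => rsub (bb $ i $ j) (aa $ i $ j))) (nS i).
Proof. by rewrite /len fnE //; rewrite /rsum; rauto. Qed.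

Lemma subE i j : fn (fun j => rsub (bb $ i $ j) (aa $ i $ j)) $ j =
  rsub (bb $ i $ j) (aa $ i $ j).
Proof. by rewrite fnE //; rauto. Qed.

Lemma aa_isR i j : nle i K -> nlt j (nS i) -> IsR (aa $ i $ j).
Proof.
by move=> Hi /nltS Hj; rewrite (Hab i j).1; exact: (pa_isR HlR HrR Hi Hj).
Qed.

Lemma bb_isR i j : nle i K -> nlt j (nS i) -> IsR (bb $ i $ j).
Proof.
by move=> Hi /nltS Hj; rewrite (Hab i j).2; exact: (pb_isR HlR HrR Hi Hj).
Qed.

Lemma aa_le_bb i j : LeR (aa $ i $ j) (bb $ i $ j).
Proof. by rewrite (Hab i j).1 (Hab i j).2; exact: pa_le_pb. Qed.

Lemma len_isR i : nle i K -> IsR (len $ i).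
Proof.
move=> Hi; rewrite lenE; apply: rsum_isR => j Hj; rewrite subE.
by apply: isR_rsub; [exact: bb_isR|exact: aa_isR].
Qed.

Lemma InJ_gap i z : InJ Ψ y i z <-> inGap l r i z.
Proof.
rewrite /InJ /InI /inGap /y -lptE -rptE -/l -/r.
split=> -[H1 H2]; split=> // -[j [Hj H]]; apply: H2; exists j; split=> //.
  by rewrite -lptE -rptE.
by rewrite lptE rptE.
Qed.

Lemma len_length i : nle i K -> LengthIs (InJ Ψ y i) (len $ i).
Proof.
move=> Hi; exists (nS i), (aa $ i), (bb $ i); split=> [j Hj|].
  by split; [exact: aa_isR|split; [exact: bb_isR|exact: aa_le_bb]].
split=> [j /nltS Hj|].
  rewrite (Hab i j).2 (Hab i (nS j)).1.
  exact: (pieces_ordered HlR HrR HyR Hly Hyr Hi Hj).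
split=> [z Hz Hne|]; last first.
  by rewrite lenE => n; rewrite subrr normr0; have := pw_gt0 n; lra.
have Hyy s j : nlt s j -> nle j K -> LtR (y $ s) (y $ j) by apply: ypt_lt.
have Hne' j : nlt j (nS i) -> ~ EqR z (pa l r i j) /\ ~ EqR z (pb l r i j).
  by move=> /Hne; rewrite (Hab i j).1 (Hab i j).2.
rewrite InJ_gap (gapP HlR HrR HyR Hly Hyr Hyy Hi Hz Hne').
split=> -[j [Hj H]]; exists j; split=> //; move: H;
  by rewrite (Hab i j).1 (Hab i j).2.
Qed.

Lemma total_gt : LtR (rsub (rrat c1) e) (rsum len (nS K)).
Proof.
have [δ [Hδ [Hδe Hsum]]] := Htot.
have [η [m [Hη Hm]]] := ltR_ev Hδ He Hδe.
(* The error in units of [2^-k]: one for each of the [L] prolonged intervals, and five for each of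
   at most [(K + 1)^2] pieces, namely one for the prolongation and four for approximating its
   endpoints. Of the remaining three, one comes from comparing [D] with [δ] and two from the
   definition of [LtR]. *)
set C := 3 + nq L + 5 * (nq (nS K) * nq (nS K)).
have HC : 0 < C.
  rewrite /C; have := nq_ge0 L; have := mulr_ge0 (nq_ge0 (nS K)) (nq_ge0 (nS K)).
  by move: (nq L) (_ * _) => *; lra.
have [k [Hk Hpk]] := @pw_small_ge M (η / C) m (divr_gt0 Hη HC).
rewrite ltr_pdivlMr // in Hpk.
have {}Hm := Hm (nS k) (nle_trans Hk (nleS k)).
exists k.
set D := qsum (fun v => qv (d $ v) - qv (c $ v)) L.
have HD : D <= rv δ (nS k) + pw k.
  have := proj1 (leRP _ _) (Hsum L) (nS k); rewrite rv_rsum pwS.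
  set S := qsum _ _; have -> : S = D.
    apply: qsum_ext; [by rauto|by rauto|move=> v].
    rewrite fnE; last by rauto.
    by rewrite rv_rrat qv_add qv_opp.
  by move=> ?; lra.
(* The index at which the endpoints enter [rv (rsum len (nS K)) k]: the outer sum adds [nS K], the
   inner one [nS i], and the difference of reals one more. *)
pose N i := nS (nadd (nadd k (nS K)) (nS i)).
pose T i j := rv (bb $ i $ j) (N i) - rv (aa $ i $ j) (N i).
pose p := pw k.
have HN i : pw (N i) <= pw k.
  apply: pw_le; apply: nle_trans (nleS _); apply: nle_trans (nle_addr _ _).
  exact: nle_addr.
have ET : rv (rsum len (nS K)) k = qsum (fun i => qsum (T i) (nS i)) (nS K).
  rewrite rv_rsum; apply: qsum_ext; [by rauto|by rewrite /T /N; rauto|move=> i].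
  rewrite lenE rv_rsum; apply: qsum_ext; [by rauto|by rewrite /T /N; rauto|move=> j].
  by rewrite subE rv_rsub.
have HT1 i : RQ1 (T i) by rewrite /T /N; rauto.
have HT2 : RQ1 (fun i => qsum (T i) (nS i)) by rewrite /T /N; rauto.
have Hsw : 1 <= qsum (fun v => qv (d $ v) - qv (c $ v) + p) L +
    qsum (fun i => qsum (fun j => rv (bb $ i $ j) (N i) + (pw (N i) + pw (N i)) -
      (rv (aa $ i $ j) (N i) - (pw (N i) + pw (N i))) + p) (nS i)) (nS K).
  (* The mesh is [2^-k] with the [k] of the approximation, so that all errors are multiples of the
     same [p]. *)
  apply: (@sweep M (fun v => qv (c $ v)) (fun v => qv (d $ v))
    (fun i j => rv (aa $ i $ j) (N i) - (pw (N i) + pw (N i)))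
    (fun i j => rv (bb $ i $ j) (N i) + (pw (N i) + pw (N i))) L (nS K) k).
  - by rauto.
  - by rauto.
  - by rewrite /N; rauto.
  - by rewrite /N; rauto.
  - by move=> v; exact: ltW (Hcd v).
  - move=> i j _ _ /=; have := proj1 (leRP _ _) (@aa_le_bb i j) (N i).
    by have := pw_gt0 (N i); lra.
  - move=> g /nq_le; rewrite nqS => Hg; have Hp := pw_gt0 k.
    have Hg1 : (nq g + 1) * pw k <= 1 by rewrite -[leRHS](pw_mul k) ler_pM2r.
    rewrite mulrDl mul1r in Hg1.
    have Hg0 : 0 <= nq g * pw k by rewrite mulr_ge0 ?nq_ge0 // ltW.
    have Hg2 : nq g * pw k < 1 by lra.
    case: (grid_piece HΨ Hpos HL N Hg0 Hg2) => [H|[i [j [Hi [Hj H]]]]]; [by left|right].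
    by exists i, j; rewrite (Hab i j).1 (Hab i j).2.
have HpC : qsum (fun v => qv (d $ v) - qv (c $ v) + p) L = D + nq L * p.
  by apply: qsum_addc; rauto.
have H5 : qsum (fun i => qsum (fun j => rv (bb $ i $ j) (N i) + (pw (N i) + pw (N i)) -
      (rv (aa $ i $ j) (N i) - (pw (N i) + pw (N i))) + p) (nS i)) (nS K) <=
      qsum (fun i => qsum (T i) (nS i)) (nS K) + nq (nS K) * (nq (nS K) * (5 * p)).
  rewrite -qsum_addc //; apply: ler_qsum; [by rewrite /N; rauto|by rauto|].
  move=> i /nq_le; rewrite nqS => Hi.
  apply: (@le_trans _ _ (qsum (fun j => T i j + 5 * p) (nS i))).
    apply: ler_qsum; [by rewrite /N; rauto|by rewrite /T /N; rauto|move=> j _].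
    by have := HN i; rewrite /T /p; lra.
  rewrite qsum_addc // lerD2l ler_wpM2r //; last by rewrite nqS.
  by rewrite /p; have := pw_gt0 k; lra.
rewrite rv_rsub rv_rrat qv_c1 ET.
move: Hsw; rewrite HpC => Hsw; move: (qsum _ _) (qsum _ _) Hsw H5 => S1 S2 Hsw H5.
have EC : pw k * C = 3 * p + nq L * p + nq (nS K) * (nq (nS K) * (5 * p)).
  by rewrite /C /p; move: (nq L) (nq (nS K)) (pw k) => *; nra.
rewrite EC in Hpk; rewrite -/p in HD *.
clearbody D p; move: (nq L * p) (nq (nS K) * _) Hsw H5 Hpk => *; lra.
Qed.
End Bound.

Lemma model_WHBU_ae (M : gmodel) (Ψ : M (one ⇒ one)) (e : M one) :
  Fun01 Ψ -> Positive01 Ψ -> ContAE Ψ -> IsR e -> LtR (rrat c0) e -> WHBU Ψ e.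
Proof.
move=> HΨ Hpos [a [b [_ [Hnull Hcont]]]] He He0.
have [c [d [Hcd [Htot Hcov]]]] := Hnull e He He0.
have [x Hx Hx01 Hdy|L HL] := @heine_borel M (lo Ψ c) (hi Ψ d) (rq_lo Ψ c) (rq_hi Ψ d).
  (* Membership in the closed set is decided classically outside the model; only the resulting code
     [e] matters. *)
  case: (pselect (InClosed a b x)) => Hab; first exact/cover_null/Hcov.
  by apply: cover_cont => //; exact: Hcont.
have [aa [bb Hab]] := pieces_rep (lpt Ψ L) (rpt Ψ L).
(* The last index is [2^L], so both endpoints 0 and 1 are among the points. *)
exists (nexp L), (ypt L); split=> [i _|].
  by split; [exact: ypt_isR|exact: ypt_in01].
split=> [i j Hij Hj E|].
  exact: (EqR_leR (EqR_sym E)) (ypt_lt Hij Hj).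
exists (len aa bb); split=> [i Hi|].
  by split; [exact: (len_isR HΨ Hab)|exact: (len_length HΨ Hpos Hab)].
exact: (total_gt HΨ Hpos He Hcd Htot HL Hab).
Qed.

Theorem theorem2 : proves (add_axiom RCA0w WKL) WHBU_ae.
Proof.
apply: provable_of_good => M gM.
pose G := {| gstruct := M; gmP := gM |}.
have -> := @sat_WHBU_ae G => Ψ HΨ Hpos Hc e; exact: model_WHBU_ae.
Qed.
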